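(* Let $G$ be an abelian pro-Lie Polish group. The following assertions are equivalent: (1) $G$ is projective in $\mathbf{proLiePAb}$; (2) $G$ is isomorphic to $\mathbb{Z}^{\alpha }\oplus ( \mathbb{Z}^{( \omega ) }) ^{\beta }\oplus \mathbb{R}^{\gamma }$ for some $\alpha ,\beta ,\gamma \in \omega +1$; (3) the set $\{ N\in \mathcal{N}( G) : G/N\text{ is projective in } \mathbf{LiePAb}\}$ is cofinal in $\mathcal{N}( G)$.
   Context: A Polish abelian group is an abelian topological group whose topology is Polish. An abelian Polish Lie group is a Polish abelian group isomorphic to $\mathbb{R}^{n}\oplus \mathbb{T}^{d}\oplus D$ with $n,d\in\omega$ and $D$ countable discrete; $\mathbf{LiePAb}$ is the category of abelian Polish Lie groups and continuous homomorphisms. For a Polish abelian group $G$, $\mathcal{N}(G)$ is the set of closed subgroups $N$ of $G$ such that $G/N$ is a Lie group, ordered by reverse inclusion (so a subset $\mathcal{S}\subseteq\mathcal{N}(G)$ is cofinal if every element of $\mathcal{N}(G)$ contains an element of $\mathcal{S}$). $G$ is pro-Lie if every neighborhood of $0$ contains an element of $\mathcal{N}(G)$. $\mathbf{proLiePAb}$ is the category of pro-Lie Polish abelian groups and continuous homomorphisms. In each of these categories, the short exact sequences are the sequences $0\to A\to B\to C\to 0$ of continuous homomorphisms that are algebraically exact with $A\to B$ a homeomorphism onto a closed subgroup; an object $P$ is projective if $\mathrm{Hom}(P,-)$ maps short exact sequences to short exact sequences of abelian groups (equivalently, every surjective continuous homomorphism onto $P$ from an object of the category has a right inverse that is a continuous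 homomorphism). $\mathbb{Z}^{(\omega)}$ is the free abelian group of countably infinite rank with the discrete topology; powers $X^{\alpha}$ with $\alpha\leq\omega$ are products of $\alpha$ copies with the product topology. *)

(* Defs.v *)
From HB Require Import structures.
From mathcomp Require Import all_boot all_order all_algebra ring_quotient.
From mathcomp.multinomials Require Import freeg.
From mathcomp Require Import all_classical all_reals topology normedtype.

Set Implicit Arguments.
Unset Strict Implicit.
Unset Printing Implicit Defensive.

Import GRing.Theory Num.Theory numFieldNormedType.Exports.

Local Open Scope classical_set_scope.
Local Open Scope ring_scope.


Section discrete_group.
Variable A : zmodType.

HB.instance Definition _ := GRing.Zmodule.copy (discrete_topology A) A.

Lemma discrete_sub_continuous :
  continuous (fun x : discrete_topology A * discrete_topology A => x.1 - x.2).
Proof.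
move=> [x y] /= U /nbhs_singleton Uxy.
exists ([set x], [set y]); first by split; exact: discrete_set1.
by move=> [u v] [/= -> ->].
Qed.

HB.instance Definition _ :=
  PreTopologicalNmodule_isTopologicalZmodule.Build (discrete_topology A)
    discrete_sub_continuous.

End discrete_group.

(* An alias of [A * B]: the canonical topological group structure of the latter
   is only inferred when [A] and [B] are topological vector spaces. *)
Definition dsum (A B : Type) : Type := (A * B)%type.

Section direct_sum.
Variables A B : topologicalZmodType.

HB.instance Definition _ := Topological.copy (dsum A B) (A * B)%type.
HB.instance Definition _ := GRing.Zmodule.copy (dsum A B) (A * B)%type.

Lemma dsum_sub_continuous :
  continuous (fun x : dsum A B * dsum A B => x.1 - x.2).
Proof.
move=> [[a b] [a' b']] /= U [[P Q] /= [nP nQ] PQU].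
have [[P1 P2] /= [nP1 nP2] sP] := @sub_continuous A (a, a') _ nP.
have [[Q1 Q2] /= [nQ1 nQ2] sQ] := @sub_continuous B (b, b') _ nQ.
exists (P1 `*` Q1, P2 `*` Q2) => /=.
  by split; [exists (P1, Q1) | exists (P2, Q2)].
move=> [[u v] [u' v']] /= [[? ?] [? ?]]; apply: PQU; split => /=.
- by apply: (sP (u, u')).
- by apply: (sQ (v, v')).
Qed.

HB.instance Definition _ :=
  PreTopologicalNmodule_isTopologicalZmodule.Build (dsum A B)
    dsum_sub_continuous.

End direct_sum.

Notation "A ⊕ B" := (dsum A B) (at level 50, left associativity) : type_scope.

Definition powg (I A : Type) : Type := {ptws I -> A}.

Section power_group.
Variables (I : Type) (A : topologicalZmodType).

HB.instance Definition _ := Topological.copy (powg I A) {ptws I -> A}.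
HB.instance Definition _ := GRing.Zmodule.copy (powg I A) (I -> A).

Lemma powg_sub_continuous :
  continuous (fun x : powg I A * powg I A => x.1 - x.2).
Proof.
have projc i : continuous ((fun f => f i) : powg I A -> A).
  exact: (@proj_continuous {classic I} (fun=> A) i).
move=> [f g]; apply/cvg_sup => i U [_ [[V oV <-] Vfg] VU].
have nV : nbhs (f i - g i) V by exact: open_nbhs_nbhs.
have [[P Q] /= [nP nQ] sPQ] := @sub_continuous A (f i, g i) _ nV.
exists ((fun h : powg I A => h i) @^-1` P, (fun h : powg I A => h i) @^-1` Q).
  by split; exact: projc.
by move=> [u v] [/= Pu Qv]; apply: VU; exact: (sPQ (u i, v i)).
Qed.

HB.instance Definition _ :=
  PreTopologicalNmodule_isTopologicalZmodule.Build (powg I A)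
    powg_sub_continuous.

End power_group.

Section quotient_group.
Variables (G : topologicalZmodType) (N : zmodClosed G).

Definition quotg : Type := quotient_topology (Quotient.quot N).

HB.instance Definition _ :=
  Topological.copy quotg (quotient_topology (Quotient.quot N)).
HB.instance Definition _ := GRing.isZmodule.Build quotg
  (@Quotient.addqA G N) (@Quotient.addqC G N)
  (@Quotient.add0q G N) (@Quotient.addNq G N).

Definition to_quotg : G -> quotg := \pi_(Quotient.quot N)%qT.

Lemma to_quotgB x y : to_quotg (x - y) = to_quotg x - to_quotg y.
Proof. exact: raddfB. Qed.

Lemma to_quotgP x y : reflect (to_quotg x = to_quotg y) (x - y \in N).
Proof. by rewrite Quotient.idealrBE; apply: (iffP eqP). Qed.

Lemma to_quotg_surj (u : quotg) : exists x, to_quotg x = u.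
Proof. by exists (repr (u : Quotient.quot N)); rewrite /to_quotg reprK. Qed.

Lemma to_quotg_continuous : continuous to_quotg.
Proof. exact: (@pi_continuous G (Quotient.quot N)). Qed.

Lemma to_quotg_open (A : set G) : open A -> open (to_quotg @` A).
Proof.
move=> oA; rewrite /open /= /quotient_open.
rewrite (_ : _ @^-1` _ = \bigcup_(n in [set` N]) ((fun x => x - n) @^-1` A)).
  apply: bigcup_open => n _; apply: open_comp => // x _.
  apply: (@continuous_comp _ _ _ (fun x => (x, n)) (fun x : G * G => x.1 - x.2)).
    by apply: cvg_pair; [exact: cvg_id | exact: cvg_cst].
  exact: sub_continuous.
apply/seteqP; split=> [x [a Aa /esym/to_quotgP xaN] | x [n Nn Axn]].
  by exists (x - a) => //=; rewrite subKr.
exists (x - n) => //; apply/esym/to_quotgP; rewrite subKr.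
exact: Nn.
Qed.

Lemma quotg_sub_continuous : continuous (fun x : quotg * quotg => x.1 - x.2).
Proof.
move=> [u v]; have [x <-] := to_quotg_surj u; have [y <-] := to_quotg_surj v.
have nbhs_img z (A : set G) : nbhs z A -> nbhs (to_quotg z) (to_quotg @` A).
  rewrite !nbhsE => -[B [oB Bz] BA].
  exists (to_quotg @` B); last exact: image_subset.
  by split; [exact: to_quotg_open | exists z].
rewrite /continuous_at /= -to_quotgB => W /to_quotg_continuous nW.
have [[A B] /= [nA nB] AB] := @sub_continuous G (x, y) _ nW.
exists (to_quotg @` A, to_quotg @` B); first by split; exact: nbhs_img.
move=> [_ _] [/= [a Aa <-] [b Bb <-]].
by rewrite -to_quotgB; exact: (AB (a, b)).
Qed.

HB.instance Definition _ :=
  PreTopologicalNmodule_isTopologicalZmodule.Build quotg quotg_sub_continuous.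

End quotient_group.

Definition cont_hom (A B : topologicalZmodType) : set (A -> B) :=
  [set f | zmod_morphism f /\ continuous f].
Arguments cont_hom : clear implicits.

Definition top_iso (A B : topologicalZmodType) : Prop :=
  exists f g, [/\ cont_hom A B f, cont_hom B A g, cancel f g & cancel g f].

Section polish.
Variables (R : realType) (T : topologicalType).

(* Nonnegativity follows from the three axioms. *)
Definition is_metric (d : T -> T -> R) : Prop :=
  [/\ forall x y, d x y = 0 <-> x = y,
      forall x y, d x y = d y x
    & forall x y z, d x z <= d x y + d y z].

Definition metrizes (d : T -> T -> R) : Prop :=
  forall (x : T) (U : set T),
    nbhs x U <-> exists2 e, 0 < e & [set y | d x y < e] `<=` U.

Definition metric_complete (d : T -> T -> R) : Prop :=
  forall u : nat -> T,
    (forall e, 0 < e ->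
       exists n0, forall m n, (n0 <= m)%N -> (n0 <= n)%N -> d (u m) (u n) < e) ->
    exists l : T, u @ \oo --> l.

Definition completely_metrizable : Prop :=
  exists d, [/\ is_metric d, metrizes d & metric_complete d].

Definition separable : Prop := exists2 S : set T, countable S & dense S.

Definition polish : Prop := separable /\ completely_metrizable.

End polish.

(* [Num.int], bundled as a subgroup. *)
Definition int_subgroup (R : realType) : zmodClosed R :=
  GRing.ZmodClosed.clone R (@archimedean.Num.int_num_subdef R) _.

Definition circle (R : realType) : topologicalZmodType :=
  @quotg R (int_subgroup R).

Definition lie_polish (R : realType) (G : topologicalZmodType) : Prop :=
  polish R G /\
  exists (n d : nat) (D : zmodType), countable [set: D] /\
    top_iso G (powg 'I_n R ⊕ powg 'I_d (circle R) ⊕ discrete_topology D).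

(* $\mathcal{N}(G)$; [zmodClosed G] is the type of subgroups of [G]. *)
Definition lie_kernels (R : realType) (G : topologicalZmodType) :
    set (zmodClosed G) :=
  [set N : zmodClosed G | closed [set` N] /\ lie_polish R (quotg N)].

Definition cofinal_lie_kernels (R : realType) (G : topologicalZmodType)
    (S : set (zmodClosed G)) : Prop :=
  forall N, lie_kernels R N -> exists2 M, S M & {subset M <= N}.

Definition pro_lie_polish (R : realType) (G : topologicalZmodType) : Prop :=
  polish R G /\
  forall U : set G, nbhs 0 U -> exists2 N, lie_kernels R N & [set` N] `<=` U.

Definition closed_embedding (A B : topologicalType) (i : A -> B) : Prop :=
  [/\ injective i, continuous i, closed (range i)
    & forall U, open U -> exists2 V, open V & i @` U = V `&` range i].

Definition short_exact (A B C : topologicalZmodType) (i : A -> B) (p : B -> C) :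
    Prop :=
  [/\ cont_hom A B i, cont_hom B C p, closed_embedding i,
      range i = [set b | p b = 0] & range p = [set: C]].

(* Exactness of [0 -> Hom(P, A) -> Hom(P, B) -> Hom(P, C) -> 0]. *)
Definition hom_short_exact (P A B C : topologicalZmodType)
    (i : A -> B) (p : B -> C) : Prop :=
  [/\ set_inj (cont_hom P A) (fun f => i \o f),
      [set i \o f | f in cont_hom P A] =
        [set g | cont_hom P B g /\ p \o g = cst 0]
    & [set p \o g | g in cont_hom P B] = cont_hom P C].

(* [Ob] selects the objects of a full subcategory of the category of topological
   abelian groups. *)
Definition projective_in (Ob : topologicalZmodType -> Prop)
    (P : topologicalZmodType) : Prop :=
  Ob P /\
  forall (A B C : topologicalZmodType) (i : A -> B) (p : B -> C),
    Ob A -> Ob B -> Ob C -> short_exact i p -> hom_short_exact P i p.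

(* An element of [omega + 1] is encoded as [option nat], with [None] standing
   for [omega]; it is sent to an index type with that many elements. *)
Definition index_type (a : option nat) : Type :=
  if a is Some n then 'I_n else nat.

Definition projective_model (R : realType) (a b c : option nat) :
    topologicalZmodType :=
  powg (index_type a) (discrete_topology int)
  ⊕ powg (index_type b) (discrete_topology {freeg nat})
  ⊕ powg (index_type c) R.

(* Main.v *)
(* Everything is deduced from one lifting principle. Let q : B -> C be an open
   surjection whose kernel is locally a real vector space, and let f : P -> C be a
   homomorphism. A set-theoretic lift of f that is additive up to small elements
   of the kernel can be corrected to a homomorphism by Hyers' averaging. Such
   almost additive lifts exist for free groups, for R (lift [0, r) with small
   values and extend along r Z) and for arbitrary powers of such groups (lift
   finitely many coordinates, and the small tail subgroup with small values).
   For a short exact sequence A -> B -> C, the projection is open by the open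
   mapping theorem, and B is the limit of the groups B/N with N in N(A); the
   successive kernels are closed subgroups of Lie groups, hence locally vector
   spaces, so that one lifts step by step. This gives (2) => (1).
   A Lie group L is a quotient of R^m + Z^(omega) by a countable subgroup. If G is
   projective, a quotient map G -> L lifts to this cover; the lift is open by Baire
   category, so its image is R^m plus a free group: this gives (1) => (3).
   Finally (3) provides a tower of quotients G/N_k = R^m + free; the lifting
   principle splits each N_k/N_(k+1) off, and summing the sections over k yields
   (3) => (2). *)
Require Import Defs.
From HB Require Import structures.
From mathcomp Require Import all_boot all_order all_algebra ring_quotient.
From mathcomp.multinomials Require Import freeg.
From mathcomp Require Import all_classical all_reals topology normedtype.
From mathcomp Require Import zify lra.

Set Implicit Arguments.
Unset Strict Implicit.
Unset Printing Implicit Defensive.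

Import Order.TTheory GRing.Theory Num.Theory numFieldNormedType.Exports.

Local Open Scope classical_set_scope.
Local Open Scope ring_scope.

(** * Identities in abelian groups *)

Inductive zterm := ZVar of nat | ZZero | ZAdd of zterm & zterm | ZOpp of zterm
  | ZMuln of zterm & nat.

Section zterm_eval.
Variable G : zmodType.

Fixpoint zeval (env : seq G) (t : zterm) : G :=
  match t with
  | ZVar i => env`_i
  | ZZero => 0
  | ZAdd a b => zeval env a + zeval env b
  | ZOpp a => - zeval env a
  | ZMuln a n => zeval env a *+ n
  end.

Fixpoint zcoef (t : zterm) (i : nat) : int :=
  match t with
  | ZVar j => (i == j)%:Z
  | ZZero => 0
  | ZAdd a b => zcoef a i + zcoef b i
  | ZOpp a => - zcoef a i
  | ZMuln a n => zcoef a i * n%:Z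
  end.

Fixpoint zbound (n : nat) (t : zterm) : bool :=
  match t with
  | ZVar j => (j < n)%N
  | ZZero => true
  | ZAdd a b => zbound n a && zbound n b
  | ZOpp a => zbound n a
  | ZMuln a _ => zbound n a
  end.

Lemma zeval_coef env t : zbound (size env) t ->
  zeval env t = \sum_(i < size env) env`_i *~ zcoef t i.
Proof.
elim: t => [j||a IHa b IHb|a IHa|a IHa n] /=.
- move=> jn; rewrite (bigD1 (Ordinal jn)) //= eqxx mulr1z big1 ?addr0 // => i.
  by rewrite -val_eqE /= => /negPf ->; rewrite mulr0z.
- by move=> _; rewrite big1 // => i _; rewrite mulr0z.
- by case/andP => /IHa-> /IHb->; rewrite -big_split; apply: eq_bigr => i _; rewrite mulrzDr.
- by move=> /IHa->; rewrite -sumrN; apply: eq_bigr => i _; rewrite mulrNz.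
- move=> /IHa->; rewrite -sumrMnl; apply: eq_bigr => i _.
  by rewrite pmulrn -mulrzA.
Qed.

(** The premise is a closed boolean after reification, so [abel] settles it by computation. *)
Lemma zterm_eq env t1 t2 :
  [&& zbound (size env) t1, zbound (size env) t2
    & all (fun i => zcoef t1 i == zcoef t2 i) (iota 0 (size env))] ->
  zeval env t1 = zeval env t2.
Proof.
case/and3P => b1 b2 /allP e; rewrite !zeval_coef //; apply: eq_bigr => i _.
by rewrite (eqP (e i _)) // mem_iota /= add0n.
Qed.

End zterm_eval.

(* Atoms are compared up to conversion, as the same sum may be elaborated along
   different paths of the algebraic hierarchy. *)
Ltac zlook x l :=
  match l with
  | cons ?y _ => let _ := match constr:(tt) with _ => unify x y end in constr:(O)
  | cons _ ?l' => let n := zlook x l' in constr:(S n)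
  end.

Ltac zadd_atom x l :=
  match l with
  | _ => let _ := zlook x l in l
  | _ => constr:(cons x l)
  end.

Ltac zatoms t l :=
  lazymatch t with
  | (?a + ?b)%R => let l1 := zatoms a l in zatoms b l1
  | (- ?a)%R => zatoms a l
  | (?a *+ S ?n)%R => zatoms a l
  | 0%R => l
  | _ => zadd_atom t l
  end.

Ltac zreify t l :=
  lazymatch t with
  | (?a + ?b)%R => let u := zreify a l in let v := zreify b l in constr:(ZAdd u v)
  | (- ?a)%R => let u := zreify a l in constr:(ZOpp u)
  | (?a *+ S ?n)%R => let u := zreify a l in constr:(ZMuln u (S n))
  | 0%R => constr:(ZZero)
  | _ => let n := zlook t l in constr:(ZVar n)
  end.

Ltac abel :=
  lazymatch goal with
  | |- @eq ?T ?a ?b =>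
    let l0 := constr:(@nil T) in
    let l1 := zatoms a l0 in let l := zatoms b l1 in
    let u := zreify a l in let v := zreify b l in
    change (zeval l u = zeval l v); apply: zterm_eq; vm_compute; reflexivity
  end.

(** * Topological abelian groups near zero *)

Section basics.
Variable G : topologicalZmodType.
Implicit Types (U V : set G) (x y : G).

Lemma nbhs_shift x U : nbhs x U <-> nbhs 0 [set y | U (x + y)].
Proof.
have cadd (z : G) : continuous (fun y : G => y - z).
  move=> y; apply: (@continuous_comp _ _ _ (fun y => (y, z)) (fun w : G * G => w.1 - w.2)).
    by apply: cvg_pair; [exact: cvg_id | exact: cvg_cst].
  exact: sub_continuous.
split=> [nU|nU].
  have : nbhs 0 [set y | U (y - - x)].
    by apply: cadd; rewrite /= sub0r opprK.
  by apply: filterS => y /=; rewrite opprK addrC.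
have : nbhs x [set y | [set z | U (x + z)] (y - x)].
  by apply: cadd; rewrite /= subrr.
by apply: filterS => y /=; rewrite addrC subrK.
Qed.

Lemma nbhs0_sub U : nbhs 0 U ->
  exists2 V, nbhs 0 V & forall x y, V x -> V y -> U (x - y).
Proof.
move=> nU; have := @sub_continuous G (0, 0); rewrite /continuous_at /= subrr.
move=> /(_ _ nU) [[P Q] /= [nP nQ] PQ]; exists (P `&` Q); first exact: filterI.
by move=> x y [Px _] [_ Qy]; exact: (PQ (x, y)).
Qed.

Lemma nbhs0_half U : nbhs 0 U -> exists V, [/\ nbhs 0 V,
  forall x, V x -> V (- x), forall x y, V x -> V y -> U (x + y) & V `<=` U].
Proof.
move=> nU; have [V nV VU] := nbhs0_sub nU.
have V0 : V 0 by exact: nbhs_singleton.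
have [W nW WV] := nbhs0_sub nV.
have W0 : W 0 by exact: nbhs_singleton.
exists [set x | V x /\ V (- x)]; split.
- apply: filterI => //; apply: filterS nW => x Wx.
  by rewrite /= -sub0r; exact: WV.
- by move=> x [? ?]; rewrite /= opprK.
- by move=> x y [? _] [_ ?]; rewrite -[y]opprK; exact: VU.
- by move=> x [? _]; rewrite -[x]subr0; exact: VU.
Qed.

Lemma nbhs0_quarter U : nbhs 0 U -> exists V, [/\ nbhs 0 V,
  forall x, V x -> V (- x),
  forall x y z t, V x -> V y -> V z -> V t -> U (x + y + z + t) & V `<=` U].
Proof.
move=> /nbhs0_half [V [nV sV VU VsU]]; have [W [nW sW WV WsV]] := nbhs0_half nV.
exists W; split => // [x y z t ? ? ? ?|x /WsV /VsU //].
by rewrite -addrA; apply: VU; exact: WV.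
Qed.

Lemma closed_near (A : set G) x : closed A ->
  (forall U, nbhs 0 U -> exists2 y, A y & U (y - x)) -> A x.
Proof.
move=> cA h; apply: cA => U /nbhs_shift /h [y Ay /= Uy]; exists y; split => //.
by rewrite addrC subrK in Uy.
Qed.

Lemma open_near (A : set G) :
  (forall x, A x -> nbhs 0 [set y | A (x + y)]) -> open A.
Proof. by move=> h; rewrite openE => x Ax; apply/nbhs_shift/h. Qed.

Definition first_countable := exists U : nat -> set G,
  (forall k, nbhs 0 (U k)) /\ forall W, nbhs 0 W -> exists k, U k `<=` W.
Definition separated := forall x, (forall U, nbhs 0 U -> U x) -> x = 0.
Definition gcauchy (u : nat -> G) := forall U, nbhs 0 U ->
  exists k, forall m n, (k <= m)%N -> (k <= n)%N -> U (u m - u n).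
Definition gcvg (u : nat -> G) (l : G) := forall U, nbhs 0 U ->
  exists k, forall n, (k <= n)%N -> U (u n - l).
Definition gcomplete := forall u, gcauchy u -> exists l, gcvg u l.
(** The form in which separability is used: no dense set appears, only countable covers by
    translates. *)
Definition narrow := forall U, nbhs 0 U -> exists s : nat -> G,
  forall x, exists n, U (x - s n).
Definition baire := forall F : nat -> set G, (forall n, closed (F n)) ->
  (forall x, exists n, F n x) -> exists n x, nbhs x (F n).

Lemma separated_eq x y : separated -> (forall U, nbhs 0 U -> U (x - y)) -> x = y.
Proof. by move=> sep h; apply/eqP; rewrite -subr_eq0; apply/eqP; exact: sep. Qed.

(** Such a base replaces a geometric series: increments taken in [U k.+1], [U k.+2], and so on have
    all their partial sums in [U k]. *)
Lemma decreasing_base : first_countable -> exists U : nat -> set G,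
  [/\ forall k, nbhs 0 (U k), forall W, nbhs 0 W -> exists k, U k `<=` W,
      forall k x y, U k.+1 x -> U k.+1 y -> U k (x + y),
      forall k x, U k x -> U k (- x) & forall k, U k.+1 `<=` U k].
Proof.
move=> [U [nU bU]].
pose good k (V : set G) := nbhs 0 V /\ (forall x, V x -> V (- x)) /\ V `<=` U k.
pose nxt (V W : set G) := (forall x y, W x -> W y -> V (x + y)) /\ W `<=` V.
have step (s : {p : nat * set G | good p.1 p.2}) :
    {t : {p : nat * set G | good p.1 p.2} |
      (sval t).1 = (sval s).1.+1 /\ nxt (sval s).2 (sval t).2}.
  apply: cid; case: s => -[k V] /= [nV [sV VU]].
  have [W [nW sW WV WsV]] := nbhs0_half (filterI nV (nU k.+1)).
  have gW : good k.+1 W by do 2!split => //; move=> x /WsV [].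
  exists (exist _ (k.+1, W) gW); split => //; split=> [x y Wx Wy|x /WsV[]//].
  by have [] := WV _ _ Wx Wy.
have [V [nV sV _ VU]] := nbhs0_half (nU 0%N).
have gV : good 0%N V by [].
have [f [f0 fS]] := dependent_choice step (exist (fun p => good p.1 p.2) (0%N, V) gV).
have fk k : (sval (f k)).1 = k by elim: k => [|k IH]; [rewrite f0|rewrite (fS k).1 IH].
exists (fun k => (sval (f k)).2); split.
- by move=> k; have [] := svalP (f k).
- move=> W /bU [k kW]; exists k; apply: subset_trans kW.
  by have := (svalP (f k)).2.2; rewrite fk.
- by move=> k; have [_ []] := fS k.
- by move=> k; have [_ []] := svalP (f k).
- by move=> k; have [_ []] := fS k.
Qed.

Lemma base_decr (U : nat -> set G) : (forall k, U k.+1 `<=` U k) ->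
  forall m n, (m <= n)%N -> U n `<=` U m.
Proof.
move=> dU m n /subnK <-; elim: (n - m)%N => [//|k IH] x; rewrite addSn => /dU.
exact: IH.
Qed.

End basics.
Arguments first_countable : clear implicits.
Arguments separated : clear implicits.
Arguments gcomplete : clear implicits.
Arguments narrow : clear implicits.
Arguments baire : clear implicits.

Lemma step_choice (T : Type) (P : nat -> T -> Prop) (Q : nat -> T -> T -> Prop) x0 :
  P 0%N x0 -> (forall k x, P k x -> exists y, P k.+1 y /\ Q k x y) ->
  exists f, f 0%N = x0 /\ forall k, P k (f k) /\ Q k (f k) (f k.+1).
Proof.
move=> P0 h.
have step (s : {p : nat * T | P p.1 p.2}) : {t : {p : nat * T | P p.1 p.2} |
    (sval t).1 = (sval s).1.+1 /\ Q (sval s).1 (sval s).2 (sval t).2}.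
  apply: cid; case: s => -[k x] /= /h [y [Py Qy]].
  by exists (exist (fun p => P p.1 p.2) (k.+1, y) Py).
have [f [f0 fS]] := dependent_choice step (exist (fun p => P p.1 p.2) (0%N, x0) P0).
have fk k : (sval (f k)).1 = k by elim: k => [|k IH]; [rewrite f0|rewrite (fS k).1 IH].
exists (fun k => (sval (f k)).2); split=> [|k]; first by rewrite f0.
by split; [have := svalP (f k)|have := (fS k).2]; rewrite fk.
Qed.

Section hom_lemmas.
Variables (A B : topologicalZmodType) (f : A -> B).

Lemma cont_homP : cont_hom A B f <->
  (forall x y, f (x - y) = f x - f y) /\
  (forall U, nbhs 0 U -> nbhs 0 (f @^-1` U)).
Proof.
split=> [[h c]|[h c]].
  split=> // U nU; apply: c; suff -> : f 0 = 0 by [].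
  by rewrite -[0 in LHS](subrr 0) h subrr.
have f0 : f 0 = 0 by rewrite -[0 in LHS](subrr 0) h subrr.
have fD x y : f (x + y) = f x + f y.
  by rewrite -[y in LHS]opprK -[- y in LHS]sub0r !h f0; abel.
split=> // x U /nbhs_shift /c nU; apply/nbhs_shift.
by apply: filterS nU => y /=; rewrite fD.
Qed.

Hypothesis hf : cont_hom A B f.

Lemma chomB x y : f (x - y) = f x - f y. Proof. exact: hf.1. Qed.
Lemma chom0 : f 0 = 0. Proof. by rewrite -(subrr 0) chomB subrr. Qed.
Lemma chomN x : f (- x) = - f x. Proof. by rewrite -sub0r chomB chom0 sub0r. Qed.
Lemma chomD x y : f (x + y) = f x + f y.
Proof. by rewrite -{1}[y]opprK chomB chomN opprK. Qed.
Lemma chomMn x n : f (x *+ n) = f x *+ n.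
Proof. by elim: n => [|n IH]; rewrite ?mulr0n ?chom0 // !mulrS chomD IH. Qed.
Lemma chomMz x (n : int) : f (x *~ n) = f x *~ n.
Proof.
by case: n => n; [rewrite -!pmulrn chomMn|rewrite !NegzE !mulrNz -!pmulrn chomN chomMn].
Qed.
Lemma chom_sum I (r : seq I) (F : I -> A) :
  f (\sum_(i <- r) F i) = \sum_(i <- r) f (F i).
Proof.
elim: r => [|i r IH]; first by rewrite !big_nil chom0.
by rewrite !big_cons chomD IH.
Qed.
Lemma chom_nbhs U : nbhs 0 U -> nbhs 0 (f @^-1` U).
Proof. by case/cont_homP: hf => _; exact. Qed.
Lemma chom_inj : (forall x, f x = 0 -> x = 0) -> injective f.
Proof.
move=> h x y e; apply/eqP; rewrite -subr_eq0; apply/eqP/h.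
by rewrite chomB e subrr.
Qed.

End hom_lemmas.

(** By translation, a homomorphism with this property is an open map. *)
Definition open_at0 (A B : topologicalZmodType) (f : A -> B) :=
  forall U, nbhs 0 U -> nbhs 0 (f @` U).

Lemma cont_hom_id (A : topologicalZmodType) : cont_hom A A id.
Proof. by apply/cont_homP. Qed.

Lemma cont_hom_comp (A B C : topologicalZmodType) (f : A -> B) (g : B -> C) :
  cont_hom A B f -> cont_hom B C g -> cont_hom A C (g \o f).
Proof.
move=> hf hg; apply/cont_homP; split=> [x y|U nU] /=; first by rewrite (chomB hf) (chomB hg).
exact: chom_nbhs hf _ (chom_nbhs hg nU).
Qed.

Lemma cont_homD (A B : topologicalZmodType) (f g : A -> B) :
  cont_hom A B f -> cont_hom A B g -> cont_hom A B (fun x => f x + g x).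
Proof.
move=> hf hg; apply/cont_homP; split=> [x y|U /nbhs0_half [V [nV _ VU _]]].
  by rewrite (chomB hf) (chomB hg); abel.
apply: filterS (filterI (chom_nbhs hf nV) (chom_nbhs hg nV)) => x [? ?].
exact: VU.
Qed.

Lemma cont_hom0 (A B : topologicalZmodType) : cont_hom A B (fun=> 0).
Proof.
apply/cont_homP; split=> [x y|U nU]; first by rewrite subr0.
by apply: filterS filterT => x _; exact: nbhs_singleton nU.
Qed.

Lemma cont_hom_sum (A B : topologicalZmodType) I (r : seq I) (F : I -> A -> B) :
  (forall i, cont_hom A B (F i)) -> cont_hom A B (fun x => \sum_(i <- r) F i x).
Proof.
move=> h; elim: r => [|i r IH].
  by under eq_fun do rewrite big_nil; exact: cont_hom0.
by under eq_fun do rewrite big_cons; exact: cont_homD.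
Qed.

(** Inclusion rather than equality, so that the empty set is allowed; [x0] is the value at the
    integers that enumerate nothing. *)
Lemma countable_enum (T : choiceType) (S : set T) (x0 : T) : countable S ->
  exists s : nat -> T, S `<=` range s.
Proof.
move/countable_injP => [f fi].
exists (fun n => if pselect (exists2 x, S x & f x = n) is left h
                 then projT1 (cid2 h) else x0) => x Sx.
exists (f x) => //; case: pselect => [h|[]]; last by exists x.
by case: (cid2 h) => y Sy fy /=; apply: fi => //; rewrite inE.
Qed.

(** * Completeness, the Baire property and the open mapping theorem *)

Section polish_groups.
Variables (R : realType) (G : topologicalZmodType).

Lemma half_pow_small (e : R) : 0 < e -> exists k, 2^-1 ^+ k < e.
Proof.
move=> e0; have [n hn] : exists n : nat, e^-1 < n%:R.
  by exists (Num.bound e^-1); apply: archi_boundP; rewrite invr_ge0 ltW.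
exists n; rewrite exprVn invf_plt ?posrE ?exprn_gt0 //.
apply: lt_le_trans hn _; rewrite -natrX ler_nat; exact/ltnW/ltn_expl.
Qed.

Hypothesis pG : polish R G.

Lemma polish_first_countable : first_countable G.
Proof.
case: pG => _ [d [md bd _]].
exists (fun k => [set y | d 0 y < 2^-1 ^+ k]); split=> [k|W /bd [e e0 eW]].
  by apply/bd; exists (2^-1 ^+ k) => //; rewrite exprn_gt0 // invr_gt0.
have [k hk] := half_pow_small e0; exists k => y /= dy; apply: eW.
exact: lt_trans dy hk.
Qed.

Lemma polish_separated : separated G.
Proof.
case: pG => _ [d [[d0 dC dT] bd _]] x h; apply/esym/d0/eqP.
have dge0 : 0 <= d 0 x.
  have := dT 0 x 0; rewrite (dC x 0) (proj2 (d0 0 0) erefl); lra.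
rewrite eq_le dge0 andbT leNgt; apply/negP => dx.
have : nbhs 0 [set y | d 0 y < d 0 x] by apply/bd; exists (d 0 x).
by move=> /h /=; rewrite ltxx.
Qed.

Lemma polish_narrow : narrow G.
Proof.
case: pG => -[S cS dS] _ U /nbhs0_sub [V nV VU].
have [s hs] := countable_enum 0 cS.
exists s => x.
have : nbhs x [set y | V (x - y)].
  apply/nbhs_shift => /=; have [W [nW sW _ WV]] := nbhs0_half nV.
  apply: filterS nW => y Wy /=; have -> : x - (x + y) = - y by abel.
  exact/WV/sW.
rewrite nbhsE => -[O [oO Ox] OV].
have [y [Oy /hs [n _ sn]]] := dS O (ex_intro _ x Ox) oO.
exists n; rewrite sn; rewrite -[x - y]subr0; apply: VU; first exact: OV.
exact: nbhs_singleton nV.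
Qed.

Lemma metric_series_cauchy (d : G -> G -> R) (z : nat -> G) :
  is_metric d -> (forall k, d (z k) (z k.+1) < 2^-1 ^+ k) ->
  forall e, 0 < e -> exists n0, forall m n, (n0 <= m)%N -> (n0 <= n)%N -> d (z m) (z n) < e.
Proof.
move=> [d0 dC dT] h e e0.
(* The exact partial sum of the geometric series, because the cruder bound [2 * 2^-m] would not pass
   through the induction. *)
have hd m j : d (z m) (z (m + j)%N) <= 2 * 2^-1 ^+ m - 2 * 2^-1 ^+ (m + j).
  elim: j => [|j IH]; first by rewrite addn0 (proj2 (d0 _ _) erefl); lra.
  rewrite addnS; apply: le_trans (dT _ (z (m + j)%N) _) _.
  have := h (m + j)%N; rewrite exprS; lra.
have pw k : 0 < (2^-1 : R) ^+ k by rewrite exprn_gt0 // invr_gt0.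
(* Two tails starting at [k] are compared, each at most [2 * 2^-k < e / 2]. *)
have [k hk] := half_pow_small (divr_gt0 e0 (ltr0n R 4)).
exists k => m n km kn.
have hz l : (k <= l)%N -> d (z k) (z l) <= 2 * 2^-1 ^+ k.
  by move=> /subnKC <-; apply: le_trans (hd _ _) _; have := pw (k + (l - k))%N; lra.
apply: le_lt_trans (dT _ (z k) _) _; rewrite dC.
by have := hz _ km; have := hz _ kn; lra.
Qed.

(* Klee's argument: for a Cauchy sequence u, one builds z and y = z + u_(n k)
   moving alternately, each step being small for the given complete metric at
   the current point; both converge, and u tends to the difference of limits. *)
Lemma polish_complete : gcomplete G.
Proof.
case: (pG) => _ [d [md bd cd]] u cu.
have d0 x : d x x = 0 by case: md => h _ _; apply/h.
have small k (x : G) : exists m, forall l l', (m <= l)%N -> (m <= l')%N ->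
    d x (x + (u l - u l')) < 2^-1 ^+ k.
  have : nbhs x [set y | d x y < 2^-1 ^+ k].
    by apply/bd; exists (2^-1 ^+ k) => //; rewrite exprn_gt0 // invr_gt0.
  by move=> /nbhs_shift /cu [m hm]; exists m => l l' ? ?; exact: hm.
pose P k (s : G * nat) := (k <= s.2)%N /\ forall l, (s.2 <= l)%N ->
   d s.1 (s.1 + (u s.2 - u l)) < 2^-1 ^+ k.
pose Q k (s t : G * nat) := d s.1 t.1 < 2^-1 ^+ k /\
   d (s.1 + u s.2) (t.1 + u t.2) < 2^-1 ^+ k.
have [n0 h0] := small 0%N 0.
have P0 : P 0%N (0, n0) by split=> // l hl; exact: h0.
have step k s : P k s -> exists t, P k.+1 t /\ Q k s t.
  case: s => z n [/= kn hn]; have [m hm] := small k (z + u n).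
  (* [z'] absorbs the change of index from [n] to [m']: since [z' + u m' = z + u n], the point [y]
     stays put while [z] moves. Then [y] moves alone, by [u n' - u m']. *)
  pose m' := maxn m n; pose z' := z + u n - u m'.
  have [p hp] := small k.+1 z'; pose n' := maxn k.+1 (maxn m' p).
  exists (z', n'); do 2!split => /=.
  - by rewrite /n'; lia.
  - by move=> l nl; apply: hp; rewrite /n' in nl *; lia.
  - by rewrite /z' -addrA; apply: hn; rewrite /m'; lia.
  - have -> : z' + u n' = z + u n + (u n' - u m') by rewrite /z'; abel.
    by apply: hm; rewrite /n' /m'; lia.
have [s [_ hs]] := step_choice P0 step.
have [z zl] := cd _ (metric_series_cauchy md (fun k => (hs k).2.1)).
have [y yl] := cd (fun k => (s k).1 + u (s k).2) (metric_series_cauchy md (fun k => (hs k).2.2)).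
exists (y - z) => U /nbhs0_quarter [V [nV sV VU _]].
have ev (w : nat -> G) l : w @ \oo --> l -> exists k, forall n, (k <= n)%N -> V (w n - l).
  move=> wl; have : nbhs l [set x | V (x - l)].
    by apply/nbhs_shift; apply: filterS nV => x /=; rewrite addrC addKr.
  by move=> /wl [k _ hk]; exists k => n /hk.
have [k1 h1] := ev _ _ zl; have [k2 h2] := ev _ _ yl; have [k3 h3] := cu _ nV.
exists k3 => n kn; pose k := maxn k1 (maxn k2 k3).
have -> : u n - (y - z) = (u n - u (s k).2) + ((s k).1 + u (s k).2 - y)
   + (- ((s k).1 - z)) + 0 by abel.
have kk : (k <= (s k).2)%N by have [] := (hs k).1.
apply: VU; last exact: nbhs_singleton nV.
- by apply: h3 => //; apply: leq_trans kk; rewrite /k; lia.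
- by apply: h2; rewrite /k; lia.
- by apply/sV/h1; rewrite /k; lia.
Qed.

End polish_groups.

Section baire_om.

Lemma base_cauchy (G : topologicalZmodType) (U : nat -> set G) (s : nat -> G) :
  (forall W, nbhs 0 W -> exists k, U k `<=` W) ->
  (forall k x y, U k.+1 x -> U k.+1 y -> U k (x + y)) ->
  (forall k x, U k x -> U k (- x)) -> (forall k, nbhs 0 (U k)) ->
  (forall k, U k.+1 (s k.+1 - s k)) ->
  gcauchy s /\ forall k n, (k <= n)%N -> U k (s n - s k).
Proof.
move=> bU aU sU nU hs.
have hk n k : U k (s (k + n)%N - s k).
  elim: n k => [|n IH] k; first by rewrite addn0 subrr; exact: nbhs_singleton.
  have -> : s (k + n.+1)%N - s k = (s (k.+1 + n)%N - s k.+1) + (s k.+1 - s k).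
    by rewrite addnS addSn; abel.
  exact: aU.
split=> [W /bU [k kW]|k n /subnKC <- //].
exists k.+1 => m n km kn; apply: kW.
have -> : s m - s n = (s m - s k.+1) + (- (s n - s k.+1)) by abel.
by apply: aU; [|apply: sU]; rewrite -(subnKC km, subnKC kn).
Qed.

Lemma complete_baire (G : topologicalZmodType) :
  first_countable G -> gcomplete G -> baire G.
Proof.
move=> /decreasing_base [U [nU bU aU sU dU]] cG F cF covF.
apply: contrapT => noint.
have avoid n x k : exists y, U k (y - x) /\ exists m, forall z, U m (z - y) -> ~ F n z.
  apply: contrapT => h; apply: noint; exists n, x; apply/nbhs_shift.
  apply: filterS (nU k) => v Uv; apply: closed_near (cF n) _ => W nW.
  apply: contrapT => h2; apply: h; exists (x + v); split.
    by rewrite addrC addKr.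
  have [m mW] := bU _ nW; exists m => z Uz Fz; apply: h2; exists z => //.
  exact: mW.
(* A state is a center with the index of a neighborhood; from stage [k'.+1] on, the translate of
   [U s.2] misses [F k']. *)
pose P k (s : G * nat) := (k <= s.2)%N /\ if k is k'.+1 then forall z, U s.2 (z - s.1) -> ~ F k' z else True.
(* Two indices are spent: increments in [U s.2.+2] keep all later centers within [U s.2.+1], and
   their limit within [U s.2]. *)
pose Q (k : nat) (s t : G * nat) := U s.2.+2 (t.1 - s.1) /\ (s.2 < t.2)%N.
have P0 : P 0%N (0, 0%N) by [].
have step k s : P k s -> exists t, P k.+1 t /\ Q k s t.
  case: s => x n [/= kn _]; have [y [Uy [m hm]]] := avoid k x n.+2.
  exists (y, maxn n.+1 m); split; last by split => //=; lia.
  split=> [|z Uz] /=; first by lia.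
  by apply: hm; apply: (base_decr dU _ Uz); exact: leq_maxr.
have [s [_ hs]] := step_choice P0 step.
have sk k : (k <= (s k).2)%N by have [] := (hs k).1.
have tail k n : U (s k).2.+1 ((s (k + n)%N).1 - (s k).1).
  elim: n k => [|n IH] k; first by rewrite addn0 subrr; exact: nbhs_singleton.
  have -> : (s (k + n.+1)%N).1 - (s k).1 = ((s (k.+1 + n)%N).1 - (s k.+1).1) + ((s k.+1).1 - (s k).1).
    by rewrite addnS addSn; abel.
  have [_ [hU hlt]] := hs k; apply: aU => //.
  exact: (base_decr dU _ (IH k.+1)).
have cs : gcauchy (fun k => (s k).1).
  move=> W /bU [k kW]; exists k => m n km kn; apply: kW.
  have -> : (s m).1 - (s n).1 = ((s m).1 - (s k).1) + (- ((s n).1 - (s k).1)) by abel.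
  have t l : (k <= l)%N -> U k.+1 ((s l).1 - (s k).1).
    move=> /subnKC <-; apply: (base_decr dU _ (tail k _)).
    by rewrite ltnS; exact: sk.
  by apply: aU; [|apply: sU]; exact: t.
have [l sl] := cG _ cs; have [n Fn] := covF l.
apply: (hs n.+1).1.2 Fn; have [k hk] := sl _ (nU (s n.+1).2.+1).
have -> : l - (s n.+1).1 = ((s (n.+1 + k)%N).1 - (s n.+1).1) + (- ((s (n.+1 + k)%N).1 - l)).
  by abel.
by apply: aU; [exact: tail|apply/sU/hk; lia].
Qed.

(** Countably many translates of the image suffice, which serves both surjections ([c] constant) and
    lifts to a cover ([c] enumerating its kernel). Baire makes the closures of images of
    neighborhoods large; completeness of [G] then removes the closure by successive
    approximation. *)
Lemma open_mapping (G F : topologicalZmodType) (phi : G -> F) (c : nat -> F) :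
  first_countable G -> gcomplete G -> narrow G -> baire F -> separated F ->
  cont_hom G F phi -> (forall y, exists n g, y = c n + phi g) -> open_at0 phi.
Proof.
move=> /decreasing_base [U [nU bU aU sU dU]] cG nG bF sF hphi cov.
pose cl (A : set G) := [set y | forall W, nbhs 0 W -> exists2 x, A x & W (phi x - y)].
have clN k : nbhs 0 (cl (U k)).
  have [s hs] := nG _ (nU k.+1).
  (* Translates of the closure by [c i + phi (s j)], the pair being coded in [m]; one of them has an
     interior point, and differences of its points fill a neighborhood of zero. *)
  pose T m : set F := [set y | if @unpickle (nat * nat)%type m is Some (i, j)
      then cl (U k.+1) (y - (c i + phi (s j))) else False].
  have cT m : closed (T m).
    move=> y; rewrite /T /=; case: unpickle => [[i j]|]; last first.
      by move=> /(_ setT filterT) [z []].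
    move=> h W /nbhs0_half [V [nV sV VW _]].
    have /h [z [hz Vz]] : nbhs y [set z | V (z - y)].
      by apply/nbhs_shift; apply: filterS nV => v /=; rewrite addrC addKr.
    have [x Ux Vx] := hz _ nV; exists x => //.
    have -> : phi x - (y - (c i + phi (s j))) = (phi x - (z - (c i + phi (s j)))) + (z - y).
      by abel.
    exact: VW.
  have covT y : exists m, T m y.
    have [i [g eg]] := cov y; have [j hj] := hs g.
    exists (pickle (i, j)); rewrite /T /= pickleK => W nW; exists (g - s j) => //.
    rewrite eg (chomB hphi).
    have -> : phi g - phi (s j) - (c i + phi g - (c i + phi (s j))) = 0 by abel.
    exact: nbhs_singleton.
  have [m [y /nbhs_shift nT]] := bF _ cT covT.
  have [O nO hO] := nbhs0_sub nT; have O0 := nbhs_singleton nO.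
  apply: filterS nO => w Ow W /nbhs0_half [V [nV sV VW _]].
  move: (hO _ _ Ow O0) (nbhs_singleton nT); rewrite /T /=.
  case: unpickle => [[i j]|//] /(_ _ nV) [x Ux Vx] /(_ _ nV) [x' Ux' Vx'].
  exists (x - x'); first by apply: aU => //; exact: sU.
  have -> : phi (x - x') - w = (phi x - (y + (w - 0) - (c i + phi (s j))))
      + (- (phi x' - (y + 0 - (c i + phi (s j))))).
    by rewrite (chomB hphi); abel.
  by apply: VW => //; exact: sV.
move=> W /bU [k0 kW]; apply: filterS (clN k0.+2) => y0 hy0.
(* The remainder stays in the closure of the image of a shrinking neighborhood. Starting at [k0.+2]
   leaves one index for the sum of the increments and one for the limit. *)
pose P k (s : G) := cl (U (k0.+2 + k)%N) (y0 - phi s).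
pose Q k (s t : G) := U (k0.+2 + k)%N (t - s).
have P0 : P 0%N 0 by rewrite /P (chom0 hphi) subr0 addn0.
have step k s : P k s -> exists t, P k.+1 t /\ Q k s t.
  move=> Ps; have [V [nV sV _ Vcl]] := nbhs0_half (clN (k0.+2 + k.+1)%N).
  have [x Ux Vx] := Ps _ nV; exists (s + x); split; last by rewrite /Q addrC addKr.
  rewrite /P (chomD hphi); apply: Vcl.
  have -> : y0 - (phi s + phi x) = - (phi x - (y0 - phi s)) by abel.
  exact: sV.
have [s [s0 hs]] := step_choice P0 step.
pose U' k := U (k0.+1 + k)%N.
have [cs ts] : gcauchy s /\ forall k n, (k <= n)%N -> U' k (s n - s k).
  apply: base_cauchy.
  - move=> V /bU [k kV]; exists k; apply: subset_trans kV.
    by apply: (base_decr dU); exact: leq_addl.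
  - by move=> k x y; rewrite /U' addnS; exact: aU.
  - by move=> k x; exact: sU.
  - by move=> k; exact: nU.
  - by move=> k; rewrite /U' addnS -addSn; have [_] := hs k.
have [g sg] := cG _ cs; exists g.
  have [k hk] := sg _ (nU k0.+1); apply: kW.
  have -> : g = (s k - s 0%N) + (- (s k - g)) by rewrite s0; abel.
  apply: aU; last exact/sU/hk.
  by have := ts 0%N k isT; rewrite /U' addn0.
apply/esym/separated_eq => // Z /nbhs0_quarter [V [nV sV VZ _]].
have nphi := chom_nbhs hphi nV.
have [k1 h1] := sg _ nphi; have [k2 h2] := bU _ nphi; pose k := maxn k1 k2.
have [/(_ _ nV) [x Ux Vx] _] := hs k.
have -> : y0 - phi g = - (phi x - (y0 - phi (s k))) + phi x + phi (s k - g) + 0.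
  by rewrite (chomB hphi); abel.
apply: VZ; [exact: sV| | |exact: nbhs_singleton].
- by apply: h2; apply: (base_decr dU _ Ux); rewrite /k; lia.
- by apply: h1; rewrite /k; lia.
Qed.

End baire_om.

(** * Neighborhoods of zero in powers, sums, discrete groups and quotients *)

Section powg_nbhs.
Variables (I : choiceType) (A : topologicalZmodType).

Lemma proj_cont_hom i : cont_hom (powg I A) A (fun f => f i).
Proof.
split=> //; exact: (@proj_continuous {classic I} (fun=> A) i).
Qed.

Lemma powg_nbhs_seq (s : seq I) (V : set A) : nbhs 0 V ->
  nbhs 0 [set f : powg I A | forall i, i \in s -> V (f i)].
Proof.
move=> nV; elim: s => [|i s IH]; first by apply: filterS filterT => f _ i.
apply: filterS (filterI (chom_nbhs (proj_cont_hom i) nV) IH) => f [/= Vi Vs] j.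
by rewrite in_cons => /orP[/eqP ->|/Vs].
Qed.

(** The boxes over finite lists of coordinates form a filter that converges to zero in each
    coordinate, hence in the topology generated by the projections. *)
Lemma powg_nbhsP (U : set (powg I A)) : nbhs 0 U -> exists (s : seq I) (V : set A),
  nbhs 0 V /\ forall f, (forall i, i \in s -> V (f i)) -> U f.
Proof.
pose B (p : seq I * set A) : set (powg I A) := [set f | forall i, i \in p.1 -> p.2 (f i)].
pose D := [set p : seq I * set A | nbhs (0 : A) p.2].
have FF : Filter (filter_from D B).
  apply: filter_from_filter => [|[s V] [t W] /= nV nW].
    by exists ([::], setT); exact: filterT.
  exists (s ++ t, V `&` W); first exact: filterI.
  by move=> f h; split=> i /= hi; have [] := h i; rewrite ?mem_cat /= ?hi ?orbT.
suff c : filter_from D B --> (0 : powg I A).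
  by move=> /c [[s V] /= nV BU]; exists s, V; split => // f /BU.
apply/cvg_sup => i U' [_ [[V oV <-] V0] VU].
exists ([:: i], V) => [|f /= h]; first exact: open_nbhs_nbhs.
by apply: VU; apply: h; rewrite inE.
Qed.

Lemma cont_hom_powg (P : topologicalZmodType) (F : P -> powg I A) :
  (forall i, cont_hom P A (fun x => F x i)) -> cont_hom P (powg I A) F.
Proof.
move=> h; apply/cont_homP; split=> [x y|U /powg_nbhsP [s [V [nV VU]]]].
  by apply: funext => i; rewrite (chomB (h i)).
suff : nbhs 0 [set x | forall i, i \in s -> V (F x i)].
  by apply: filterS => x; exact: VU.
elim: s {VU} => [|i s IH]; first by apply: filterS filterT => f _ i.
apply: filterS (filterI (chom_nbhs (h i) nV) IH) => f [/= Vi Vs] j.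
by rewrite in_cons => /orP[/eqP ->|/Vs].
Qed.

Definition single (i : I) (x : A) : powg I A := fun j => if j == i then x else 0.

Lemma single_cont_hom i : cont_hom A (powg I A) (single i).
Proof.
apply: cont_hom_powg => j; rewrite /single; case: (j == i).
  exact: cont_hom_id.
exact: cont_hom0.
Qed.

Lemma powg_sumE (s : seq I) (f : powg I A) j : uniq s ->
  (\sum_(i <- s) single i (f i)) j = if j \in s then f j else 0.
Proof.
have sE J (r : seq J) (F : J -> powg I A) : (\sum_(k <- r) F k) j = \sum_(k <- r) F k j.
  by elim: r => [|k r IH]; rewrite ?big_nil // !big_cons -IH.
rewrite sE; elim: s => [|i s IH] /=; first by rewrite big_nil.
case/andP => /negPf nis us; rewrite big_cons IH // in_cons /single.
by have [->|_] := eqVneq j i; rewrite ?nis ?addr0 //= add0r.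
Qed.

End powg_nbhs.

Section dsum_nbhs.
Variables (A B : topologicalZmodType).

Lemma dsum_nbhsP (U : set (A ⊕ B)) : nbhs 0 U <->
  exists V W, [/\ nbhs 0 V, nbhs 0 W & forall a b, V a -> W b -> U (a, b)].
Proof.
split=> [[[V W] /= [nV nW] VW]|[V [W [nV nW VW]]]].
  by exists V, W; split => // a b ? ?; exact: (VW (a, b)).
by exists (V, W) => //= -[a b] [/= ? ?]; exact: VW.
Qed.

Lemma fst_cont_hom : cont_hom (A ⊕ B) A fst.
Proof.
apply/cont_homP; split=> // U nU; apply/dsum_nbhsP.
by exists U, setT; split => //; exact: filterT.
Qed.

Lemma snd_cont_hom : cont_hom (A ⊕ B) B snd.
Proof.
apply/cont_homP; split=> // U nU; apply/dsum_nbhsP.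
by exists setT, U; split => //; exact: filterT.
Qed.

Lemma pair_cont_hom (P : topologicalZmodType) (f : P -> A) (g : P -> B) :
  cont_hom P A f -> cont_hom P B g -> cont_hom P (A ⊕ B) (fun x => (f x, g x)).
Proof.
move=> hf hg; apply/cont_homP; split=> [x y|U /dsum_nbhsP [V [W [nV nW VW]]]].
  by rewrite (chomB hf) (chomB hg).
apply: filterS (filterI (chom_nbhs hf nV) (chom_nbhs hg nW)) => x [? ?].
exact: VW.
Qed.

Lemma inl_cont_hom : cont_hom A (A ⊕ B) (fun a => (a, 0)).
Proof. by apply: pair_cont_hom; [exact: cont_hom_id|exact: cont_hom0]. Qed.

Lemma inr_cont_hom : cont_hom B (A ⊕ B) (fun b => (0, b)).
Proof. by apply: pair_cont_hom; [exact: cont_hom0|exact: cont_hom_id]. Qed.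

End dsum_nbhs.

Section discrete_nbhs.
Variable D : zmodType.

Lemma discrete_nbhs (U : set (discrete_topology D)) : U 0 -> nbhs 0 U.
Proof.
move=> U0; apply: open_nbhs_nbhs; split=> //.
exact: (@discrete_open (discrete_topology D)).
Qed.

Lemma discrete_cont_hom (B : topologicalZmodType) (f : D -> B) :
  (forall x y, f (x - y) = f x - f y) -> cont_hom (discrete_topology D) B f.
Proof.
move=> h; apply/cont_homP; split=> // U nU; apply: discrete_nbhs => /=.
by rewrite -(subrr 0) h subrr; exact: nbhs_singleton.
Qed.

End discrete_nbhs.

Section quotg_nbhs.
Variables (G : topologicalZmodType) (N : zmodClosed G).

Lemma to_quotg_hom : cont_hom G (quotg N) (@to_quotg G N).
Proof. by split; [exact: to_quotgB|exact: to_quotg_continuous]. Qed.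

Lemma to_quotg_open0 : open_at0 (@to_quotg G N).
Proof.
move=> U; rewrite nbhsE => -[O [oO O0] OU].
have : nbhs (@to_quotg G N 0) (@to_quotg G N @` O).
  by apply: open_nbhs_nbhs; split; [exact: to_quotg_open|exists 0].
by rewrite (chom0 to_quotg_hom); apply: filterS; exact: image_subset.
Qed.

Lemma to_quotg0 x : @to_quotg G N x = 0 <-> x \in N.
Proof.
rewrite -(chom0 to_quotg_hom) -[x in x \in N]subr0.
by split => [/to_quotgP|/to_quotgP].
Qed.

Lemma closed_quotg_separated : closed [set` N] -> separated (quotg N).
Proof.
move=> cN u; have [x <-] := to_quotg_surj u => h; apply/to_quotg0.
apply: (closed_near cN) => U /nbhs0_half [V [nV sV _ VU]].
have [v Vv e] := h _ (to_quotg_open0 nV).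
exists (x - v); last by rewrite addrC addKr; exact/VU/sV.
by apply/to_quotg0; rewrite to_quotgB e subrr.
Qed.

End quotg_nbhs.

(** * Finite-dimensional real groups and their closed subgroups *)

Section real_powers.
Variables (R : realType).

Section fixed_n.
Variable n : nat.
Notation V := (powg 'I_n R).

Definition rscale (t : R) (v : V) : V := fun i => t * v i.
Definition rnorm (v : V) : R := \sum_i `|v i|.

Lemma rscaleB t v w : rscale t (v - w) = rscale t v - rscale t w.
Proof. by apply: funext => i; exact: mulrBr. Qed.
Lemma rscaleA s t v : rscale s (rscale t v) = rscale (s * t) v.
Proof. by apply: funext => i; exact: mulrA. Qed.
Lemma rscale1 v : rscale 1 v = v.
Proof. by apply: funext => i; exact: mul1r. Qed.
Lemma rscaleBl s t v : rscale (s - t) v = rscale s v - rscale t v.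
Proof. by apply: funext => i; exact: mulrBl. Qed.
Lemma rscaleMz t v (m : int) : rscale t v *~ m = rscale (m%:~R * t) v.
Proof.
apply: funext => i; rewrite /rscale.
have -> : forall (w : V), (w *~ m) i = w i *~ m.
  by move=> w; exact: (chomMz (proj_cont_hom R i)).
by rewrite mulrzl -mulrzAl.
Qed.

Lemma rnorm_ge0 v : 0 <= rnorm v. Proof. by apply: sumr_ge0. Qed.
Lemma rnormD v w : rnorm (v + w) <= rnorm v + rnorm w.
Proof. by rewrite /rnorm -big_split; apply: ler_sum => i _; exact: ler_normD. Qed.
Lemma rnormN v : rnorm (- v) = rnorm v.
Proof. by apply: eq_bigr => i _; exact: normrN. Qed.
Lemma rnormZ t v : rnorm (rscale t v) = `|t| * rnorm v.
Proof. by rewrite /rnorm mulr_sumr; apply: eq_bigr => i _; exact: normrM. Qed.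
Lemma rnorm_coord v i : `|v i| <= rnorm v.
Proof. by rewrite /rnorm (bigD1 i) //= lerDl sumr_ge0. Qed.
Lemma rnorm0_eq v : rnorm v = 0 -> v = 0.
Proof.
move=> h; apply: funext => i; apply/eqP; rewrite -normr_le0 -h.
exact: rnorm_coord.
Qed.
Lemma rnorm0 : rnorm 0 = 0.
Proof. by apply: big1 => i _; exact: normr0. Qed.

Lemma real_nbhs0 (e : R) : 0 < e -> nbhs (0 : R) [set x | `|x| < e].
Proof.
move=> e0; apply/nbhs_ballP; exists e => // x; rewrite /ball /=.
by rewrite sub0r normrN.
Qed.

Lemma real_nbhs0P (U : set R) : nbhs 0 U -> exists2 e, 0 < e & forall x, `|x| < e -> U x.
Proof.
move=> /nbhs_ballP [e e0 eU]; exists e => // x xe; apply: eU.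
by rewrite /ball /= sub0r normrN.
Qed.

Lemma rnorm_nbhs (e : R) : 0 < e -> nbhs (0 : V) [set v | rnorm v < e].
Proof.
move=> e0; have e1 : 0 < e / n.+1%:R by rewrite divr_gt0.
apply: filterS (powg_nbhs_seq (enum 'I_n) (real_nbhs0 e1)) => v h /=.
apply: (@le_lt_trans _ _ (\sum_(i < n) e / n.+1%:R)).
  by apply: ler_sum => i _; apply/ltW/h; rewrite mem_enum.
rewrite sumr_const card_ord -[_ *+ n]mulr_natr -mulrA gtr_pMr // mulrC ltr_pdivrMr //.
by rewrite mul1r ltr_nat.
Qed.

Lemma rnorm_nbhsP (U : set V) : nbhs 0 U -> exists2 e, 0 < e & forall v, rnorm v < e -> U v.
Proof.
move=> /powg_nbhsP [s [W [/real_nbhs0P [e e0 eW] WU]]].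
by exists e => // v ve; apply: WU => i _; apply: eW; apply: le_lt_trans ve; exact: rnorm_coord.
Qed.

Lemma unit_ball_cluster (u : nat -> V) : (forall k, rnorm (u k) <= 1) ->
  exists w, forall e, 0 < e -> forall k, exists2 j, (k <= j)%N & rnorm (u j - w) < e.
Proof.
move=> u1; pose A := [set f : prod_topology (fun _ : 'I_n => R) | forall i, `[(-1 : R), 1]%classic (f i)].
have cA : compact A 
  by apply: (@tychonoff 'I_n (fun=> R) (fun=> `[(-1 : R), 1]%classic)) => i; exact: segment_compact.
have uA : (u @ \oo) A.
  exists 0%N => // k _ i /=; rewrite in_itv /= -ler_norml.
  exact: le_trans (rnorm_coord _ _) (u1 k).
have [w [_ cw]] := cA (u @ \oo) _ uA; exists w => e e0 k.
have nw : nbhs (w : V) [set v | rnorm (v - w) < e].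
  apply/nbhs_shift; apply: filterS (rnorm_nbhs e0) => v /= h.
  by have -> : (w : V) + v - w = v by abel.
have uk : (u @ \oo) [set u j | j in [set j | (k <= j)%N]] by exists k => // j; exists j.
by have [_ [[j kj <-] h]] := cw _ _ uk nw; exists j.
Qed.

End fixed_n.
End real_powers.

Section cartan.
Variables (R : realType) (n : nat).
Notation V := (powg 'I_n R).

Section closed_subgroup.
Variable L : set V.
Hypotheses (L0 : L 0) (LB : forall x y, L x -> L y -> L (x - y)) (cL : closed L).

Let LMz x (m : int) : L x -> L (x *~ m).
Proof.
move=> Lx.
have LN y : L y -> L (- y) by move=> Ly; rewrite -sub0r; exact: LB.
have LMn k : L (x *+ k).
  elim: k => [|k IH]; first by rewrite mulr0n.
  by rewrite mulrS -[x *+ k]opprK; apply: LB => //; exact: LN.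
by case: m => m; rewrite ?NegzE ?mulrNz -pmulrn; [|apply: LN].
Qed.

(** The largest vector subspace contained in [L]. *)
Definition lines : set V := [set v | forall t, L (rscale t v)].

Let near_lines v : (forall e, 0 < e -> exists2 w, lines w & rnorm (v - w) < e) -> lines v.
Proof.
move=> h t; apply: closed_near cL _ => U /rnorm_nbhsP [e e0 eU].
have t0 : 0 < `|t| + 1 by rewrite ltr_wpDl.
have [w Lw vw] := h _ (divr_gt0 e0 t0); exists (rscale t w); first exact: Lw.
apply: eU; rewrite -rscaleB rnormZ -[w - v]opprB rnormN.
apply: (@le_lt_trans _ _ ((`|t| + 1) * rnorm (v - w))).
  by rewrite ler_wpM2r ?rnorm_ge0 // lerDl.
by rewrite mulrC -ltr_pdivlMr.
Qed.

Let linesB v w : lines v -> lines w -> lines (v - w).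
Proof. by move=> Lv Lw t; rewrite rscaleB; exact: LB. Qed.
Let linesZ s v : lines v -> lines (rscale s v).
Proof. by move=> Lv t; rewrite rscaleA. Qed.
Let lines0 : lines 0.
Proof. by move=> t; have -> : rscale t 0 = 0 :> V by apply: funext => i; exact: mulr0. Qed.

(* Riesz: a vector outside the closed subspace can be shifted by it so as to be
   almost as close to the subspace as possible. *)
Let riesz v : ~ lines v -> exists2 w, lines w &
  forall w', lines w' -> rnorm (v - w) <= 2 * rnorm (v - w').
Proof.
move=> nv; apply: contrapT => h; apply: nv.
have hk k : exists2 w, lines w & rnorm (v - w) <= 2^-1 ^+ k * rnorm v.
  elim: k => [|k [w Lw vw]]; first by exists 0 => //; rewrite subr0 expr0 mul1r.
  apply: contrapT => h2; apply: h; exists w => // w' Lw'; rewrite leNgt.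
  apply/negP => c; apply: h2; exists w' => //; rewrite exprS; lra.
apply: near_lines => e e0.
have v1 : 0 < rnorm v + 1 by rewrite ltr_wpDl ?rnorm_ge0.
have [k hke] := half_pow_small (divr_gt0 e0 v1); have [w Lw vw] := hk k.
exists w => //; apply: le_lt_trans vw _; move: hke; rewrite ltr_pdivlMr // => hke.
apply: le_lt_trans hke; rewrite ler_wpM2l ?lerDl //.
by rewrite exprn_ge0 // invr_ge0.
Qed.

(** Cartan's argument: otherwise there are elements [m k] of [L] tending to zero and, by [riesz],
    almost orthogonal to [lines]. Their directions have a cluster point [w]. Integer multiples of
    the [m k] approximate every multiple of [w], so [w] lies in [lines], although the directions
    stay at distance at least 1/2 from that subspace. *)
Lemma small_closed_subgroup : exists2 e : R, 0 < e & forall v, L v -> rnorm v < e -> lines v.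
Proof.
apply: contrapT => h.
have pw k : 0 < (2^-1 : R) ^+ k by rewrite exprn_gt0 // invr_gt0.
have hv k : exists m : V, [/\ L m, 0 < rnorm m, rnorm m < 2 * 2^-1 ^+ k &
    forall w, lines w -> rnorm m <= 2 * rnorm (m - w)].
  have [v [Lv vk nv]] : exists v : V, [/\ L v, rnorm v < 2^-1 ^+ k & ~ lines v].
    apply: contrapT => h2; apply: h; exists (2^-1 ^+ k) => // v Lv vk.
    by apply: contrapT => nv; apply: h2; exists v.
  have [w Lw hw] := riesz nv; exists (v - w); split.
  - by apply: LB => //; have := Lw 1; rewrite rscale1.
  - rewrite lt_neqAle rnorm_ge0 andbT eq_sym; apply/eqP => /rnorm0_eq e.
    by apply: nv; rewrite -[v]subr0 -e opprB addrCA subrr addr0.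
  - by apply: le_lt_trans (hw 0 lines0) _; rewrite subr0 ltr_pM2l.
  - move=> w' Lw'; have -> : v - w - w' = v - (w - - w') by abel.
    by apply/hw/linesB => //; rewrite -sub0r; exact: linesB.
have [m hm] := choice hv.
have [w hw] : exists w : V, forall e, 0 < e -> forall k,
    exists2 j, (k <= j)%N & rnorm (rscale (rnorm (m j))^-1 (m j) - w) < e.
  apply: unit_ball_cluster => k; have [_ m0 _ _] := hm k.
  by rewrite rnormZ ger0_norm ?invr_ge0 ?mulVf ?gt_eqF // ltW.
have Lw : lines w.
  move=> t; apply: closed_near cL _ => U /rnorm_nbhsP [e e0 eU].
  have t0 : 0 < `|t| + 1 by rewrite ltr_wpDl.
  have [k hk] := half_pow_small (divr_gt0 e0 (ltr0n R 4)).
  have [j kj hj] := hw _ (divr_gt0 (divr_gt0 e0 (ltr0n R 2)) t0) k.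
  have [Lm m0 mk _] := hm j.
  (* The multiple of [m j] closest from below to [t u], with [u] the direction of [m j]; the error
     is at most the norm of [m j], which tends to zero. *)
  pose z := Num.floor (t / rnorm (m j)); exists (m j *~ z); first exact: LMz.
  apply: eU; set u := rscale _ _ in hj.
  have -> : m j *~ z - rscale t w = rscale (z%:~R * rnorm (m j) - t) u + rscale t (u - w).
    rewrite rscaleBl rscaleB /u !rscaleA mulfK ?gt_eqF //.
    have -> : m j *~ z = rscale z%:~R (m j) by rewrite -[m j in LHS]rscale1 rscaleMz mulr1.
    abel.
  have u1 : rnorm u = 1 by rewrite rnormZ ger0_norm ?invr_ge0 ?mulVf ?gt_eqF // ltW.
  have zt : `|z%:~R * rnorm (m j) - t| <= rnorm (m j).
    have /andP[z1 z2] := floor_itv (t / rnorm (m j)).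
    move: z1 z2; rewrite -/z ler_pdivlMr // ltr_pdivrMr // intrD mulrDl mul1r => z1 z2.
    by rewrite ler_norml; lra.
  have tu : `|t| * rnorm (u - w) <= (`|t| + 1) * rnorm (u - w).
    by rewrite ler_wpM2r ?rnorm_ge0 // lerDl.
  move: hj; rewrite ltr_pdivlMr // mulrC => hj.
  have kj2 : (2^-1 : R) ^+ j <= 2^-1 ^+ k.
    by rewrite ler_wiXn2l ?invr_ge0 ?invf_le1 // ler1n.
  apply: le_lt_trans (rnormD _ _) _.
  rewrite (rnormZ (_ - t) u) u1 mulr1 (rnormZ t (u - w)); lra.
(* The competitor [rnorm (m j)] times [w] in [riesz] contradicts a distance below 1/2 between the
   direction and [w]. *)
have half0 : 0 < (1 / 2 : R) by lra.
have [j _ hj] := hw _ half0 0%N.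
have [Lm m0 _ /(_ (rscale (rnorm (m j)) w) (linesZ _ Lw))] := hm j.
have -> : m j - rscale (rnorm (m j)) w =
   rscale (rnorm (m j)) (rscale (rnorm (m j))^-1 (m j) - w).
  by rewrite rscaleB rscaleA divff ?gt_eqF // rscale1.
rewrite rnormZ (ger0_norm (ltW m0)) => h3.
have h4 : rnorm (m j) * rnorm (rscale (rnorm (m j))^-1 (m j) - w) < rnorm (m j) * (1 / 2).
  by rewrite ltr_pM2l.
lra.
Qed.

End closed_subgroup.
End cartan.

Section linear_maps.
Variable R : realType.

Lemma linear_cont_hom n c (F : powg 'I_n R -> powg 'I_c R) :
  (forall v w, F (v - w) = F v - F w) -> (forall t v, F (rscale t v) = rscale t (F v)) ->
  cont_hom (powg 'I_n R) (powg 'I_c R) F.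
Proof.
move=> FB FZ; apply/cont_homP; split=> // U /rnorm_nbhsP [e e0 eU].
have F0 : F 0 = 0 by rewrite -(subrr 0) FB subrr.
have FD v w : F (v + w) = F v + F w.
  by rewrite -[w in LHS]opprK -[- w in LHS]sub0r !FB F0; abel.
pose one (i : 'I_n) : powg 'I_n R := @single 'I_n (R : topologicalZmodType) i (1 : R).
pose M := \sum_i rnorm (F (one i)).
have M0 : 0 <= M by apply: sumr_ge0 => i _; exact: rnorm_ge0.
have Fsum (v : powg 'I_n R) : F v = \sum_i rscale (v i) (F (one i)).
  have {1}-> : v = \sum_i rscale (v i) (one i).
    apply: funext => j.
    transitivity ((\sum_(i <- index_enum 'I_n) single i (v i) : powg 'I_n R) j).
      by rewrite powg_sumE ?index_enum_uniq // mem_index_enum.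
    congr (_ j); apply: eq_bigr => i _; apply: funext => k.
    by rewrite /rscale /one /single; case: (k == i); rewrite ?mulr1 ?mulr0.
  by rewrite (big_morph F FD F0); apply: eq_bigr => i _; rewrite FZ.
have hM v : rnorm (F v) <= M * rnorm v.
  rewrite Fsum mulr_suml.
  have nsum (s : seq 'I_n) (f : 'I_n -> powg 'I_c R) :
      rnorm (\sum_(i <- s) f i) <= \sum_(i <- s) rnorm (f i).
    elim: s => [|i s IH]; first by rewrite !big_nil rnorm0.
    rewrite !big_cons; apply: le_trans (rnormD _ _) _; exact: lerD.
  apply: le_trans (nsum _ _) _; apply: ler_sum => i _; rewrite rnormZ mulrC.
  by rewrite ler_wpM2l ?rnorm_ge0 // rnorm_coord.
have M1 : 0 < M + 1 by lra.
apply: filterS (rnorm_nbhs n (divr_gt0 e0 M1)) => v /=; rewrite ltr_pdivlMr // => hv.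
apply: eU; apply: le_lt_trans (hM v) _; apply: le_lt_trans hv.
by rewrite mulrC ler_wpM2l ?rnorm_ge0 // lerDl.
Qed.

(** A vector space of maximal dimension inside [lines L] contains every vector of [lines L], since
    otherwise a line could be added to it. A basis of it gives the chart, and near zero [L] is no
    larger than [lines L]. *)
Lemma closed_subgroup_chart n (L : set (powg 'I_n R)) :
  L 0 -> (forall x y, L x -> L y -> L (x - y)) -> closed L ->
  exists (c : nat) (io : powg 'I_c R -> powg 'I_n R),
  [/\ cont_hom (powg 'I_c R) (powg 'I_n R) io, forall x, L (io x),
      forall x, io x = 0 -> x = 0
    & forall U, nbhs 0 U -> exists2 O, nbhs 0 O & forall v, L v -> O v -> (io @` U) v].
Proof.
move=> L0 LB cL; have [e e0 he] := small_closed_subgroup L0 LB cL.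
pose toM (v : powg 'I_n R) : 'rV[R]_n := \row_i v i.
pose ofM (M : 'rV[R]_n) : powg 'I_n R := fun i => M 0 i.
have toMK v : ofM (toM v) = v by apply: funext => i; rewrite /ofM /toM mxE.
have ofMK M : toM (ofM M) = M by apply/rowP => i; rewrite /ofM /toM mxE.
have linB v w : lines L v -> lines L w -> lines L (v - w).
  by move=> Lv Lw t; rewrite rscaleB; exact: LB.
have linZ s v : lines L v -> lines L (rscale s v) by move=> Lv t; rewrite rscaleA.
pose P d := `[< exists U : {vspace 'rV[R]_n}, \dim U = d /\ forall M, M \in U -> lines L (ofM M) >].
have exP : exists d, P d.
  exists 0%N; apply/asboolP; exists 0%VS; split; first by rewrite dimv0.
  move=> M; rewrite memv0 => /eqP -> t.
  have -> // : rscale t (ofM 0) = 0.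
  by apply: funext => i; rewrite /rscale /ofM mxE mulr0.
have bP d : P d -> (d <= \dim {: 'rV[R]_n})%N.
  by move=> /asboolP [U [<- _]]; apply/dimvS/subvf.
case: (ex_maxnP exP bP) => d /asboolP [U [dU hU]] maxd.
have inU v : lines L v -> toM v \in U.
  move=> Lv; apply/negPn/negP => nv.
  suff : (d.+1 <= d)%N by rewrite ltnn.
  apply: maxd; apply/asboolP; exists (U + <[toM v]>)%VS; split.
    rewrite dimv_disjoint_sum; last first.
      apply/eqP; rewrite -subv0; apply/subvP => w; rewrite memv_cap => /andP[wU /vlineP [k wk]].
      have [k0|k0] := eqVneq k 0; first by rewrite wk k0 scale0r mem0v.
      by move: nv; rewrite -(scalerK k0 (toM v)) -wk memvZ.
    rewrite dU dim_vline; have -> : toM v != 0 by apply: contraNneq nv => ->; exact: mem0v.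
    by rewrite addn1.
  move=> M /memv_addP [a aU [_ /vlineP [k ->] ->]].
  have -> : ofM (a + k *: toM v) = ofM a - rscale (- k) v.
    by apply: funext => i; rewrite /ofM /toM !mxE /rscale /= -mulNr opprK.
  by apply: linB; [exact: hU|exact: linZ].
pose b := vbasis U; pose c := \dim U.
pose io (x : powg 'I_c R) : powg 'I_n R := ofM (\sum_(i < c) x i *: b`_i).
pose co (v : powg 'I_n R) : powg 'I_c R := fun i => coord b i (toM v).
have ofMB M N : ofM (M - N) = ofM M - ofM N by apply: funext => i; rewrite /ofM !mxE.
have ofMZ t M : ofM (t *: M) = rscale t (ofM M) by apply: funext => i; rewrite /ofM !mxE.
have toMB v w : toM (v - w) = toM v - toM w by apply/rowP => i; rewrite !mxE.
have toMZ t v : toM (rscale t v) = t *: toM v by apply/rowP => i; rewrite !mxE.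
have hio : cont_hom (powg 'I_c R) (powg 'I_n R) io.
  apply: linear_cont_hom => [v w|t v]; rewrite /io.
    rewrite -ofMB -sumrB; congr ofM; apply: eq_bigr => i _.
    by rewrite -scalerBl.
  by rewrite -ofMZ scaler_sumr; congr ofM; apply: eq_bigr => i _; rewrite scalerA.
have hco : cont_hom (powg 'I_n R) (powg 'I_c R) co.
  apply: linear_cont_hom => [v w|t v]; apply: funext => i; rewrite /co.
    by rewrite toMB linearB.
  by rewrite toMZ linearZ.
have coio x : co (io x) = x.
  apply: funext => i; rewrite /co /io ofMK coord_sum_free //.
  exact: basis_free (vbasisP U).
have ioco v : lines L v -> io (co v) = v.
  move=> /inU vU; rewrite /io /co -[RHS]toMK; congr ofM.
  exact/esym/coord_vbasis.
exists c, io; split=> //.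
- move=> x; have : lines L (io x).
    apply: hU; apply: rpred_sum => i _; apply: memvZ; apply: vbasis_mem.
    by rewrite mem_nth // size_tuple.
  by move=> /(_ 1); rewrite rscale1.
- by move=> x x0; rewrite -(coio x) x0 (chom0 hco).
move=> W nW; exists ([set v | rnorm v < e] `&` co @^-1` W).
  by apply: filterI; [exact: rnorm_nbhs|exact: chom_nbhs].
by move=> v Lv [ve coW]; exists (co v) => //; apply/ioco/he.
Qed.

End linear_maps.

(** * Lifting homomorphisms along locally Euclidean kernels *)

Section halving_series.
Variables (R : realType) (d : R).
Hypothesis d0 : 0 <= d.

(** Horner form of the partial sums of [(w_j + d) / 2^(j+1)]: peeling the first term matches the
    shift in [hsum_shift]. *)
Fixpoint hsum_part (N : nat) (w : nat -> R) : R :=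
  if N is N'.+1 then (w 0%N + d) / 2 + hsum_part N' (fun j => w j.+1) / 2 else 0.

(* The sum of w_j / 2^(j+1) for a sequence bounded by d; shifting by d makes the
   partial sums monotone, so that the sum is a supremum. *)
Definition hsum (w : nat -> R) : R := sup [set hsum_part N w | N in setT] - d.

Let bounded (w : nat -> R) := forall j, `|w j| <= d.

Let part_le N w : bounded w -> hsum_part N w <= 2 * d.
Proof.
elim: N w => [|N IH] w bw /=; first by rewrite mulr_ge0.
have := IH (fun j => w j.+1) (fun j => bw j.+1).
have := bw 0%N; rewrite ler_norml => /andP[? ?]; lra.
Qed.

Let part_sup w : bounded w -> has_sup [set hsum_part N w | N in setT].
Proof.
move=> bw; split; first by exists 0, 0%N.
by exists (2 * d) => _ [N _ <-]; exact: part_le.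
Qed.

Lemma hsum_bound w : bounded w -> `|hsum w| <= d.
Proof.
move=> bw; rewrite /hsum ler_norml; have [ne ub] := part_sup bw.
have h1 : 0 <= sup [set hsum_part N w | N in setT].
  by apply: (ub_le_sup ub); exists 0%N.
have h2 : sup [set hsum_part N w | N in setT] <= 2 * d.
  by apply: ge_sup => // _ [N _ <-]; exact: part_le.
by lra.
Qed.

(** For [w j] the doubling defect at [2^j x], this identity says that adding [hsum w] makes doubling
    exact at [x]. *)
Lemma hsum_shift w : bounded w -> hsum w + hsum w = w 0%N + hsum (fun j => w j.+1).
Proof.
move=> bw; pose w' j := w j.+1; have bw' : bounded w' by move=> j; exact: bw.
have [ne ub] := part_sup bw; have [ne' ub'] := part_sup bw'.
rewrite /hsum -/w'; set s := sup _; set s' := sup _.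
have s'0 : 0 <= s' by apply: (ub_le_sup ub'); exists 0%N.
have b0 : 0 <= w 0%N + d by have := bw 0%N; rewrite ler_norml => /andP[? ?]; lra.
have h1 : s <= (w 0%N + d) / 2 + s' / 2.
  apply: ge_sup => // _ [[|N] _ <-] /=; first lra.
  have : hsum_part N w' <= s' by apply: (ub_le_sup ub'); exists N.
  rewrite /w'; lra.
have h2 : s' <= 2 * s - (w 0%N + d).
  apply: ge_sup => // _ [N _ <-].
  have : hsum_part N.+1 w <= s by apply: (ub_le_sup ub); exists N.+1.
  rewrite /= -/w'; lra.
lra.
Qed.

End halving_series.

Section boxes.
Variable R : realType.

Definition box n (e : R) (v : powg 'I_n R) := forall i, `|v i| <= e.

Lemma box_nbhs n (e : R) : 0 < e -> nbhs 0 [set v : powg 'I_n R | box e v].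
Proof.
move=> e0; apply: filterS (powg_nbhs_seq (enum 'I_n) (real_nbhs0 e0)) => v h i.
by apply/ltW/h; rewrite mem_enum.
Qed.

Lemma box_nbhsP n (U : set (powg 'I_n R)) : nbhs 0 U ->
  exists2 e, 0 < e & forall v, box e v -> U v.
Proof.
move=> /powg_nbhsP [s [V [/real_nbhs0P [e e0 eV] VU]]].
exists (e / 2) => [|v bv]; first lra.
by apply: VU => i _; apply: eV; have := bv i; lra.
Qed.

Lemma boxW n (e e' : R) (v : powg 'I_n R) : e <= e' -> box e v -> box e' v.
Proof. by move=> ee bv i; exact: le_trans (bv i) ee. Qed.

Lemma boxD n (e e' : R) (v w : powg 'I_n R) : box e v -> box e' w -> box (e + e') (v + w).
Proof. by move=> bv bw i; apply: le_trans (ler_normD _ _) _; exact: lerD. Qed.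

Lemma boxN n (e : R) (v : powg 'I_n R) : box e v -> box e (- v).
Proof. by move=> bv i; rewrite normrN. Qed.

Lemma double_bounded_eq0 (z : nat -> R) (b : R) :
  (forall j, z j.+1 = z j + z j) -> (forall j, `|z j| <= b) -> z 0%N = 0.
Proof.
move=> dz bz; apply/eqP/negPn/negP => z0.
have zj j : `|z 0%N| <= b * 2^-1 ^+ j.
  have -> : z 0%N = 2^-1 ^+ j * z j.
    by elim: j => [|j IH]; rewrite ?expr0 ?mul1r // exprS IH dz; lra.
  rewrite normrM ger0_norm ?exprn_ge0 ?invr_ge0 // mulrC.
  by rewrite ler_wpM2r ?exprn_ge0 ?invr_ge0.
have b1 : 0 < `|b| + 1 by rewrite ltr_wpDl.
have n0 : 0 < `|z 0%N| by rewrite normr_gt0.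
have [j hj] := half_pow_small (divr_gt0 n0 b1).
have pj : 0 <= (2^-1 : R) ^+ j by rewrite exprn_ge0 // invr_ge0.
have := zj j; move: hj; rewrite ltr_pdivlMr // => hj h.
have : b * 2^-1 ^+ j <= (`|b| + 1) * 2^-1 ^+ j.
  by rewrite ler_wpM2r // ; have := ler_norm b; lra.
lra.
Qed.

End boxes.

Section lifting.
Variable R : realType.

(** Says, without a topology on [H], that [e] is a local isomorphism onto [H] at zero. Tori qualify
    as well as vector spaces, and discrete groups with [c = 0]. *)
Definition loc_vec (B : topologicalZmodType) (H : set B) := exists (c : nat) (e : powg 'I_c R -> B),
  [/\ cont_hom (powg 'I_c R) B e, forall v, H (e v),
      exists2 V, nbhs 0 V & forall v, V v -> e v = 0 -> v = 0
    & forall U, nbhs 0 U -> exists2 O, nbhs 0 O & forall h, H h -> O h -> (e @` U) h].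

(* Hyers' stability argument: a map that is additive up to small elements of the
   kernel becomes additive after adding the sum of the defects
   (u(2^(j+1) x) - 2 u(2^j x)) / 2^(j+1), computed in the chart of the kernel. *)
Lemma hyers_lift (B C : topologicalZmodType) (q : B -> C) :
  cont_hom B C q -> open_at0 q -> loc_vec [set b | q b = 0] ->
  exists2 Y : set B, nbhs 0 Y & forall (P : topologicalZmodType) (f : P -> C) (u : P -> B),
    cont_hom P C f -> (forall x, q (u x) = f x) ->
    (forall x y, Y (u (x + y) - u x - u y)) -> nbhs 0 [set x | Y (u x)] ->
    exists2 g, cont_hom P B g & forall x, q (g x) = f x.
Proof.
move=> hq oq [n [e [he qe [V nV Vinj] He]]].
have [e0 e0gt e0V] := box_nbhsP nV.
have inj v : box e0 v -> e v = 0 -> v = 0 by move=> /e0V; exact: Vinj.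
(* The largest combination of boxes tested for injectivity below has size [12 d]. *)
pose d := e0 / 16; have d0 : 0 < d by rewrite /d; lra.
have [O nO HO] := He _ (box_nbhs n d0).
have [Y [nY sY YO YsO]] := nbhs0_quarter nO.
exists Y => // P f u hf qu uY nu.
have Y0 : Y 0 by exact: nbhs_singleton.
have kap x y : exists k, box d k /\ e k = u (x + y) - u x - u y.
  have [|k bk ek] := HO (u (x + y) - u x - u y) _ (YsO _ (uY x y)); last by exists k.
  by rewrite /= !(chomB hq) !qu (chomD hf); abel.
have [w hw] := choice (fun x => kap x x).
pose c x : powg 'I_n R := fun i => hsum d (fun j => w (x *+ 2 ^ j) i).
have bw x i j : `|w (x *+ 2 ^ j) i| <= d by have [b _] := hw (x *+ 2 ^ j); exact: b.
have bc x : box d (c x) by move=> i; exact: (hsum_bound (ltW d0) (bw x i)).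
have c2 x : c x + c x = w x + c (x + x).
  apply: funext => i; rewrite /c.
  have := hsum_shift (ltW d0) (bw x i); rewrite expn0 mulr1n => h.
  apply: etrans h _; congr (_ + hsum d _); apply: funext => j.
  by rewrite -mulr2n -mulrnA expnS.
clearbody c; pose h x := u x + e (c x).
have qh x : q (h x) = f x by rewrite /h (chomD hq) qu qe addr0.
have h2 x : h (x + x) = h x + h x.
  have [_ ew] := hw x.
  have -> : h x + h x = u x + u x + e (c x + c x) by rewrite (chomD he) /h; abel.
  by rewrite c2 (chomD he) ew /h; abel.
have [k hk] := choice (fun p => kap p.1 p.2).
(* The additivity defect of [h] in the chart. As [h] doubles exactly, [z] doubles with its
   arguments; being bounded, it vanishes. *)
pose z x y := k (x, y) + c (x + y) - c x - c y.
have bz x y : box (4 * d) (z x y).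
  have [bk _] := hk (x, y).
  have -> : 4 * d = d + d + d + d by lra.
  by apply: boxD; [apply: boxD; [apply: boxD|]|]; rewrite //; apply: boxN.
have ez x y : e (z x y) = h (x + y) - h x - h y.
  have [_ ek] := hk (x, y).
  by rewrite /z !(chomB he) (chomD he) ek /h /=; abel.
clearbody z; have z2 x y : z (x + x) (y + y) = z x y + z x y.
  apply/eqP; rewrite -subr_eq0; apply/eqP/inj.
    apply: (@boxW _ _ (4 * d + (4 * d + 4 * d))); first by rewrite /d; lra.
    by apply: boxD => //; apply: boxN; exact: boxD.
  rewrite (chomB he) (chomD he) !ez addrACA !h2; abel.
have z0 x y : z x y = 0.
  apply: funext => i.
  have zM m : (x + x) *+ 2 ^ m = x *+ 2 ^ m + x *+ 2 ^ m by rewrite mulrnDl.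
  apply: (@double_bounded_eq0 R (fun j => z (x *+ 2 ^ j) (y *+ 2 ^ j) i) (4 * d)).
    by move=> j; rewrite expnS mulSn mul1n !mulrnDr z2.
  by move=> j; exact: bz.
have hD x y : h (x + y) = h x + h y.
  by apply/eqP; rewrite -subr_eq0 opprD addrA -ez z0 (chom0 he).
have hB x y : h (x - y) = h x - h y.
  by have := hD (x - y) y; rewrite subrK => ->; rewrite addrK.
exists h => //; apply/cont_homP; split=> // W /nbhs0_half [W1 [nW1 sW1 W1W _]].
have [t' t'0 ht'] := box_nbhsP (chom_nbhs he nW1).
(* Repeated halving ends in a box of size at most [2 t], which must fit into the one of size [t'];
   [t <= d] keeps the comparisons inside the injectivity box. *)
pose t := Num.min (t' / 2) d.
have t0 : 0 < t by rewrite /t lt_min d0 andbT; lra.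
have tt2 : t <= t' / 2 by rewrite /t ge_min lexx.
have td : t <= d by rewrite /t ge_min lexx orbT.
have [Ot nOt HOt] := He _ (box_nbhs n t0).
have [O2 [nO2 sO2 O2s O2sub]] := nbhs0_quarter (filterI (filterI nOt nW1) nY).
have O20 : O2 0 by exact: nbhs_singleton.
(* Continuity: [h x] is a small element plus [e v], with [v] so far only in a fixed box. Exact
   doubling of [h] forces [v] into smaller boxes as [x] approaches zero. *)
pose rep b x := exists o v, [/\ O2 o, q o = f x, h x = o + e v & box b v].
pose X0 := [set x | (q @` O2) (f x)] `&` [set x | Y (u x)].
have nX0 : nbhs 0 X0 by apply: filterI => //; exact: (chom_nbhs hf (oq _ nO2)).
have repX0 x : X0 x -> rep (d + d) x.
  case=> -[o O2o qo] Yu.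
  have [||v bv ev] := HO (u x - o); first by rewrite /= (chomB hq) qu qo subrr.
    have -> : u x - o = u x + - o + 0 + 0 by abel.
    by apply: YO => //; have [_] := O2sub _ (sO2 _ O2o).
  exists o, (v + c x); split => //; last exact: boxD.
  by rewrite (chomD he) ev /h; abel.
(* Comparing the representations at [x] and [x + x] gives [2 v = v' - s] with [s] in the box of size
   [t]; a bound [r + t] for [v'] becomes [(r + 2 t) / 2 = r / 2 + t] for [v]. *)
have repl l : nbhs 0 [set x | rep ((d + d) * 2^-1 ^+ l + t) x].
  elim: l => [|l IH].
    apply: filterS nX0 => x /repX0 [o [v [? ? ? bv]]]; exists o, v; split => //.
    by apply: boxW bv; rewrite expr0; lra.
  have nI := chom_nbhs (cont_homD (@cont_hom_id P) (@cont_hom_id P)) IH.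
  apply: filterS (filterI nX0 nI) => x [/repX0 [o [v [O2o qo hx bv]]]].
  move=> [o' [v' [O2o' qo' hx' bv']]]; exists o, v; split => //.
  have [||s bs es] := HOt (o + o - o').
  - by rewrite /= (chomB hq) (chomD hq) qo qo' (chomD hf); abel.
  - have -> : o + o - o' = o + o + - o' + 0 by abel.
    by have [[]] := O2s _ _ _ _ O2o O2o (sO2 _ O2o') O20.
  have ev : e (v' - (v + v) - s) = 0.
    rewrite !(chomB he) (chomD he) es.
    have -> : e v' = h (x + x) - o' by rewrite hx'; abel.
    by rewrite h2 hx; abel.
  have pl : (2^-1 : R) ^+ l <= 1 by rewrite exprn_ile1 ?invr_ge0 ?invf_le1 // ler1n.
  have dl : (d + d) * 2^-1 ^+ l <= (d + d) * 1 by rewrite ler_wpM2l //; lra.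
  have ev0 : v' - (v + v) - s = 0.
    apply: inj ev; apply: (@boxW _ _ (((d + d) * 2^-1 ^+ l + t) + ((d + d) + (d + d)) + t)).
      by rewrite /d in dl td *; lra.
    by apply: boxD; [apply: boxD|] => //; apply: boxN => //; exact: boxD.
  move=> i; have := congr1 (fun g : powg 'I_n R => g i) ev0.
  rewrite -[LHS]/(v' i - (v i + v i) - s i) -[RHS]/(0 : R) => evi.
  have := bs i; have := bv' i; rewrite !ler_norml exprS => /andP[? ?] /andP[? ?].
  apply/andP; split; lra.
have [l hl] := half_pow_small (divr_gt0 t0 (addr_gt0 d0 d0)).
apply: filterS (repl l) => x [o [v [O2o qo hx bv]]]; rewrite /= hx; apply: W1W.
  by have [[]] := O2sub _ O2o.
apply: ht'; apply: boxW bv.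
by move: hl; rewrite ltr_pdivlMr ?addr_gt0 // => hl; lra.
Qed.

End lifting.

(** * Classes of groups with the lifting property *)

Section lift_classes.
Variable R : realType.

Definition lifts (P : topologicalZmodType) :=
  forall (B C : topologicalZmodType) (q : B -> C),
  cont_hom B C q -> open_at0 q -> (forall y, exists x, q x = y) ->
  loc_vec R [set b | q b = 0] ->
  forall f, cont_hom P C f -> exists2 g, cont_hom P B g & forall x, q (g x) = f x.

Definition abstractly_projective (D : zmodType) := forall (B C : zmodType) (q : B -> C) (f : D -> C),
  (forall x y, q (x - y) = q x - q y) -> (forall y, exists x, q x = y) ->
  (forall x y, f (x - y) = f x - f y) ->
  exists2 g : D -> B, (forall x y, g (x - y) = g x - g y) & forall x, q (g x) = f x.

Lemma lifts_discrete (D : zmodType) : abstractly_projective D -> lifts (discrete_topology D).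
Proof.
move=> pD B C q hq _ sq _ f hf.
have [g gB qg] := pD B C q f (chomB hq) sq (chomB hf).
by exists g => //; exact: discrete_cont_hom.
Qed.

Lemma int_projective : abstractly_projective int.
Proof.
move=> B C q f qB sq fB; have [b qb] := sq (f 1).
have hq : cont_hom (discrete_topology B) (discrete_topology C) q by exact: discrete_cont_hom.
have hf : cont_hom (discrete_topology int) (discrete_topology C) f.
  exact: discrete_cont_hom.
exists (fun n => b *~ n) => [x y|n]; first exact: mulrzBr.
by rewrite (chomMz hq) qb -(chomMz hf) intz.
Qed.

Section freeg.
Variables (B : zmodType).

Definition fgeval (b : nat -> B) (x : {freeg nat}) : B := \sum_(i <- dom x) b i *~ coeff i x.

Lemma fgevalE b (x : {freeg nat}) s : uniq s -> {subset dom x <= s} ->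
  fgeval b x = \sum_(i <- s) b i *~ coeff i x.
Proof.
move=> us ds; rewrite (bigID (mem (dom x))) /= [X in _ + X]big1 => [|i]; last first.
  by move/coeff_outdom ->; rewrite mulr0z.
rewrite addr0 -big_filter; apply: perm_big; apply: uniq_perm.
- exact: uniq_dom.
- exact: filter_uniq.
- by move=> i; rewrite mem_filter andbC /=; case: (boolP (i \in dom x)) => [/ds ->|]; rewrite ?andbF.
Qed.

Lemma fgevalB b x y : fgeval b (x - y) = fgeval b x - fgeval b y.
Proof.
pose s := undup (dom x ++ dom y).
have us : uniq s by exact: undup_uniq.
rewrite (@fgevalE b x s) //; last by move=> i ix; rewrite mem_undup mem_cat ix.
rewrite (@fgevalE b y s) //; last by move=> i iy; rewrite mem_undup mem_cat iy orbT.
rewrite (@fgevalE b (x - y) s) //; last first.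
  by move=> i /domB; rewrite mem_undup.
by rewrite -sumrB; apply: eq_bigr => i _; rewrite coeffB mulrzBr.
Qed.

Lemma fgevalU b i : fgeval b << i >> = b i.
Proof. by rewrite /fgeval domU1 big_seq1 coeffU eqxx mulr1 mulr1z. Qed.

End freeg.

Lemma freeg_projective : abstractly_projective {freeg nat}.
Proof.
move=> B C q f qB sq fB.
have [b qb] := choice (fun i => sq (f << i >>)).
exists (fgeval b); first exact: fgevalB.
have q0 : q 0 = 0 by rewrite -(subrr 0) qB subrr.
have f0 : f 0 = 0 by rewrite -(subrr 0) fB subrr.
have hq : cont_hom (discrete_topology B) (discrete_topology C) q by exact: discrete_cont_hom.
have hf : cont_hom (discrete_topology {freeg nat}) (discrete_topology C) f.
  exact: discrete_cont_hom.
move=> x; rewrite /fgeval.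
rewrite (chom_sum hq) -[in RHS](freeg_sumE x) (chom_sum hf); apply: eq_bigr => i _.
have -> : << coeff i x *g i >> = << i >> *~ coeff i x by rewrite freegU_mulz intz.
by rewrite (chomMz hq) (chomMz hf) qb.
Qed.

Lemma lifts_dsum (P Q : topologicalZmodType) : lifts P -> lifts Q -> lifts (P ⊕ Q).
Proof.
move=> lP lQ B C q hq oq sq vq f hf.
have [g1 hg1 qg1] := lP _ _ _ hq oq sq vq _ (cont_hom_comp (inl_cont_hom P Q) hf).
have [g2 hg2 qg2] := lQ _ _ _ hq oq sq vq _ (cont_hom_comp (inr_cont_hom P Q) hf).
exists (fun x => g1 x.1 + g2 x.2).
  apply: cont_homD.
    exact: (cont_hom_comp (fst_cont_hom P Q) hg1).
  exact: (cont_hom_comp (snd_cont_hom P Q) hg2).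
move=> [x y]; rewrite (chomD hq) qg1 qg2 /= -(chomD hf); congr f.
by congr pair; [exact: addr0|exact: add0r].
Qed.

Lemma lifts_iso (P Q : topologicalZmodType) : top_iso P Q -> lifts P -> lifts Q.
Proof.
move=> [a [b [ha hb ab ba]]] lP B C q hq oq sq vq f hf.
have [g hg qg] := lP _ _ _ hq oq sq vq _ (cont_hom_comp ha hf).
exists (g \o b); first exact: cont_hom_comp hb hg.
by move=> x; rewrite /= qg /= ba.
Qed.

Lemma lifts_real : lifts R.
Proof.
move=> B C q hq oq sq vq f hf.
have [Y nY HY] := hyers_lift hq oq vq.
have [W [nW sW WY WsY]] := nbhs0_quarter nY.
have W0 : W 0 by exact: nbhs_singleton.
have [r r0 hr] := real_nbhs0P (chom_nbhs hf (oq _ nW)).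
have hu x : exists b, q b = f x /\ (`|x| < r -> W b).
  have [/hr [b Wb qb]|nx] := pselect (`|x| < r); first by exists b.
  by have [b qb] := sq (f x); exists b.
have [u0 hu0] := choice hu.
(* Smaller than [r], so that the period [s] itself has a small lift, and not only the points of
   [[0, s)]. *)
pose s := r / 2; have s0 : 0 < s by rewrite /s; lra.
have sr : s < r by rewrite /s; lra.
pose fl (x : R) : int := Num.floor (x / s).
pose fr (x : R) : R := x - (fl x)%:~R * s.
have frP x : 0 <= fr x /\ fr x < s.
  have /andP[] := floor_itv (x / s); rewrite -/(fl x) ler_pdivlMr // ltr_pdivrMr //.
  by rewrite intrD mulrDl mul1r /fr => ? ?; split; lra.
pose u x := u0 s *~ fl x + u0 (fr x).
have Wu x : `|x| < r -> W (u0 x) by have [_] := hu0 x.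
have Ws : W (u0 s) by apply: Wu; rewrite gtr0_norm.
have Wfr x : W (u0 (fr x)).
  by have [? ?] := frP x; apply: Wu; rewrite ger0_norm // (lt_trans _ sr).
have qu x : q (u x) = f x.
  rewrite /u (chomD hq) (chomMz hq) !(hu0 _).1 -(chomMz hf) -(chomD hf); congr f.
  by rewrite /fr -mulrzl; lra.
have uY x y : Y (u (x + y) - u x - u y).
  have [x1 x2] := frP x; have [y1 y2] := frP y.
  (* [m] is the carry in the addition of remainders. The defect is thus at most one copy of [u0 s]
     and three values at remainders, which are the four summands allowed by [nbhs0_quarter]. *)
  have [m em flm] : exists2 m : int, (m == 0) || (m == 1) & fl (x + y) = fl x + fl y + m.
    have e : x + y = (fl x + fl y)%:~R * s + (fr x + fr y) by rewrite intrD /fr; lra.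
    have [lt|ge] := ltP (fr x + fr y) s.
      exists 0 => //; rewrite addr0 {1}/fl; apply: floor_def.
      rewrite ler_pdivlMr // ltr_pdivrMr // !intrD in e *.
      by apply/andP; split; lra.
    exists 1 => //; rewrite {1}/fl; apply: floor_def.
    rewrite ler_pdivlMr // ltr_pdivrMr // !intrD in e *.
    by apply/andP; split; lra.
  have -> : u (x + y) - u x - u y =
      u0 s *~ m + u0 (fr (x + y)) + - u0 (fr x) + - u0 (fr y).
    by rewrite /u flm !mulrzDr; abel.
  apply: WY; [|exact: Wfr|exact/sW/Wfr|exact/sW/Wfr].
  by case/orP: em => /eqP ->; rewrite ?mulr0z ?mulr1z.
suff nu : nbhs 0 [set x | Y (u x)] by exact: (HY R f u hf qu uY nu).
apply: filterS (real_nbhs0 s0) => x; rewrite /= ltr_norml => /andP[xs1 xs2].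
have [x0|x0] := leP 0 x.
  have fl0 : fl x = 0.
    apply: floor_def; rewrite ler_pdivlMr // ltr_pdivrMr //; apply/andP; split; lra.
  by rewrite /u fl0 mulr0z add0r; apply/WsY/Wfr.
(* Just below zero the integer part jumps, and smallness survives because [u0 s] is small too. *)
have fl0 : fl x = -1.
  apply: floor_def; rewrite ler_pdivlMr // ltr_pdivrMr //; apply/andP; split; lra.
rewrite /u fl0 mulrNz mulr1z.
have -> : - u0 s + u0 (fr x) = - u0 s + u0 (fr x) + 0 + 0 by abel.
by apply: WY => //; exact: sW.
Qed.

Lemma lifts_powg (I : choiceType) (P : topologicalZmodType) : lifts P -> lifts (powg I P).
Proof.
move=> lP B C q hq oq sq vq f hf.
have [Y nY HY] := hyers_lift hq oq vq.
have [W [nW sW WY WsY]] := nbhs0_quarter nY.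
have W0 : W 0 by exact: nbhs_singleton.
have [s0 [V [nV VW]]] := powg_nbhsP (chom_nbhs hf (oq _ nW)).
pose s := undup s0; have us : uniq s by exact: undup_uniq.
have hg i := lP _ _ _ hq oq sq vq _ (cont_hom_comp (single_cont_hom P i) hf).
have [g hg1 hg2] : exists2 g : I -> P -> B, forall i, cont_hom P B (g i) &
    forall i x, q (g i x) = f (single i x).
  have [g h] := choice (fun i => let: ex_intro2 g h1 h2 := hg i in
     ex_intro (fun g => cont_hom P B g /\ forall x, q (g x) = f (single i x)) g (conj h1 h2)).
  by exists g => i; have [] := h i.
pose G (x : powg I P) := \sum_(i <- s) g i (x i).
have hG : cont_hom (powg I P) B G.
  apply: cont_hom_sum => i; exact: (cont_hom_comp (proj_cont_hom P i) (hg1 i)).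
pose tl (x : powg I P) : powg I P := x - \sum_(i <- s) single i (x i).
have tlB x y : tl (x + y) = tl x + tl y.
  apply: funext => j.
  rewrite -[LHS]/((x + y) j - (\sum_(i <- s) single i ((x + y) i)) j).
  rewrite -[RHS]/(x j - (\sum_(i <- s) single i (x i)) j + (y j - (\sum_(i <- s) single i (y i)) j)).
  rewrite !powg_sumE //; case: (j \in s); rewrite -[(x + y) j]/(x j + y j); abel.
(* [tl x] vanishes on [s], so it lies in the chosen neighborhood whatever its other coordinates are:
   the lift is small for all [x], not only near zero. *)
have hu x : exists2 b, W b & q b = f (tl x).
  have [|b Wb qb] := VW (tl x); last by exists b.
  move=> i; rewrite -mem_undup => is0.
  rewrite /tl -[X in V X]/(x i - (\sum_(j <- s) single j (x j)) i) powg_sumE // is0 subrr.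
  exact: nbhs_singleton.
have [u0 Wu0 qu0] : exists2 u0 : powg I P -> B, forall x, W (u0 x) & forall x, q (u0 x) = f (tl x).
  have [u0 h] := choice (fun x => let: ex_intro2 b h1 h2 := hu x in
     ex_intro (fun b => W b /\ q b = f (tl x)) b (conj h1 h2)).
  by exists u0 => x; have [] := h x.
pose u x := G x + u0 x.
have qu x : q (u x) = f x.
  rewrite /u (chomD hq) (chom_sum hq) qu0 /tl (chomB hf) (chom_sum hf).
  have -> : \sum_(i <- s) q (g i (x i)) = \sum_(i <- s) f (single i (x i)).
    by apply: eq_bigr => i _; rewrite hg2.
  abel.
have uY x y : Y (u (x + y) - u x - u y).
  have -> : u (x + y) - u x - u y = u0 (x + y) + - u0 x + - u0 y + 0.
    by rewrite /u (chomD hG); abel.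
  by apply: WY => //; exact: sW.
suff nu : nbhs 0 [set x | Y (u x)] by exact: (HY _ f u hf qu uY nu).
apply: filterS (chom_nbhs hG nW) => x /= Wx.
have -> : u x = G x + u0 x + 0 + 0 by rewrite /u; abel.
exact: WY.
Qed.

End lift_classes.

(** * Subgroups, quotients and towers of quotients *)

Section subgroup_of.
Variables (G : zmodType) (P : set G).
Hypotheses (P0 : P 0) (PB : forall x y, P x -> P y -> P (x - y)).

Let subgroup_pred : {pred G} := fun x => `[< P x >].

Let subgroup_zmod_closed : zmod_closed subgroup_pred.
Proof.
split=> [|x y]; first exact/asboolP.
by move=> /asboolP Px /asboolP Py; apply/asboolP/PB.
Qed.

Definition subgroup_of : zmodClosed G :=
  HB.pack subgroup_pred (GRing.isZmodClosed.Build G subgroup_pred subgroup_zmod_closed).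

Lemma subgroup_ofP x : (x \in subgroup_of) <-> P x.
Proof. by split=> /asboolP. Qed.

End subgroup_of.

Lemma closed_kernel (A B : topologicalZmodType) (f : A -> B) :
  cont_hom A B f -> separated B -> closed [set x | f x = 0].
Proof.
move=> hf sB x cx; apply: sB => U /nbhs0_half [V [nV sV _ VU]].
have [y [/= fy Vy]] : [set x | f x = 0] `&` [set y | V (f (y - x))] !=set0.
  apply: cx; apply/nbhs_shift; apply: filterS (chom_nbhs hf nV) => v /=.
  by have -> : x + v - x = v by abel.
apply: VU; rewrite -[f x]opprK; apply: sV.
by move: Vy; rewrite (chomB hf) fy sub0r.
Qed.

Section quotient_map.
Variables (A B : topologicalZmodType) (f : A -> B) (N : zmodClosed A) (M : zmodClosed B).
Hypotheses (hf : cont_hom A B f) (NM : forall x, x \in N -> f x \in M).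

Definition qmap (u : quotg N) : quotg M := to_quotg M (f (projT1 (cid (to_quotg_surj u)))).

Lemma qmapE x : qmap (to_quotg N x) = to_quotg M (f x).
Proof.
rewrite /qmap; case: cid => y /= yx; apply/to_quotgP; rewrite -(chomB hf).
exact/NM/to_quotgP.
Qed.

Lemma qmap_cont_hom : cont_hom (quotg N) (quotg M) qmap.
Proof.
apply/cont_homP; split=> [u v|U nU].
  have [x <-] := to_quotg_surj u; have [y <-] := to_quotg_surj v.
  by rewrite -to_quotgB !qmapE (chomB hf) to_quotgB.
have := to_quotg_open0 N (chom_nbhs hf (chom_nbhs (to_quotg_hom M) nU)).
by apply: filterS => _ [x Ux <-]; rewrite /= qmapE.
Qed.

Lemma qmap_open : open_at0 f -> open_at0 qmap.
Proof.
move=> fo U nU; have := to_quotg_open0 M (fo _ (chom_nbhs (to_quotg_hom N) nU)).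
by apply: filterS => _ [_ [x Ux <-] <-]; exists (to_quotg N x) => //; exact: qmapE.
Qed.

Lemma qmap_surj : (forall y, exists x, f x = y) -> forall u, exists v, qmap v = u.
Proof.
move=> sf u; have [y <-] := to_quotg_surj u; have [x <-] := sf y.
by exists (to_quotg N x); exact: qmapE.
Qed.

End quotient_map.

Lemma open_id (A : topologicalZmodType) : open_at0 (@id A).
Proof. by move=> U; rewrite image_id. Qed.

Section towers.
Variable R : realType.

(** The preimage of [K] in the chart of [H] is a closed subgroup of R^n, to which
    [closed_subgroup_chart] applies. *)
Lemma loc_vec_sub (B : topologicalZmodType) (H K : set B) : loc_vec R H ->
  K 0 -> (forall x y, K x -> K y -> K (x - y)) -> closed K -> K `<=` H -> loc_vec R K.
Proof.
move=> [n [e [he eH [V nV Vinj] He]]] K0 KB cK KH.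
pose L : set (powg 'I_n R) := e @^-1` K.
have L0 : L 0 by rewrite /L /= (chom0 he).
have LB x y : L x -> L y -> L (x - y) by rewrite /L /= (chomB he); exact: KB.
have cL : closed L by apply: closed_comp cK => x _; exact: he.2.
have [c [io [hio ioL ioinj Hio]]] := closed_subgroup_chart L0 LB cL.
exists c, (e \o io); split.
- exact: cont_hom_comp hio he.
- exact: ioL.
- exists (io @^-1` V); first exact: (chom_nbhs hio nV).
  by move=> v Vv /(Vinj _ Vv); exact: ioinj.
move=> U /Hio [O nO HO]; have [O' nO' HO'] := He _ nO.
exists O' => // h Kh Oh; have [v Ov ev] := HO' _ (KH _ Kh) Oh.
have [|x Ux iox] := HO v _ Ov; first by rewrite /L /= ev.
by exists x => //=; rewrite iox.
Qed.

(** Stage [k] is a function into [B] that is a continuous homomorphism modulo [M k] only, starting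
    with the arbitrary representatives [r]. Successive stages differ by elements of [M k], so they
    converge uniformly in [B] and no inverse limit has to be formed. *)
Lemma tower_lift (B P : topologicalZmodType) (M : nat -> zmodClosed B) (r : P -> B) :
  gcomplete B -> separated B -> (forall k, {subset M k.+1 <= M k}) ->
  (forall k, closed [set` M k]) ->
  (forall U, nbhs 0 U -> exists k, [set` M k] `<=` U) ->
  (forall k, exists2 H : set (quotg (M k.+1)), loc_vec R H &
     forall x, x \in M k -> H (to_quotg (M k.+1) x)) ->
  lifts R P -> cont_hom P (quotg (M 0%N)) (fun x => to_quotg (M 0%N) (r x)) ->
  exists2 g, cont_hom P B g & forall x, g x - r x \in M 0%N.
Proof.
move=> cB sB dM cM sM vM lP hr.
pose good k (s : P -> B) := cont_hom P (quotg (M k)) (fun x => to_quotg (M k) (s x)).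
pose nxt k (s t : P -> B) := forall x, t x - s x \in M k.
have step k s : good k s -> exists t, good k.+1 t /\ nxt k s t.
  move=> gs; have hq := qmap_cont_hom (@cont_hom_id B) (dM k).
  have [H vH HM] := vM k.
  have vK : loc_vec R [set u : quotg (M k.+1) | qmap id (M k) u = 0].
    apply: (loc_vec_sub vH).
    - exact: chom0 hq.
    - by move=> x y /= hx hy; rewrite (chomB hq) hx hy subrr.
    - by apply: closed_kernel hq _; exact: closed_quotg_separated.
    - move=> u /=; have [x <-] := to_quotg_surj u.
      by rewrite (qmapE (@cont_hom_id B) (dM k)) => /to_quotg0; exact: HM.
  have [g hg qg] := lP _ _ _ hq (qmap_open (@cont_hom_id B) (dM k) (@open_id B))
    (qmap_surj (@cont_hom_id B) (dM k) (fun y => ex_intro _ y erefl)) vK _ gs.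
  have [t ht] := choice (fun x => to_quotg_surj (g x)).
  exists t; split.
    by rewrite /good; under eq_fun do rewrite ht.
  by move=> x; apply/to_quotgP; rewrite -(qmapE (@cont_hom_id B) (dM k)) ht qg.
have [s [s0 hs]] := step_choice hr step.
have MD k x y : x \in M k -> y \in M k -> x + y \in M k by exact: rpredD.
have sub k n x : s (k + n)%N x - s k x \in M k.
  have dMn j : {subset M (k + j)%N <= M k}.
    by elim: j => [|j IH] y; rewrite ?addn0 // addnS => /dM /IH.
  elim: n => [|n IH]; first by rewrite addn0 subrr rpred0.
  rewrite addnS; have [_ /(_ x) h] := hs (k + n)%N.
  have -> : s (k + n).+1 x - s k x = (s (k + n).+1 x - s (k + n)%N x) + (s (k + n)%N x - s k x).
    by abel.
  by apply: MD => //; exact: dMn h.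
have cs x : gcauchy (fun k => s k x).
  move=> U /sM [k MU]; exists k => m n /subnKC <- /subnKC <-; apply: MU => /=.
  have -> : s (k + (m - k))%N x - s (k + (n - k))%N x =
    (s (k + (m - k))%N x - s k x) - (s (k + (n - k))%N x - s k x) by abel.
  by apply: rpredB; exact: sub.
have [g hg] := choice (fun x => cB _ (cs x)).
have gs k x : g x - s k x \in M k.
  apply: (closed_near (cM k)) => U /nbhs0_half [V [nV sV _ VU]].
  have [n hn] := hg x _ nV; exists (s (k + n)%N x - s k x); first exact: sub.
  have -> : s (k + n)%N x - s k x - (g x - s k x) = s (k + n)%N x - g x by abel.
  by apply/VU/hn; exact: leq_addl.
exists g; last by move=> x; rewrite -s0.
apply/cont_homP; split=> [x y|U /nbhs0_half [V [nV sV VU _]]].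
  apply: separated_eq => // U /sM [k MU]; apply: MU => /=.
  have [gk _] := hs k.
  have h : s k (x - y) - (s k x - s k y) \in M k.
    by apply/to_quotgP; rewrite (chomB gk) to_quotgB.
  have -> : g (x - y) - (g x - g y) = (g (x - y) - s k (x - y)) +
     ((s k (x - y) - (s k x - s k y)) - ((g x - s k x) - (g y - s k y))) by abel.
  by apply: MD => //; apply: rpredB => //; apply: rpredB.
have [k MV] := sM _ nV; have [gk _] := hs k.
apply: filterS (chom_nbhs gk (to_quotg_open0 _ nV)) => x [v Vv /to_quotgP vs] /=.
have -> : g x = v + (g x - s k x - (v - s k x)) by abel.
by apply: VU => //; apply: MV => /=; apply: rpredB.
Qed.

(** What is kept of R^n + T^d + D: the torus is unrolled into R^d, and the discrete summand survives
    as the countable family of coset representatives. *)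
Definition lie_chart (L : topologicalZmodType) := exists (m : nat) (e : powg 'I_m R -> L),
  [/\ cont_hom (powg 'I_m R) L e,
      exists2 V, nbhs 0 V & forall v, V v -> e v = 0 -> v = 0,
      open_at0 e
    & exists d : nat -> L, forall x, exists v k, x = e v + d k].

Lemma lie_chart_loc_vec L : lie_chart L -> loc_vec R [set: L].
Proof.
move=> [m [e [he ie oe _]]]; exists m, e; split => // U /oe nU.
by exists (e @` U).
Qed.

Lemma lie_polish_chart L : lie_polish R L -> lie_chart L.
Proof.
move=> [_ [n [d [D [cD [f [g [hf hg fg gf]]]]]]]].
have [s hs] := countable_enum 0 cD.
pose tor (v : powg 'I_(n + d) R) : powg 'I_d (circle R) :=
  fun j => to_quotg (int_subgroup R) (v (rshift n j)).
pose lin (v : powg 'I_(n + d) R) : powg 'I_n R := fun i => v (lshift d i).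
pose e (v : powg 'I_(n + d) R) : L := g ((lin v, tor v), 0).
have hlin : cont_hom (powg 'I_(n + d) R) (powg 'I_n R) lin.
  by apply: cont_hom_powg => i; exact: proj_cont_hom.
have htor : cont_hom (powg 'I_(n + d) R) (powg 'I_d (circle R)) tor.
  apply: cont_hom_powg => i.
  exact: (cont_hom_comp (proj_cont_hom R _) (to_quotg_hom (int_subgroup R))).
pose glue (a : powg 'I_n R) (t : 'I_d -> R) : powg 'I_(n + d) R :=
  fun i => match fintype.split i with inl j => a j | inr j => t j end.
have glueP a t : lin (glue a t) = a /\ tor (glue a t) = (fun j => to_quotg (int_subgroup R) (t j)).
  split; apply: funext => j.
    rewrite /lin /glue; case: (fintype.splitP (lshift d j)) => i /= ji.
      by congr a; exact: val_inj.
    by have := ltn_ord j; lia.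
  rewrite /tor /glue; case: (fintype.splitP (rshift n j)) => i /= ji.
    by have := ltn_ord i; lia.
  by congr to_quotg; congr t; apply: val_inj; rewrite /=; lia.
have he : cont_hom (powg 'I_(n + d) R) L e.
  apply: (cont_hom_comp _ hg); apply: pair_cont_hom; last exact: cont_hom0.
  exact: pair_cont_hom.
have gi := can_inj gf.
exists (n + d)%N, e; split => //.
(* An integer of absolute value at most 1/2 is zero, so no nonzero vector of this box dies in the
   torus. *)
- exists [set v | box (1 / 2) v]; first by apply: box_nbhs; lra.
  move=> v bv; rewrite -(chom0 hg) => /gi [l0 t0]; apply: funext => i.
  case: (fintype.splitP i) => j ij.
    have -> : i = lshift d j by exact: val_inj.
    exact: (congr1 (fun h => h j) l0).
  have ej : i = rshift n j by exact: val_inj.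
  have := congr1 (fun h => h j) t0; rewrite /tor -ej => /to_quotg0 /intrP [z vz].
  have := bv i; rewrite vz -intr_norm => zb.
  suff -> : z = 0 by [].
  apply/eqP; rewrite -absz_eq0; apply/negPn/negP; rewrite -lt0n => z1.
  suff : (1 : R) <= `|z|%:~R by lra.
  by rewrite -[1]/(1%:~R) ler_int; lia.
- move=> U /box_nbhsP [r r0 rU].
  pose W : set (powg 'I_n R ⊕ powg 'I_d (circle R) ⊕ discrete_topology D) :=
    [set w | [/\ forall i, i \in enum 'I_n -> `|w.1.1 i| < r,
     forall j, j \in enum 'I_d -> (to_quotg (int_subgroup R) @` [set x : R | `|x| < r]) (w.1.2 j)
     & w.2 = 0]].
  have nW : nbhs 0 W.
    apply/dsum_nbhsP.
    exists [set w | (forall i, i \in enum 'I_n -> `|w.1 i| < r) /\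
      forall j, j \in enum 'I_d -> (to_quotg (int_subgroup R) @` [set x : R | `|x| < r]) (w.2 j)].
    exists [set 0]; split; last by move=> [a b] c [h1 h2] /= ->.
      apply/dsum_nbhsP.
      exists [set a | forall i, i \in enum 'I_n -> `|a i| < r].
      exists [set b | forall j, j \in enum 'I_d -> (to_quotg (int_subgroup R) @` [set x : R | `|x| < r]) (b j)].
      split=> //; first exact: (powg_nbhs_seq _ (real_nbhs0 r0)).
      apply: (powg_nbhs_seq (A := circle R)); apply: to_quotg_open0; exact: real_nbhs0.
    exact: discrete_nbhs.
  apply: filterS (chom_nbhs hf nW) => x; rewrite /preimage /W /=.
  case fx: (f x) => [[a b] c] /= [ha hb c0].
  have ht0 j : exists t : R, `|t| < r /\ to_quotg (int_subgroup R) t = b j.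
    by have [|t ? ?] := hb j; rewrite ?mem_enum //; exists t.
  have [t ht] := choice ht0.
  exists (glue a t).
    apply: rU => i; rewrite /glue; case: fintype.split => j; last by apply: ltW; have [] := ht j.
    by apply/ltW/ha; rewrite mem_enum.
  have [la tb] := glueP a t; rewrite -[x]fg fx /e la tb c0; congr g; congr pair; congr pair.
  by apply: funext => j; have [] := ht j.
exists (fun k => g (0, s k)) => x; case fx: (f x) => [[a b] c].
have [t ht] := choice (fun j => to_quotg_surj (b j)).
have [k _ sk] := hs c I.
have [la tb] := glueP a t; exists (glue a t), k.
rewrite -[x]fg fx /e la tb -(chomD hg); congr g.
have -> : b = (fun j => to_quotg (int_subgroup R) (t j)) by apply: funext => j; rewrite ht.
by rewrite sk; congr pair; [rewrite -[RHS]/(_ + 0) addr0|rewrite -[RHS]/(0 + _) add0r].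
Qed.

(** In a small enough box, doubling an element doubles its coordinates, which stay bounded only if
    they vanish. Stability under doubling is the property to ask, as images of subgroups then need
    not be packed as subgroups. *)
Lemma no_small_subgroups L : lie_chart L -> exists2 U : set L, nbhs 0 U &
  forall S : set L, (forall x, S x -> S (x + x)) -> S `<=` U -> forall x, S x -> x = 0.
Proof.
move=> [m [e [he [V /box_nbhsP [r r0 rV] Vinj] oe _]]].
have r4 : 0 < r / 4 by lra.
exists (e @` [set v | box (r / 4) v]); first exact/oe/box_nbhs.
move=> S S2 SU x Sx.
have Sj j : S (x *+ 2 ^ j) by elim: j => [//|j IH]; rewrite expnS mulSn mul1n mulrnDr; exact: S2.
have hv0 j : exists v, box (r / 4) v /\ e v = x *+ 2 ^ j.
  by have [v ? ?] := SU _ (Sj j); exists v.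
have [v hv] := choice hv0.
have v2 j : v j.+1 = v j + v j.
  apply/eqP; rewrite -subr_eq0; apply/eqP/Vinj.
    apply: rV; apply: (@boxW _ _ (r / 4 + (r / 4 + r / 4))); first lra.
    by apply: boxD; [exact: (hv _).1|apply: boxN; apply: boxD; exact: (hv _).1].
  rewrite (chomB he) (chomD he) !(hv _).2 expnS mulSn mul1n mulrnDr; abel.
have v0 : v 0%N = 0.
  apply: funext => i; apply: (@double_bounded_eq0 R (fun j => v j i) (r / 4)).
    by move=> j; rewrite v2.
  by move=> j; exact: (hv j).1.
by have := (hv 0%N).2; rewrite v0 (chom0 he) expn0 mulr1n.
Qed.

(** [S] need not be stable under intersections. The tower decreases because [quotg N] has no small
    subgroups: every sufficiently small kernel has trivial image there, so it lies in [N]. *)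
Lemma kernel_tower (G : topologicalZmodType) (S : set (zmodClosed G)) :
  pro_lie_polish R G -> S `<=` @lie_kernels R G -> cofinal_lie_kernels R S ->
  exists N : nat -> zmodClosed G, [/\ forall k, S (N k), forall k, {subset N k.+1 <= N k}
    & forall U, nbhs 0 U -> exists k, [set` N k] `<=` U].
Proof.
move=> [pG lG] SL cS.
have [U [nU bU]] := polish_first_countable pG.
pose P k (N : zmodClosed G) := S N /\ [set` N] `<=` U k.
have [N0 [S0 N0U]] : exists N, P 0%N N.
  have [N lN NU] := lG _ (nU 0%N); have [M SM MN] := cS _ lN.
  by exists M; split => // x /MN; exact: NU.
have step k N : P k N -> exists M, P k.+1 M /\ {subset M <= N}.
  move=> [SN _]; have [_ lN] := SL _ SN.
  have [O nO HO] := no_small_subgroups (lie_polish_chart lN).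
  have [M lM MU] := lG _ (filterI (nU k.+1) (chom_nbhs (to_quotg_hom N) nO)).
  have [M' SM' MM'] := cS _ lM; exists M'; split.
    by split => // x /MM' /MU [].
  move=> x /MM' xM; apply/to_quotg0; apply: (HO (to_quotg N @` [set` M])).
  - by move=> _ [y yM <-]; exists (y + y); [exact: rpredD|rewrite (chomD (to_quotg_hom N))].
  - by move=> _ [y /MU [_ Oy] <-].
  - by exists x.
have [N [_ hN]] := step_choice (conj S0 N0U : P 0%N N0) step.
exists N; split=> [k|k|V /bU [k kV]].
- by have [[]] := hN k.
- by have [] := hN k.
- by exists k; apply: subset_trans kV; have [[]] := hN k.
Qed.

End towers.

(** * Projectivity of groups with the lifting property *)

Section pro_lie_projective.
Variable R : realType.

Lemma short_exact_open (A B C : topologicalZmodType) (i : A -> B) (p : B -> C) :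
  polish R B -> polish R C -> short_exact i p -> open_at0 p.
Proof.
move=> pB pC [_ hp _ _ rp].
apply: (open_mapping (c := fun=> 0)) => //.
- exact: polish_first_countable pB.
- exact: polish_complete pB.
- exact: polish_narrow pB.
- exact: complete_baire (polish_first_countable pC) (polish_complete pC).
- exact: polish_separated pC.
- move=> y; have [x _ px] : range p y by rewrite rp.
  by exists 0%N, x; rewrite add0r.
Qed.

Lemma embedding_nbhs (A B : topologicalZmodType) (i : A -> B) (W : set A) :
  cont_hom A B i -> closed_embedding i -> nbhs 0 W ->
  exists2 V, nbhs 0 V & forall a, V (i a) -> W a.
Proof.
move=> hi [ii _ _ ei]; rewrite nbhsE => -[O [oO O0] OW].
have [V oV eV] := ei _ oO; exists V.
  apply: open_nbhs_nbhs; split=> //.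
  have [] : (V `&` range i) 0 by rewrite -eV; exists 0 => //; exact: chom0 hi.
  by [].
move=> a Va; have [b Ob /ii <-] : (i @` O) (i a) by rewrite eV; split => //; exists a.
exact: OW.
Qed.

Lemma lifts_pro_lie (P A B C : topologicalZmodType) (i : A -> B) (p : B -> C) :
  lifts R P -> pro_lie_polish R A -> polish R B -> polish R C -> short_exact i p ->
  forall f, cont_hom P C f -> exists2 g, cont_hom P B g & forall x, p (g x) = f x.
Proof.
move=> lP lA pB pC ex f hf; have op := short_exact_open pB pC ex.
have [hi hp emb ri rp] := ex; have [ii _ ci _] := emb.
have kerp b : p b = 0 <-> exists a, i a = b.
  split=> [pb|[a <-]]; last by have : range i (i a) by [exists a]; rewrite ri.
  by have [a _ <-] : range i b by [rewrite ri]; exists a.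
have [N [lN dN sN]] : exists N : nat -> zmodClosed A, [/\ forall k, lie_kernels R (N k),
    forall k, {subset N k.+1 <= N k} & forall U, nbhs 0 U -> exists k, [set` N k] `<=` U].
  by apply: kernel_tower lA _ _ => // M lM; exists M.
(* The tower in [B] starts at the kernel of [p], so that [quotg (M 0)] is essentially [C] and any
   set-theoretic lift of [f] starts the process; the kernels in [A] come shifted by one. *)
pose Q k : set B := if k is k'.+1 then i @` [set` N k'] else [set b | p b = 0].
have Q0 k : Q k 0.
  by case: k => [|k] /=; [exact: chom0 hp|exists 0; [exact: rpred0|exact: chom0 hi]].
have QB k x y : Q k x -> Q k y -> Q k (x - y).
  case: k => [|k] /=; first by rewrite (chomB hp) => -> ->; rewrite subrr.
  by move=> [a aN <-] [b bN <-]; exists (a - b); [exact: rpredB|exact: chomB hi _ _].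
pose M k := subgroup_of (Q0 k) (QB k).
have MP k x : x \in M k <-> Q k x by exact: subgroup_ofP.
have Mi k x : x \in M k -> exists a, i a = x.
  by move/MP; case: k => [|k]; [move/kerp|move=> [a _ <-]; exists a].
have iM k a : i a \in M k.+1 <-> a \in N k.
  by split=> [/MP [b bN /ii <-]|aN] //; apply/MP; exists a.
have cM k : closed [set` M k].
  have cK : closed [set b | p b = 0] by exact: closed_kernel hp (polish_separated pC).
  case: k => [|k].
    by have -> : [set` M 0%N] = [set b | p b = 0] by apply/seteqP; split=> b; [move/MP|move=> pb; apply/MP].
  (* A limit of elements of [i (N k)] lies in the closed kernel of [p], so it comes from [A], where
     [N k] is closed. *)
  move=> x cx; have [a ax] : exists a, i a = x.
    by apply/kerp/cK => U /cx [b [/Mi /kerp ? ?]]; exists b.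
  rewrite -ax; apply/iM; have [cN _] := lN k.
  apply: (closed_near cN) => W nW; have [V nV VW] := embedding_nbhs hi emb nW.
  have [y [/MP [n nN <-] Vn]] : [set` M k.+1] `&` [set y | V (y - x)] !=set0.
    apply: cx; apply/nbhs_shift; apply: filterS nV => v /=.
    by have -> : x + v - x = v by abel.
  by exists n => //; apply: VW; rewrite (chomB hi) ax.
have dM k : {subset M k.+1 <= M k}.
  move=> x /MP [a aN <-]; case: k aN => [|k] aN; first by apply/MP/kerp; exists a.
  exact/iM/dN.
have sM U : nbhs 0 U -> exists k, [set` M k] `<=` U.
  move=> nU; have [k hk] := sN _ (chom_nbhs hi nU); exists k.+1.
  by move=> x /MP [a aN <-]; exact: hk.
have vM k : exists2 H : set (quotg (M k.+1)), loc_vec R H &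
    forall x, x \in M k -> H (to_quotg (M k.+1) x).
  (* The image of [A] in the quotient, charted by the Lie group [quotg (N k)], which [i] embeds
     there. *)
  exists [set u | exists a, u = to_quotg (M k.+1) (i a)]; last first.
    by move=> x /Mi [a <-]; exists a.
  have [_ lk] := lN k; have [n [e [he [V nV Vinj] oe _]]] := lie_polish_chart lk.
  have NM x : x \in N k -> i x \in M k.+1 by move/iM.
  pose j := qmap i (M k.+1) (N := N k).
  have jE a : j (to_quotg (N k) a) = to_quotg (M k.+1) (i a) by exact: qmapE.
  have hj : cont_hom (quotg (N k)) (quotg (M k.+1)) j by exact: qmap_cont_hom.
  have j0 u : j u = 0 -> u = 0.
    by have [a <-] := to_quotg_surj u; rewrite jE => /to_quotg0 /iM aN; apply/to_quotg0.
  exists n, (j \o e); split.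
  - exact: cont_hom_comp he hj.
  - by move=> v /=; have [a <-] := to_quotg_surj (e v); exists a; rewrite jE.
  - by exists V => // v Vv /j0; exact: Vinj.
  move=> U /oe nU.
  have [W nW HW] := embedding_nbhs hi emb (chom_nbhs (to_quotg_hom (N k)) nU).
  exists (to_quotg (M k.+1) @` W); first exact: to_quotg_open0.
  move=> _ [a ->] [w Ww wa].
  have [m ew] : exists m, i m = w - i a by apply: (@Mi k.+1); apply/to_quotgP.
  have mN : m \in N k by apply/iM; rewrite ew; apply/to_quotgP.
  have [|v Uv ev] := HW (a + m).
    by rewrite (chomD hi) ew; have -> : i a + (w - i a) = w by abel.
  exists v => //=; rewrite ev jE (chomD hi) (chomD (to_quotg_hom (M k.+1))).
  by have /to_quotg0 -> : i m \in M k.+1 by [apply/iM]; rewrite addr0.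
have sp y : exists b, p b = y by have [b _ <-] : range p y by [rewrite rp]; exists b.
have [r pr] := choice (fun x => sp (f x)).
have hr : cont_hom P (quotg (M 0%N)) (fun x => to_quotg (M 0%N) (r x)).
  apply/cont_homP; split=> [x y|U nU].
    rewrite -to_quotgB; apply/to_quotgP/MP.
    by rewrite /Q /= !(chomB hp) !pr (chomB hf) subrr.
  apply: filterS (chom_nbhs hf (op _ (chom_nbhs (to_quotg_hom (M 0%N)) nU))) => x [b Ub pb] /=.
  have /to_quotgP <- // : b - r x \in M 0%N.
  by apply/MP; rewrite /Q /= (chomB hp) pb pr subrr.
have [g hg gr] := tower_lift (polish_complete pB) (polish_separated pB) dM cM sM vM lP hr.
exists g => // x; have /MP := gr x; rewrite /Q /= (chomB hp) pr => /eqP.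
by rewrite subr_eq0 => /eqP.
Qed.

Lemma lifts_projective (Ob : topologicalZmodType -> Prop) (P : topologicalZmodType) :
  (forall A, Ob A -> pro_lie_polish R A) -> Ob P -> lifts R P -> projective_in Ob P.
Proof.
move=> Obl oP lP; split=> // A B C i p oA oB oC ex.
have [hi hp emb ri rp] := ex; have [ii _ _ _] := emb.
split.
- move=> f g _ _ e; apply: funext => x; apply: ii.
  exact: (congr1 (fun h => h x) e).
- apply/seteqP; split=> [_ [f hf <-]|g [hg pg]].
    split; first exact: cont_hom_comp hf hi.
    apply: funext => x /=; have : range i (i (f x)) by exists (f x).
    by rewrite ri.
  have gi x : exists a, i a = g x.
    have : range i (g x) by rewrite ri; exact: (congr1 (fun h => h x) pg).
    by move=> [a _ <-]; exists a.
  have [f fg] := choice gi; exists f; last by apply: funext => x; exact: fg.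
  apply/cont_homP; split=> [x y|W nW].
    by apply: ii; rewrite (chomB hi) !fg (chomB hg).
  have [V nV VW] := embedding_nbhs hi emb nW.
  by apply: filterS (chom_nbhs hg nV) => x; rewrite /= -fg; exact: VW.
apply/seteqP; split=> [_ [g hg <-]|f hf]; first exact: cont_hom_comp hg hp.
have [g hg pg] := lifts_pro_lie lP (Obl _ oA) (Obl _ oB).1 (Obl _ oC).1 ex hf.
by exists g => //; apply: funext => x; exact: pg.
Qed.

Lemma lifts_index (a : option nat) (P : topologicalZmodType) :
  lifts R P -> lifts R (powg (index_type a) P).
Proof.
by case: a => [n|] lP; [exact: (@lifts_powg R 'I_n)|exact: (@lifts_powg R nat)].
Qed.

Lemma lifts_model a b c : lifts R (projective_model R a b c).
Proof.
apply: lifts_dsum; [apply: lifts_dsum|]; apply: lifts_index.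
- exact: lifts_discrete int_projective.
- exact: lifts_discrete freeg_projective.
- exact: lifts_real.
Qed.

Lemma top_iso_open (A B : topologicalZmodType) (f : A -> B) :
  cont_hom A B f -> open_at0 f -> (forall x, f x = 0 -> x = 0) ->
  (forall y, exists x, f x = y) -> top_iso A B.
Proof.
move=> hf fo f0 sf; have fi := chom_inj hf f0; have [g fg] := choice sf.
have gf : cancel f g by move=> x; apply: fi.
exists f, g; split => //; apply/cont_homP; split=> [x y|U nU].
  by apply: fi; rewrite (chomB hf) !fg.
by apply: filterS (fo _ nU) => _ [x Ux <-]; rewrite /= gf.
Qed.

Lemma top_iso_sym (A B : topologicalZmodType) : top_iso A B -> top_iso B A.
Proof. by move=> [f [g [hf hg fg gf]]]; exists g, f. Qed.

Lemma top_iso_trans (A B C : topologicalZmodType) :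
  top_iso A B -> top_iso B C -> top_iso A C.
Proof.
move=> [f [g [hf hg fg gf]]] [f' [g' [hf' hg' fg' gf']]].
exists (f' \o f), (g \o g'); split; [exact: cont_hom_comp|exact: cont_hom_comp| |].
  by move=> x /=; rewrite fg' fg.
by move=> x /=; rewrite gf gf'.
Qed.

Lemma polish_iso (A B : topologicalZmodType) : top_iso A B -> polish R A -> polish R B.
Proof.
move=> [f [g [hf hg fg gf]]] [[S cS dS] [d [[d0 dC dT] md cd]]].
have cf := hf.2; have cg := hg.2; split.
  exists (f @` S); first exact: (sub_countable (card_image_le f S)).
  move=> O [y Oy] oO; have [|x [/= Ox Sx]] := dS (f @^-1` O) _ (open_comp (fun x _ => cf x) oO).
    by exists (g y); rewrite /preimage /= gf.
  by exists (f x); split => //; exists x.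
exists (fun x y => d (g x) (g y)); split.
- split=> // x y; split=> [/d0 /(can_inj gf)|->] //; exact/d0.
- move=> x U; split=> [nU|[e e0 eU]].
    have : nbhs (g x) (f @^-1` U) by apply: cf; rewrite gf.
    move=> /md [e e0 eU]; exists e => // y /= dy.
    by rewrite -[y]gf; exact: eU.
  have : nbhs (g x) [set y | d (g x) y < e] by apply/md; exists e.
  move=> /(cg x) h; have : nbhs x (g @^-1` [set y | d (g x) y < e]) by exact: h.
  by apply: filterS => y; exact: eU.
move=> u cu; have [l hl] := cd (g \o u) cu; exists (f l).
have -> : u = f \o (g \o u) by apply: funext => n /=; rewrite gf.
move=> W /(cf l) /hl; exact.
Qed.

Lemma lie_polish_iso (A B : topologicalZmodType) :
  top_iso A B -> lie_polish R A -> lie_polish R B.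
Proof.
move=> AB [pA [n [d [D [cD iD]]]]]; split; first exact: polish_iso AB pA.
exists n, d, D; split => //; exact: top_iso_trans (top_iso_sym AB) iD.
Qed.

Lemma lie_pro_lie (L : topologicalZmodType) : lie_polish R L -> pro_lie_polish R L.
Proof.
move=> lL; have [pL _] := lL; split=> // U nU.
have sL := polish_separated pL.
have z0 : [set 0 : L] 0 by [].
have zB (x y : L) : [set 0 : L] x -> [set 0 : L] y -> [set 0 : L] (x - y).
  by move=> /= -> ->; rewrite subrr.
pose Z := subgroup_of z0 zB; have ZP x : x \in Z <-> x = 0 by exact: subgroup_ofP.
exists Z; last by move=> x /ZP ->; exact: nbhs_singleton.
split.
  have -> : [set` Z] = [set x | id x = 0] by apply/seteqP; split=> x; [move/ZP|move=> x0; apply/ZP].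
  exact: closed_kernel (@cont_hom_id L) sL.
apply: lie_polish_iso lL; apply: (top_iso_open (to_quotg_hom Z)).
- exact: to_quotg_open0.
- by move=> x /to_quotg0 /ZP.
- exact: to_quotg_surj.
Qed.

End pro_lie_projective.

(** * Polish models *)

Section polish_models.
Variable R : realType.

Lemma polish_dsum (A B : topologicalZmodType) : polish R A -> polish R B -> polish R (A ⊕ B).
Proof.
move=> [[S cS dS] [d [[d0 dC dT] md cd]]] [[S' cS' dS'] [d' [[d0' dC' dT'] md' cd']]].
have ge0 x y : 0 <= d x y by have := dT x y x; rewrite (dC y x) (proj2 (d0 x x) erefl); lra.
have ge0' x y : 0 <= d' x y by have := dT' x y x; rewrite (dC' y x) (proj2 (d0' x x) erefl); lra.
split.
  exists (S `*` S'); first exact: countableX.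
  move=> O [[a b] Oab] oO.
  have [[V W] /= [nV nW] VW] : nbhs ((a, b) : A * B) O by exact: open_nbhs_nbhs.
  move: nV nW; rewrite !nbhsE => -[V' [oV' V'a] V'V] [W' [oW' W'b] W'W].
  have [x [V'x Sx]] := dS V' (ex_intro _ a V'a) oV'.
  have [y [W'y Sy]] := dS' W' (ex_intro _ b W'b) oW'.
  by exists (x, y); split => //; apply: VW; split; [exact: V'V|exact: W'W].
exists (fun x y => d x.1 y.1 + d' x.2 y.2); split.
- split=> [[a b] [a' b']|x y|x y z] /=.
  + split=> [h|[-> ->]]; last by rewrite (proj2 (d0 _ _) erefl) (proj2 (d0' _ _) erefl) addr0.
    have := ge0 a a'; have := ge0' b b' => ? ?.
    by congr pair; [apply/d0|apply/d0']; lra.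
  + by rewrite dC dC'.
  + by have := dT x.1 y.1 z.1; have := dT' x.2 y.2 z.2; lra.
- move=> [a b] U; split=> [[[V W] /= [/md [e e0 eV] /md' [e' e0' eW]] VW]|[e e0 eU]].
    exists (Num.min e e') => [|[a' b'] /=]; first by rewrite lt_min e0.
    rewrite lt_min => /andP[h h']; have := ge0 a a'; have := ge0' b b' => ? ?.
    by apply: VW; split; [apply: eV|apply: eW] => /=; lra.
  have e2 : 0 < e / 2 by lra.
  exists ([set y | d a y < e / 2], [set y | d' b y < e / 2]).
    by split; [apply/md|apply/md']; exists (e / 2).
  by move=> [a' b'] [/= h h']; apply: eU => /=; lra.
move=> u cu.
have [|l hl] := cd (fun n => (u n).1).
  move=> e /cu [n0 h]; exists n0 => m n hm hn; have := h m n hm hn.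
  by have := ge0' (u m).2 (u n).2; lra.
have [|l' hl'] := cd' (fun n => (u n).2).
  move=> e /cu [n0 h]; exists n0 => m n hm hn; have := h m n hm hn.
  by have := ge0 (u m).1 (u n).1; lra.
exists (l, l') => O [[V W] /= [nV nW] VW].
have [n1 _ h1] := hl _ nV; have [n2 _ h2] := hl' _ nW.
exists (maxn n1 n2) => // n /=; rewrite geq_max => /andP[? ?]; apply: VW.
by split; [exact: h1|exact: h2].
Qed.

Lemma polish_discrete (D : zmodType) : countable [set: D] -> polish R (discrete_topology D).
Proof.
move=> cD; split.
  by exists setT => // O [x Ox] _; exists x.
exists (fun x y => (x != y)%:R); split.
- split=> [x y|x y|x y z].
  + by split=> [/eqP|->]; rewrite ?eqxx // pnatr_eq0 eqb0 negbK => /eqP.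
  + by rewrite eq_sym.
  + have [->|xy] := eqVneq x y; first by rewrite add0r.
    have [<-|yz] := eqVneq y z; first by rewrite (negPf xy) /=; lra.
    by case: (x != z) => /=; lra.
- move=> x U; split=> [nU|[e e0 eU]].
    exists 1 => [|y /=]; first exact: ltr01.
    have [<-|_] := eqVneq x y; last by rewrite ltxx.
    by move=> _; exact: nbhs_singleton.
  apply: open_nbhs_nbhs; split; first exact: (@discrete_open (discrete_topology D)).
  by apply: eU; rewrite /= eqxx.
move=> u /(_ 1 ltr01) [n0 h]; exists (u n0) => U nU.
exists n0 => // n hn; have {h} := h n0 n (leqnn _) hn; rewrite /preimage /=.
have [<- _|_] := eqVneq (u n0) (u n); last by rewrite ltxx.
exact: nbhs_singleton nU.
Qed.

Lemma polish_real_power m : polish R (powg 'I_m R).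
Proof.
split.
  pose gr (p : nat * {ffun 'I_m -> int}) : powg 'I_m R := fun i => (p.2 i)%:~R * 2^-1 ^+ p.1.
  exists (range gr).
    exact: (sub_countable (card_image_le _ _) (countableP _)).
  move=> O [v Ov] oO; have /nbhs_shift /box_nbhsP [e e0 eO] : nbhs v O by exact: open_nbhs_nbhs.
  have [k hk] := half_pow_small e0.
  have k0 : 0 < (2^-1 : R) ^+ k by rewrite exprn_gt0 // invr_gt0.
  pose p := (k, [ffun i => Num.floor (v i / 2^-1 ^+ k)] : {ffun 'I_m -> int}).
  exists (gr p); split; last by exists p.
  have -> : gr p = v + (gr p - v) by abel.
  apply: eO => i; rewrite -[(gr p - v) i]/(gr p i - v i) /gr /p /= ffunE.
  have /andP[] := floor_itv (v i / 2^-1 ^+ k); rewrite ler_pdivlMr // ltr_pdivrMr //.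
  by rewrite intrD mulrDl mul1r ler_norml => ? ?; apply/andP; split; lra.
exists (fun v w => rnorm (v - w)); split.
- split=> [x y|x y|x y z].
  + split=> [/rnorm0_eq /eqP|->]; last by rewrite subrr rnorm0.
    by rewrite subr_eq0 => /eqP.
  + by rewrite -rnormN opprB.
  + by have -> : x - z = (x - y) + (y - z) by [abel]; exact: rnormD.
- move=> v U; split=> [/nbhs_shift /rnorm_nbhsP [e e0 eU]|[e e0 eU]].
    exists e => // w /= h; have -> : w = v + (w - v) by abel.
    by apply: eU; rewrite -rnormN opprB.
  apply/nbhs_shift; apply: filterS (rnorm_nbhs m e0) => w h; apply: eU => /=.
  by have -> : v - (v + w) = - w by [abel]; rewrite rnormN.
move=> u cu.
have cvi i : exists l : R, (fun n => u n i) @ \oo --> l.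
  apply/cvg_ex; apply: cauchy_cvg; apply: cauchy_exP => e e0.
  have [n0 h] := cu _ e0; exists (u n0 i), n0 => // n hn.
  rewrite /ball /=; apply: le_lt_trans (h n0 n (leqnn _) hn).
  exact: (rnorm_coord (u n0 - u n) i).
have [l hl] := choice cvi; exists (l : powg 'I_m R) => U.
move=> /nbhs_shift /powg_nbhsP [s [V [nV VU]]].
have [n0 hn0] : exists n0, forall n, (n0 <= n)%N -> forall i, i \in s -> V (u n i - l i).
  elim: s {VU} => [|i s [n1 h1]]; first by exists 0%N.
  have [n2 _ h2] : ((fun n => u n i) @ \oo) [set x | V (x - l i)].
    apply: hl; apply/nbhs_shift; apply: filterS nV => x /=.
    by rewrite addrC addKr.
  exists (maxn n1 n2) => n; rewrite geq_max => /andP[h h'] j; rewrite in_cons.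
  by case/orP => [/eqP ->|]; [exact: h2|exact: h1].
exists n0 => // n hn /=; have -> : u n = l + (u n - l) by abel.
by apply: VU => i /hn0; exact.
Qed.

Lemma lie_model m (D : zmodType) : countable [set: D] ->
  lie_polish R (powg 'I_m R ⊕ discrete_topology D).
Proof.
move=> cD; split; first by apply: polish_dsum; [exact: polish_real_power|exact: polish_discrete].
exists m, 0%N, D; split=> //.
exists (fun x => ((x.1, 0), x.2)), (fun x => (x.1.1, x.2)); split => //.
- apply: pair_cont_hom; last exact: snd_cont_hom.
  by apply: pair_cont_hom; [exact: fst_cont_hom|exact: cont_hom0].
- apply: pair_cont_hom; last exact: snd_cont_hom.
  exact: (cont_hom_comp (fst_cont_hom _ _) (fst_cont_hom _ _)).
- by case.
- by case=> -[a b] c; congr pair; congr pair; apply: funext => -[].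
Qed.

Lemma lie_discrete (D : zmodType) : countable [set: D] -> lie_polish R (discrete_topology D).
Proof.
move=> cD; apply: lie_polish_iso (lie_model 0 cD).
exists snd, (fun x => (0, x)); split => //; [exact: snd_cont_hom|exact: inr_cont_hom|].
by case=> a b; congr pair; apply: funext => -[].
Qed.

End polish_models.

(** * Subgroups of the free group on the powers of X *)

Section poly_eval.
Variable B : zmodType.

(** The homomorphism sending ['X^i] to [b i]: polynomials serve as finitely supported families of
    integers. *)
Definition peval (b : nat -> B) (q : {poly int}) : B := \sum_(i < size q) b i *~ q`_i.

Lemma pevalE b (q : {poly int}) n : (size q <= n)%N ->
  peval b q = \sum_(i < n) b i *~ q`_i.
Proof.
move=> qn; rewrite /peval (big_ord_widen n (fun i => b i *~ q`_i) qn) big_mkcond.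
apply: eq_bigr => i _; case: ltnP => // /(nth_default 0) ->; rewrite mulr0z //.
Qed.

Lemma pevalB b p q : peval b (p - q) = peval b p - peval b q.
Proof.
have sm := leq_maxl (size p) (size q); have sm' := leq_maxr (size p) (size q).
rewrite (@pevalE b p _ sm) (@pevalE b q _ sm') (@pevalE b (p - q) (maxn (size p) (size q))).
  by rewrite -sumrB; apply: eq_bigr => i _; rewrite coefB mulrzBr.
by apply: leq_trans (size_polyD _ _) _; rewrite size_polyN.
Qed.

Lemma pevalXn b (k : int) n : peval b (k *: 'X^n) = b n *~ k.
Proof.
rewrite (@pevalE b _ n.+1); last by rewrite (leq_trans (size_scale_leq _ _)) ?size_polyXn.
rewrite big_ord_recr /= coefZ coefXn eqxx mulr1 big1 ?add0r // => i _.
by rewrite coefZ coefXn ltn_eqF ?mulr0 ?mulr0z.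
Qed.

End poly_eval.

Lemma peval_hom (B C : topologicalZmodType) (f : B -> C) b q :
  cont_hom B C f -> f (peval b q) = peval (f \o b) q.
Proof.
by move=> hf; rewrite /peval (chom_sum hf); apply: eq_bigr => i _; rewrite (chomMz hf).
Qed.

Lemma free_subgroup (S : zmodClosed {poly int}) :
  exists (b : nat -> {poly int}) (piv : pred nat),
  [/\ forall i, b i \in S,
      forall q, q \in S -> exists2 c : {poly int}, (forall i, ~~ piv i -> c`_i = 0) & q = peval b c
    & forall c : {poly int}, (forall i, ~~ piv i -> c`_i = 0) -> peval b c = 0 -> c = 0].
Proof.
pose top i q := q \in S /\ size q = i.+1.
have hb i : exists b : {poly int}, b \in S /\ ((exists q, top i q) ->
    size b = i.+1 /\ forall q, q \in S -> (size q <= i.+1)%N -> (absz (b`_i)%R %| absz (q`_i)%R)%N).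
  have [[q0 hq0]|nq] := pselect (exists q, top i q); last by exists 0; split; [exact: rpred0|].
  pose P n := `[< exists q, top i q /\ absz q`_i = n >].
  have exP : exists n, P n by exists (absz q0`_i); apply/asboolP; exists q0.
  case: (ex_minnP exP) => n /asboolP [b [[bS sb] bn]] minn; exists b; split=> // _; split=> //.
  move=> q qS sq.
  have b0 : b`_i != 0.
    have : lead_coef b != 0 by rewrite lead_coef_eq0 -size_poly_gt0 sb.
    by rewrite /lead_coef sb.
  (* A nonzero remainder would be the leading coefficient of an element of [S] of the same degree,
     against minimality. *)
  set k := (q`_i %/ b`_i)%Z; set r := q - b *~ k.
  have rS : r \in S by apply: rpredB => //; apply: rpredMz.
  have ri : r`_i = (q`_i %% b`_i)%Z.
    rewrite coefB -scaler_int coefZ /modz /k; congr (_ - _); by rewrite intz.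
  suff /dvdz_mod0P : (q`_i %% b`_i)%Z = 0 by rewrite dvdzE.
  apply/eqP/negPn/negP => r0.
  have sr : size r = i.+1.
    apply/eqP; rewrite eqn_leq; apply/andP; split.
      apply: leq_trans (size_polyD _ _) _; rewrite geq_max sq size_polyN.
      by rewrite -scaler_int (leq_trans (size_scale_leq _ _)) ?sb.
    rewrite ltnNge; apply/negP => /(nth_default 0); rewrite ri => h.
    by rewrite h eqxx in r0.
  have : (n <= absz (r`_i)%R)%N by apply: minn; apply/asboolP; exists r.
  have := ltz_mod q`_i b0; rewrite ri -bn; have := modz_ge0 q`_i b0; lia.
have [b hb'] := choice hb.
pose piv i := `[< exists q, top i q >].
pose b' i := if piv i then b i else 0.
have b'S i : b' i \in S by rewrite /b'; case: ifP => _; [exact: (hb' i).1|exact: rpred0].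
have sb' i : (size (b' i) <= i.+1)%N.
  rewrite /b'; case: ifP => [/asboolP h|]; last by rewrite size_poly0.
  by have [-> _] := (hb' i).2 h.
have lb' i : piv i -> (b' i)`_i != 0.
  rewrite /b' => pi; rewrite pi; move/asboolP: pi => /(hb' i).2 [sb _].
  have : lead_coef (b i) != 0 by rewrite lead_coef_eq0 -size_poly_gt0 sb.
  by rewrite /lead_coef sb.
exists b', piv; split=> //.
- move=> q; have [n] := ubnP (size q); elim: n q => // n IH q sq qS.
  have [sn|sn] := ltnP (size q) n; first exact: IH.
  have [q0|q0] := eqVneq q 0.
    exists 0; first by move=> i _; rewrite coef0.
    by rewrite q0 /peval size_poly0 big_ord0.
  case: n => [|n] in IH sn sq *; first by rewrite ltnS leqn0 size_poly_eq0 (negPf q0) in sq.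
  have [sqn|sqn] := ltnP (size q) n.+1; first exact: IH.
  have {sqn sn}sq1 : size q = n.+1 by apply/eqP; rewrite eqn_leq sqn -ltnS sq.
  have pn : piv n by apply/asboolP; exists q.
  have : (absz ((b' n)`_n)%R %| absz (q`_n)%R)%N.
    rewrite /b' pn; move/asboolP: (pn) => /(hb' n).2 [_ h].
    by apply: h => //; rewrite sq1.
  rewrite -dvdzE => /dvdzP [k hk].
  have sq' : (size (q - k *: b' n)%R < n.+1)%N.
    rewrite ltnS; apply/leq_sizeP => j nj; rewrite coefB coefZ.
    have [->|jn] := eqVneq j n; first by rewrite hk subrr.
    have {jn nj}nj : (n.+1 <= j)%N by rewrite ltn_neqAle eq_sym jn.
    by rewrite !nth_default ?mulr0 ?subrr ?sq1 // (leq_trans (sb' n)).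
  have q'S : q - k *: b' n \in S by rewrite -[k]intz scaler_int; apply: rpredB => //; apply: rpredMz.
  have [c cP ec] := IH _ sq' q'S.
  (* Written as a difference to fit [pevalB]. *)
  exists (c - (- k) *: 'X^n).
    move=> i npi; rewrite coefB coefZ coefXn cP //.
    by have [ei|] := eqVneq i n; [rewrite ei pn in npi|rewrite mulr0 subr0].
  rewrite pevalB pevalXn mulrNz -ec -scaler_int intz; abel.
move=> c cP pc; apply/eqP/negPn/negP => c0.
have [n sc] : exists n, size c = n.+1 by exists (size c).-1; rewrite prednK // size_poly_gt0.
have cn : c`_n != 0.
  have : lead_coef c != 0 by rewrite lead_coef_eq0.
  by rewrite /lead_coef sc.
have pn : piv n by apply: contraNT cn => /cP ->.
have := congr1 (fun p : {poly int} => p`_n) pc; rewrite /peval sc big_ord_recr coef0 coefD.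
rewrite coef_sum big1 ?add0r => [|i _]; last first.
  by rewrite -scaler_int coefZ [(b' i)`_n]nth_default ?mulr0 // (leq_trans (sb' i)).
rewrite /= -scaler_int coefZ => /eqP; rewrite mulf_eq0 intz (negPf cn) /=.
by apply/negP/lb'.
Qed.

(** * Covers of Lie groups by R^m + Z^(omega) *)

Section subgroup_type.
Variables (A : zmodType) (S : zmodClosed A).

Record subg := Subg { subg_val : A; subg_valP : subg_val \in S }.

HB.instance Definition _ := [isSub for subg_val].
HB.instance Definition _ := [Choice of subg by <:].
HB.instance Definition _ := [SubChoice_isSubZmodule of subg by <:].

Lemma subg_valB x y : subg_val (x - y) = subg_val x - subg_val y.
Proof. exact: (raddfB (\val : subg -> A)). Qed.

Lemma subg_countable (K : set A) : countable K -> (forall x, x \in S -> K x) ->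
  countable [set: subg].
Proof.
move=> /countable_injP [f fi] SK; apply/countable_injP; exists (f \o subg_val) => x y _ _ /= e.
by apply: val_inj; apply: fi => //; rewrite inE; apply: SK; exact: subg_valP.
Qed.

End subgroup_type.

Lemma subg_projective (S : zmodClosed {poly int}) : abstractly_projective (subg S).
Proof.
move=> B C q f qB sq fB; have [b [piv [bS bgen bfree]]] := free_subgroup S.
have hc0 (d : subg S) : exists c : {poly int},
    (forall i, ~~ piv i -> c`_i = 0) /\ subg_val d = peval b c.
  by have [c ? ?] := bgen _ (subg_valP d); exists c.
have [c hc] := choice hc0.
have cB x y : c (x - y) = c x - c y.
  apply/eqP; rewrite -subr_eq0; apply/eqP/bfree.
    by move=> i ni; rewrite !coefB !(hc _).1 // !subr0.
  by rewrite !pevalB -!(hc _).2 subg_valB subrr.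
have [be qbe] := choice (fun i => sq (f (Subg (bS i)))).
have hq : cont_hom (discrete_topology B) (discrete_topology C) q by exact: discrete_cont_hom.
have hf : cont_hom (discrete_topology (subg S)) (discrete_topology C) f.
  exact: discrete_cont_hom.
have hv : cont_hom (discrete_topology (subg S)) (discrete_topology {poly int}) (@subg_val _ S).
  by apply: discrete_cont_hom; exact: subg_valB.
exists (fun d => peval be (c d)) => [x y|d]; first by rewrite cB pevalB.
have -> : q (peval be (c d)) = peval (q \o be) (c d) by exact: (peval_hom _ _ hq).
have -> : peval (q \o be) (c d) = peval (f \o (fun i => Subg (bS i))) (c d).
  by apply: eq_bigr => i _; rewrite /= qbe.
have <- : f (peval (fun i => Subg (bS i)) (c d)) =
    peval (f \o (fun i => Subg (bS i))) (c d) by exact: (peval_hom _ _ hf).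
congr f; apply: val_inj; apply: etrans (esym (hc d).2).
exact: (peval_hom _ (c d) hv).
Qed.

Lemma first_iso (G B : topologicalZmodType) (f : G -> B) (N : zmodClosed G) :
  cont_hom G B f -> open_at0 f -> (forall y, exists x, f x = y) ->
  (forall x, x \in N <-> f x = 0) -> top_iso (quotg N) B.
Proof.
move=> hf fo sf NP.
pose j (u : quotg N) := f (projT1 (cid (to_quotg_surj u))).
have jE x : j (to_quotg N x) = f x.
  rewrite /j; case: cid => y /= /to_quotgP /NP /eqP.
  by rewrite (chomB hf) subr_eq0 => /eqP.
have hj : cont_hom (quotg N) B j.
  apply/cont_homP; split=> [u v|U nU].
    have [x <-] := to_quotg_surj u; have [y <-] := to_quotg_surj v.
    by rewrite -to_quotgB !jE (chomB hf).
  by apply: filterS (to_quotg_open0 N (chom_nbhs hf nU)) => _ [x Ux <-]; rewrite /= jE.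
apply: (top_iso_open hj).
- move=> U nU; apply: filterS (fo _ (chom_nbhs (to_quotg_hom N) nU)) => _ [x Ux <-].
  by exists (to_quotg N x); rewrite ?jE.
- by move=> u; have [x <-] := to_quotg_surj u; rewrite jE => /NP /to_quotg0.
- by move=> y; have [x <-] := sf y; exists (to_quotg N x).
Qed.

Section covers.
Variable R : realType.

(** Polynomials represent Z^(omega) here because their degree drives the echelon argument for
    subgroups. *)
Definition cover m : topologicalZmodType := powg 'I_m R ⊕ discrete_topology {poly int}.

Lemma poly_int_countable : countable [set: {poly int}].
Proof. exact: countableP. Qed.

Lemma cover_lie m : lie_polish R (cover m).
Proof. exact: lie_model poly_int_countable. Qed.

(** Two kernel elements in one translate of a small [W] differ by a kernel element of [V], so they
    coincide; countably many translates cover [F]. *)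
Lemma discrete_kernel_countable (F L : topologicalZmodType) (p : F -> L) (V : set F) :
  narrow F -> cont_hom F L p -> nbhs 0 V -> (forall x, V x -> p x = 0 -> x = 0) ->
  countable [set x | p x = 0].
Proof.
move=> nF hp /nbhs0_sub [W nW WV] V0; have [s hs] := nF _ nW.
have [n hn] := choice hs; apply/countable_injP; exists n => x y; rewrite !inE /= => px py e.
apply/eqP; rewrite -subr_eq0; apply/eqP/V0; last by rewrite (chomB hp) px py subrr.
have -> : x - y = (x - s (n x)) - (y - s (n y)) by rewrite e; abel.
exact: WV.
Qed.

(** R^m maps by the chart and the generators ['X^k] go to its coset representatives. Local
    injectivity of the chart makes the kernel discrete. *)
Lemma lie_cover (L : topologicalZmodType) : lie_polish R L ->
  exists (m : nat) (A : topologicalZmodType) (i : A -> cover m) (p : cover m -> L),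
  [/\ lie_polish R A, short_exact i p & countable [set x | p x = 0]].
Proof.
move=> lL; have [m [e [he [V nV Vinj] eo [d hd]]]] := lie_polish_chart lL.
pose p (x : cover m) : L := e x.1 + peval d x.2.
have hp : cont_hom (cover m) L p.
  apply: cont_homD; first exact: (cont_hom_comp (fst_cont_hom _ _) he).
  have hpe : cont_hom (discrete_topology {poly int}) L (peval d).
    by apply: discrete_cont_hom; exact: pevalB.
  exact: (cont_hom_comp (snd_cont_hom _ _) hpe).
have sp y : exists x, p x = y.
  have [v [k ->]] := hd y; exists (v, (1 : int) *: 'X^k).
  by rewrite /p /= pevalXn mulr1z.
pose W : set (cover m) := [set x | V x.1 /\ x.2 = 0].
have nW : nbhs 0 W.
  apply/dsum_nbhsP; exists V, [set 0]; split => //; exact: discrete_nbhs.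
have W0 x : W x -> p x = 0 -> x = 0.
  case: x => v q [/= Vv ->]; rewrite /p /= {1}/peval size_poly0 big_ord0 addr0.
  by move=> /(Vinj _ Vv) ->.
have pL : polish R L by case: lL.
have pF : polish R (cover m) by case: (cover_lie m).
have cK := discrete_kernel_countable (polish_narrow pF) hp nW W0.
have K0 : [set x | p x = 0] 0 by exact: chom0 hp.
have KB x y : [set x | p x = 0] x -> [set x | p x = 0] y -> [set x | p x = 0] (x - y).
  by rewrite /= (chomB hp) => -> ->; rewrite subrr.
pose K := subgroup_of K0 KB; have KP x : x \in K <-> p x = 0 by exact: subgroup_ofP.
have cA : countable [set: subg K] by apply: (subg_countable cK) => x /KP.
pose i (x : discrete_topology (subg K)) : cover m := subg_val x.
have hi : cont_hom (discrete_topology (subg K)) (cover m) i.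
  by apply: discrete_cont_hom; exact: subg_valB.
have ri : range i = [set x | p x = 0].
  apply/seteqP; split=> [_ [x _ <-]|x /KP xK]; first by apply/KP; exact: subg_valP.
  by exists (Subg xK).
exists m, (discrete_topology (subg K)), i, p; split=> //; first exact: lie_discrete.
split=> //; last by apply/seteqP; split=> // y _; have [x <-] := sp y; exists x.
split.
- exact: val_inj.
- exact: hi.2.
- by rewrite ri; exact: closed_kernel hp (polish_separated pL).
move=> U _; move: nW; rewrite nbhsE => -[O [oO O0] OW].
(* [O] meets the kernel only in zero, so the translate of [O] at [i u] isolates that kernel
   point. *)
exists (\bigcup_(u in U) [set x | O (x - i u)]).
  apply: bigcup_open => u _; apply: open_near => x /= Ox.
  have := oO; rewrite openE => /(_ _ Ox) /nbhs_shift; apply: filterS => y /=.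
  by have -> : x - i u + y = x + y - i u by abel.
apply/seteqP; split=> [_ [u Uu <-]|x [[u Uu /= Ou] [a _ ea]]].
  by split; [exists u => //=; rewrite subrr|exists u].
exists u => //; apply/esym/eqP; rewrite -subr_eq0; apply/eqP/W0; first exact: OW.
have pi (b : subg K) : p (i b) = 0 by apply/KP; exact: subg_valP.
by rewrite (chomB hp) -ea !pi subrr.
Qed.

Lemma cover_lift_open (G L : topologicalZmodType) m (p : cover m -> L) (q : G -> L) (phi : G -> cover m) :
  polish R G -> cont_hom (cover m) L p -> countable [set x | p x = 0] ->
  (forall y, exists g, q g = y) -> cont_hom G (cover m) phi -> (forall g, p (phi g) = q g) ->
  open_at0 phi /\ forall v, exists g, phi g = (v, 0).
Proof.
move=> pG hp cK sq hphi pphi; have [s hs] := countable_enum 0 cK.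
have [pF _] := cover_lie m.
have op : open_at0 phi.
  apply: (open_mapping (c := s)) => //.
  - exact: polish_first_countable pG.
  - exact: polish_complete pG.
  - exact: polish_narrow pG.
  - exact: complete_baire (polish_first_countable pF) (polish_complete pF).
  - exact: polish_separated pF.
  move=> y; have [g qg] := sq (p y).
  have [n _ sn] : range s (y - phi g).
    by apply: hs; rewrite /= (chomB hp) pphi qg subrr.
  by exists n, g; rewrite sn; abel.
split=> // v.
have nT : nbhs 0 (phi @` setT) by apply: op; exact: filterT.
have [W [W' [/rnorm_nbhsP [e e0 eW] nW' WW']]] := proj1 (dsum_nbhsP _) nT.
(* The image contains a neighborhood of zero; [v / k] lies in it for large [k], and then so does its
   multiple [v] in the image. *)
have [k hk] : exists k : nat, rnorm v / e < k%:R.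
  by exists (Num.bound (rnorm v / e)); apply: archi_boundP; rewrite divr_ge0 ?rnorm_ge0 // ltW.
have k0 : (0 : R) < k%:R by apply: le_lt_trans hk; rewrite divr_ge0 ?rnorm_ge0 // ltW.
have [|g _ pg] := WW' (rscale k%:R^-1 v) 0 _ (nbhs_singleton nW').
  apply: eW; rewrite rnormZ ger0_norm ?invr_ge0 ?ltW // mulrC ltr_pdivrMr //.
  by move: hk; rewrite ltr_pdivrMr // mulrC.
exists (g *+ k); rewrite (chomMn hphi) pg.
have pairMn (w : powg 'I_m R) j : ((w, 0) : cover m) *+ j = (w *+ j, 0 *+ j).
  by elim: j => [//|j IH]; rewrite !mulrS IH.
rewrite pairMn; congr pair; last by rewrite mul0rn.
have := rscaleMz k%:R^-1 v k; rewrite -pmulrn => ->.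
by rewrite -pmulrn divff ?gt_eqF // rscale1.
Qed.

(** [Ob] is left abstract for two uses: pro-Lie groups with a quotient map [q], and Lie groups with
    [q] the identity of a projective quotient. *)
Lemma projective_cover (Ob : topologicalZmodType -> Prop) (G L : topologicalZmodType) (q : G -> L) :
  (forall A, lie_polish R A -> Ob A) -> polish R G -> projective_in Ob G ->
  lie_polish R L -> cont_hom G L q -> (forall y, exists g, q g = y) ->
  exists (m : nat) (phi : G -> cover m), [/\ cont_hom G (cover m) phi, open_at0 phi,
    forall v, exists g, phi g = (v, 0) & forall g, phi g = 0 -> q g = 0].
Proof.
move=> Obl pG [_ prG] lL hq sq; have [m [A [i [p [lA ex cK]]]]] := lie_cover lL.
have [_ _ h3] := prG _ _ _ i p (Obl _ lA) (Obl _ (cover_lie m)) (Obl _ lL) ex.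
have [_ hp _ _ _] := ex.
have [phi hphi pphi] : [set p \o g | g in cont_hom G (cover m)] q by rewrite h3.
have pp g : p (phi g) = q g by rewrite -pphi.
have [op full] := cover_lift_open pG hp cK sq hphi pp.
by exists m, phi; split => // g pg; rewrite -pp pg (chom0 hp).
Qed.

Lemma projective_cofinal (G : topologicalZmodType) : pro_lie_polish R G ->
  projective_in (pro_lie_polish R) G ->
  cofinal_lie_kernels R [set N : zmodClosed G | lie_kernels R N /\
    projective_in (lie_polish R) (quotg N)].
Proof.
move=> [pG _] prG N [cN lN].
have [m [phi [hphi op full kN]]] :=
  projective_cover (@lie_pro_lie R) pG prG lN (to_quotg_hom N) (@to_quotg_surj G N).
have [pF _] := cover_lie m.
have M0 : [set g | phi g = 0] 0 by exact: chom0 hphi.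
have MB x y : [set g | phi g = 0] x -> [set g | phi g = 0] y -> [set g | phi g = 0] (x - y).
  by rewrite /= (chomB hphi) => -> ->; rewrite subrr.
pose M := subgroup_of M0 MB; have MP x : x \in M <-> phi x = 0 by exact: subgroup_ofP.
(* The free coordinates of the image. As the image contains R^m, it is the product of R^m and this
   subgroup. *)
pose E := [set q : {poly int} | exists g, phi g = (0, q)].
have E0 : E 0 by exists 0; exact: chom0 hphi.
have EB x y : E x -> E y -> E (x - y).
  move=> [a ea] [b eb]; exists (a - b); rewrite (chomB hphi) ea eb.
  by congr pair; exact: subr0.
pose D := subgroup_of E0 EB; have DP x : x \in D <-> E x by exact: subgroup_ofP.
have phiD g : (phi g).2 \in D.
  apply/DP; have [g' eg'] := full (phi g).1; exists (g - g').
  rewrite (chomB hphi) eg'; case: (phi g) => v q.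
  by congr pair; [exact: subrr|exact: subr0].
pose f g : powg 'I_m R ⊕ discrete_topology (subg D) := ((phi g).1, Subg (phiD g)).
have fP g v (w : subg D) : phi g = (v, subg_val w) -> f g = (v, w).
  move=> e; rewrite /f; congr pair; first by rewrite e.
  by apply: val_inj => /=; rewrite e.
have hf : cont_hom G (powg 'I_m R ⊕ discrete_topology (subg D)) f.
  apply: pair_cont_hom; first exact: (cont_hom_comp hphi (fst_cont_hom _ _)).
  apply/cont_homP; split=> [x y|U nU].
    by apply: val_inj; rewrite /= (chomB hphi).
  have n2 := chom_nbhs (cont_hom_comp hphi (snd_cont_hom _ _))
    (discrete_nbhs (U := [set 0 : discrete_topology {poly int}]) erefl).
  apply: filterS n2 => g /= g0; have -> : Subg (phiD g) = 0 by exact: val_inj.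
  exact: nbhs_singleton nU.
have cD : countable [set: subg D].
  by apply: (subg_countable poly_int_countable) => x _.
have iso : top_iso (quotg M) (powg 'I_m R ⊕ discrete_topology (subg D)).
  apply: (@first_iso _ _ f M hf).
  - move=> U /op /dsum_nbhsP [V [W [nV nW VW]]]; apply/dsum_nbhsP; exists V, [set 0].
    split=> [//||v _ Vv ->]; first exact: discrete_nbhs.
    have [g Ug eg] := VW v 0 Vv (nbhs_singleton nW); exists g => //.
    exact: fP.
  - move=> [v [q qD]]; have [g eg] := full v; have /DP [g' eg'] := qD.
    exists (g + g'); apply: fP; rewrite (chomD hphi) eg eg'.
    by congr pair; [exact: addr0|exact: add0r].
  - move=> x; split=> [/MP x0|]; first exact: fP.
    move=> fx; apply/MP; move: (congr1 fst fx) (congr1 (fun z => subg_val z.2) fx).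
    by rewrite /f /=; case: (phi x) => v q /= -> ->.
have lM : lie_polish R (quotg M) := lie_polish_iso (top_iso_sym iso) (lie_model R m cD).
exists M; last by move=> x /MP /kN /to_quotg0.
split.
  split=> //; have -> : [set` M] = [set g | phi g = 0].
    by apply/seteqP; split=> x; [move/MP|move=> h; apply/MP].
  exact: closed_kernel hphi (polish_separated pF).
apply: (lifts_projective (@lie_pro_lie R) lM); apply: lifts_iso (top_iso_sym iso) _.
apply: lifts_dsum; first exact: (@lifts_powg R 'I_m _ (@lifts_real R)).
exact: lifts_discrete (@subg_projective D).
Qed.

End covers.

(** * Assembling a group from a tower of projective Lie quotients *)

Section levels.
Variable R : realType.

(* Data splitting K/K' as R^c plus the free group with basis (b_i), i in piv, by
   homomorphisms with values in K. *)
Definition splitting (G : topologicalZmodType) (K K' : zmodClosed G)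
    (x : nat * (nat -> R -> G) * (nat -> G) * pred nat) : Prop :=
  let: (c, rho, b, piv) := x in
  [/\ forall j, cont_hom R G (rho j) /\ forall t, rho j t \in K,
      forall i, b i \in K,
      forall g, g \in K -> exists (z : nat -> R) (q : {poly int}),
        (forall i, ~~ piv i -> q`_i = 0) /\
        g - \sum_(j < c) rho j (z j) - peval b q \in K',
      forall (z : nat -> R) (q : {poly int}), (forall i, ~~ piv i -> q`_i = 0) ->
        \sum_(j < c) rho j (z j) + peval b q \in K' ->
        (forall j, (j < c)%N -> z j = 0) /\ q = 0
    & forall e : R, 0 < e -> exists2 O : set G, nbhs 0 O & forall g, g \in K -> O g ->
        exists z : nat -> R, (forall j, (j < c)%N -> `|z j| < e) /\
          g - \sum_(j < c) rho j (z j) \in K'].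

(** [phi] embeds [K/K'] in R^m plus a free group. Its trace [W] on R^m is a vector subspace, whose
    coordinate lines are lifted to [G] by [lR]; its projection to the free group is free, so
    elements of [K] over a basis can be chosen at will. *)
Lemma splitting_exists (G : topologicalZmodType) (K K' : zmodClosed G) m (phi : G -> cover R m) :
  closed [set` K] -> {subset K' <= K} -> cont_hom G (cover R m) phi -> open_at0 phi ->
  (forall v, exists g, phi g = (v, 0)) -> (forall g, g \in K' <-> phi g = 0) ->
  (forall g n, g *+ n.+1 \in K -> g \in K) ->
  (forall f, cont_hom R (quotg K') f ->
     exists2 g, cont_hom R G g & forall t, to_quotg K' (g t) = f t) ->
  exists x, splitting K K' x.
Proof.
move=> cK sK hphi op full kphi tK lR.
have hphi1 := cont_hom_comp hphi (fst_cont_hom _ _).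
have hphi2 := cont_hom_comp hphi (snd_cont_hom _ _).
have phi0 g : (phi g).1 = 0 -> (phi g).2 = 0 -> g \in K'.
  by move=> h1 h2; apply/kphi; case: (phi g) h1 h2 => v q /= -> ->.
have inK g g' : g' \in K -> phi g = phi g' -> g \in K.
  move=> g'K e; have -> : g = (g - g') + g' by abel.
  by apply: rpredD => //; apply: sK; apply/kphi; rewrite (chomB hphi) e subrr.
pose W : set (powg 'I_m R) := [set v | exists2 g, g \in K & phi g = (v, 0)].
have W0 : W 0 by exists 0; [exact: rpred0|exact: chom0 hphi].
have WB x y : W x -> W y -> W (x - y).
  move=> [g gK eg] [h hK eh]; exists (g - h); first exact: rpredB.
  by rewrite (chomB hphi) eg eh; congr pair; exact: subr0.
have WK g v : W v -> phi g = (v, 0) -> g \in K.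
  by move=> [h hK eh] eg; apply: inK hK _; rewrite eh.
have openV U : nbhs 0 U -> exists2 V, nbhs 0 V & forall v, V v -> exists2 u, U u & phi u = (v, 0).
  move=> nU; have [V [V' [nV nV' VV']]] := proj1 (dsum_nbhsP _) (op _ nU).
  by exists V => // v Vv; have [u] := VV' v 0 Vv (nbhs_singleton nV'); exists u.
have cW : closed W.
  move=> v cv; have [g eg] := full v; exists g => //.
  apply: (closed_near cK) => U nU; have [V nV VU] := openV _ nU.
  have [w [[h hK eh] /= Vw]] : W `&` [set w | V (w - v)] !=set0.
    apply: cv; apply/nbhs_shift; apply: filterS nV => w /=.
    by have -> : v + w - v = w by abel.
  have [u Uu eu] := VU _ Vw; exists (g + u); last by rewrite addrC addKr.
  apply: inK hK _; rewrite (chomD hphi) eg eu eh; congr pair; last exact: addr0.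
  rewrite -[LHS]/(v + (w - v)); abel.
have [c [io [hio ioW ioinj Hio]]] := closed_subgroup_chart W0 WB cW.
(* Torsion-freeness of [quotg K] keeps [w / (k + 1)] in [W]; for large [k] it is in the range of the
   chart, and so is its multiple [w]. *)
have ioS w : W w -> exists x, io x = w.
  move=> Ww; have [O nO HO] := Hio _ filterT.
  have [e e0 eO] := rnorm_nbhsP nO.
  have [k hk] : exists k : nat, rnorm w / e < k.+1%:R.
    exists (Num.bound (rnorm w / e)); apply: lt_trans (archi_boundP _) _.
      by rewrite divr_ge0 ?rnorm_ge0 // ltW.
    by rewrite ltr_nat.
  pose w' := rscale k.+1%:R^-1 w.
  have w'k : w' *+ k.+1 = w.
    have := rscaleMz k.+1%:R^-1 w k.+1; rewrite -pmulrn => ->.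
    by rewrite -pmulrn divff ?pnatr_eq0 // rscale1.
  have Ww' : W w'.
    have [g eg] := full w'; exists g => //; apply: (tK g k); apply: WK Ww _.
    rewrite (chomMn hphi) eg.
    have pairMn (u : powg 'I_m R) j : ((u, 0) : cover R m) *+ j = (u *+ j, 0 *+ j).
      by elim: j => [//|j IH]; rewrite !mulrS IH.
    by rewrite pairMn w'k; congr pair; exact: mul0rn.
  have [|x _ ex] := HO w' Ww'.
    apply: eO; rewrite rnormZ ger0_norm ?invr_ge0 // mulrC ltr_pdivrMr //.
    by move: hk; rewrite ltr_pdivrMr // mulrC.
  by exists (x *+ k.+1); rewrite (chomMn hio) ex.
have [ga ega] := choice full.
(* A section of [phi] over R^m with values modulo [K']; it is continuous because [phi] is open. *)
have hsig : cont_hom (powg 'I_m R) (quotg K') (fun v => to_quotg K' (ga v)).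
  apply/cont_homP; split=> [x y|U nU].
    rewrite -to_quotgB; apply/to_quotgP/kphi; rewrite !(chomB hphi) !ega.
    by congr pair; [exact: subrr|rewrite -[LHS]/(0 - (0 - 0)) !subr0].
  have [V nV VU] := openV _ (chom_nbhs (to_quotg_hom K') nU).
  apply: filterS nV => v /VU [u Uu eu] /=.
  by have /to_quotgP -> : ga v - u \in K' by [apply/kphi; rewrite (chomB hphi) ega eu subrr].
have hrho (j : 'I_c) : exists r : R -> G, cont_hom R G r /\ forall t, phi (r t) = (io (single j t), 0).
  have [r hr er] := lR _ (cont_hom_comp (cont_hom_comp (single_cont_hom R j) hio) hsig).
  exists r; split => // t; have /to_quotgP /kphi := er t.
  by rewrite (chomB hphi) ega => /eqP; rewrite subr_eq0 => /eqP.
have [rho0 hrho0] := choice hrho.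
(* Zero maps beyond [c], so that the type of the data does not depend on [c]. *)
pose rho (j : nat) : R -> G := if insub j is Some i then rho0 i else fun=> 0.
have rhoE (j : 'I_c) : rho j = rho0 j by rewrite /rho valK.
have phirho (z : nat -> R) : phi (\sum_(j < c) rho j (z j)) = (io (fun j => z j), 0).
  rewrite (chom_sum hphi).
  have pairsum (s : seq 'I_c) (F : 'I_c -> powg 'I_m R) :
      \sum_(j <- s) ((F j, 0) : cover R m) = (\sum_(j <- s) F j, 0).
    elim: s => [|j s IH]; first by rewrite !big_nil.
    by rewrite !big_cons IH; congr pair; exact: addr0.
  under eq_bigr => j _ do rewrite rhoE (hrho0 j).2.
  rewrite pairsum -(chom_sum hio); congr (io _, _); apply: funext => i.
  have := @powg_sumE 'I_c (R : topologicalZmodType) (index_enum 'I_c) (fun j => z j) i (index_enum_uniq _).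
  by rewrite mem_index_enum.
pose E := [set q : {poly int} | exists2 g, g \in K & (phi g).2 = q].
have E0 : E 0 by exists 0; [exact: rpred0|rewrite (chom0 hphi)].
have EB x y : E x -> E y -> E (x - y).
  move=> [a aK ea] [b bK eb]; exists (a - b); first exact: rpredB.
  by rewrite (chomB hphi) -ea -eb.
pose D := subgroup_of E0 EB; have DP x : x \in D <-> E x by exact: subgroup_ofP.
have [be [piv [beD begen befree]]] := free_subgroup D.
have hb i : exists g, g \in K /\ (phi g).2 = be i.
  by have /DP [g gK eg] := beD i; exists g.
have [b hb'] := choice hb.
have bK i : b i \in K by have [] := hb' i.
have pbK q : peval b q \in K by apply: rpred_sum => i _; apply: rpredMz.
have phib q : (phi (peval b q)).2 = peval be q.
  have := peval_hom b q hphi2; rewrite /= => ->; apply: eq_bigr => i _.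
  by rewrite /= (hb' i).2.
have rhoK j t : rho j t \in K.
  rewrite /rho; case: insubP => [i _ _|_]; last exact: rpred0.
  exact: WK (ioW _) ((hrho0 i).2 t).
exists (c, rho, b, piv); split=> //.
- move=> j; split=> // ; rewrite /rho; case: insubP => [i _ _|_]; first by have [] := hrho0 i.
  exact: cont_hom0.
- move=> g gK; have /begen [q qP eq] : (phi g).2 \in D by apply/DP; exists g.
  have gb : g - peval b q \in K by apply: rpredB.
  have e2 : (phi (g - peval b q)).2 = 0 
    by have /= -> := chomB hphi2 g (peval b q); rewrite phib eq subrr.
  have Wg : W (phi (g - peval b q)).1.
    by exists (g - peval b q) => //; rewrite -e2; case: (phi _).
  have [x ex] := ioS _ Wg.
  pose z (j : nat) : R := if insub j is Some i then x i else 0.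
  have zx : (fun j : 'I_c => z j) = x by apply: funext => j; rewrite /z valK.
  exists z, q; split => //.
  have -> : g - \sum_(j < c) rho j (z j) - peval b q = g - peval b q - \sum_(j < c) rho j (z j).
    by abel.
  apply/kphi; rewrite (chomB hphi) phirho zx ex.
  rewrite -[X in _ - (_, X)]e2 -[X in _ - X]surjective_pairing.
  exact: subrr.
- move=> z q qP /kphi; rewrite (chomD hphi) phirho => h.
  have q0 : q = 0.
    apply: befree => //; have := congr1 snd h; rewrite /= add0r phib => e; exact: e.
  split=> // j jc; have := congr1 fst h.
  rewrite q0 /= /peval size_poly0 big_ord0 (chom0 hphi) /= addr0 => /ioinj e.
  exact: (congr1 (fun f => f (Ordinal jc)) e).
move=> e e0; have [O nO HO] := Hio _ (rnorm_nbhs c e0).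
have n2 := chom_nbhs hphi2 (discrete_nbhs (U := [set 0 : discrete_topology {poly int}]) erefl).
exists ((fst \o phi) @^-1` O `&` (snd \o phi) @^-1` [set 0]).
  by apply: filterI => //; exact: (chom_nbhs hphi1 nO).
move=> g gK [/= Og g2]; have [|x xe ex] := HO _ _ Og.
  by exists g => //; rewrite -g2; case: (phi g).
pose z (j : nat) : R := if insub j is Some i then x i else 0.
have zx : (fun j : 'I_c => z j) = x by apply: funext => j; rewrite /z valK.
exists z; split.
  move=> j jc; rewrite (_ : z j = x (Ordinal jc)); last by rewrite -zx.
  exact: le_lt_trans (rnorm_coord _ _) xe.
apply/kphi; rewrite (chomB hphi) phirho zx ex -[X in _ - (_, X)]g2 -[X in _ - X]surjective_pairing.
exact: subrr.
Qed.

End levels.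

Section reindexing.

Lemma powg_reindex (I J : choiceType) (A : topologicalZmodType) (f : J -> I) (g : I -> J) :
  cancel f g -> cancel g f -> top_iso (powg I A) (powg J A).
Proof.
move=> fg gf; exists (fun x j => x (f j)), (fun y i => y (g i)); split.
- by apply: cont_hom_powg => j; exact: proj_cont_hom.
- by apply: cont_hom_powg => i; exact: proj_cont_hom.
- by move=> x; apply: funext => i; rewrite gf.
- by move=> x; apply: funext => i; rewrite fg.
Qed.

Lemma countable_index (T : countType) :
  exists a : option nat, forall A : topologicalZmodType, top_iso (powg T A) (powg (index_type a) A).
Proof.
have [fI|iI] := pselect (finite_set [set: T]).
  have /finite_setP [n /card_set_bijP [f [fn fi fs]]] := fI; exists (Some n) => A.
  have fn' i : (f i < n)%N by exact: (fn i I).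
  have gs (j : 'I_n) : exists i, Ordinal (fn' i) = j.
    have [i _ ij] := fs j (ltn_ord j); exists i; exact: val_inj.
  have [g hg] := choice gs.
  apply: (@powg_reindex T 'I_n A g (fun i => Ordinal (fn' i))) => // i.
  by apply: fi; rewrite ?inE //; have [] := hg (Ordinal (fn' i)).
have /card_set_bijP [f [_ fi fs]] := eq_card_nat (countableP [set: T]) iI.
have gs (j : nat) : exists i, f i = j by have [i _ ij] := fs j I; exists i.
have [g hg] := choice gs; exists None => A.
apply: (@powg_reindex T nat A g f) => // i.
by apply: fi; rewrite ?inE ?hg.
Qed.

Lemma top_iso_dsum (A A' B B' : topologicalZmodType) :
  top_iso A A' -> top_iso B B' -> top_iso (A ⊕ B) (A' ⊕ B').
Proof.
move=> [f [g [hf hg fg gf]]] [f' [g' [hf' hg' fg' gf']]].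
exists (fun x => (f x.1, f' x.2)), (fun x => (g x.1, g' x.2)); split.
- by apply: pair_cont_hom; [exact: (cont_hom_comp (fst_cont_hom _ _) hf)|
    exact: (cont_hom_comp (snd_cont_hom _ _) hf')].
- by apply: pair_cont_hom; [exact: (cont_hom_comp (fst_cont_hom _ _) hg)|
    exact: (cont_hom_comp (snd_cont_hom _ _) hg')].
- by case=> x y /=; rewrite fg fg'.
- by case=> x y /=; rewrite gf gf'.
Qed.

Section extension.
Variables (T : countType) (Q : pred T) (A : topologicalZmodType).

(** Extension by zero, so that coordinates can be addressed without a proof of membership. *)
Definition ext (x : powg {t : T | Q t} A) (t : T) : A := if insub t is Some u then x u else 0.

Lemma ext_cont_hom t : cont_hom (powg {t : T | Q t} A) A (fun x => ext x t).
Proof.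
rewrite /ext; case: insub => [u|]; [exact: proj_cont_hom|exact: cont_hom0].
Qed.

Lemma ext_out x t : ~~ Q t -> ext x t = 0.
Proof. by move=> nQ; rewrite /ext insubN. Qed.

Lemma ext_val x (u : {t : T | Q t}) : ext x (val u) = x u.
Proof. by rewrite /ext valK. Qed.

End extension.

Section infinite_support.
Variable piv : pred nat.
Hypothesis ipiv : ~ finite_set [set i | piv i].

Lemma infinite_support_iso : exists th : {freeg nat} -> {poly int},
  [/\ forall x y, th (x - y) = th x - th y,
      forall y i, ~~ piv i -> (th y)`_i = 0,
      forall y, th y = 0 -> y = 0
    & forall q : {poly int}, (forall i, ~~ piv i -> q`_i = 0) -> exists y, th y = q].
Proof.
have /card_set_bijP [f [_ fi fs]] := eq_card_nat (countableP [set i | piv i]) ipiv.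
have gs (j : nat) : exists i, piv i /\ f i = j by have [i ? ij] := fs j I; exists i.
have [e he] := choice gs.
have fe j : f (e j) = j by have [] := he j.
have ef i : piv i -> e (f i) = i.
  by move=> pi; apply: fi; rewrite ?inE /= ?fe //; have [] := he (f i).
pose th (y : {freeg nat}) : {poly int} := fgeval (fun n => 'X^(e n)) y.
have thB x y : th (x - y) = th x - th y by exact: fgevalB.
have thc y i : (th y)`_i = \sum_(n <- dom y) (if i == e n then coeff n y else 0).
  rewrite /th /fgeval coef_sum; apply: eq_bigr => n _.
  by rewrite -scaler_int coefZ coefXn intz; case: eqP => _; rewrite ?mulr1 ?mulr0.
have thce y n : (th y)`_(e n) = coeff n y.
  rewrite thc; have [nd|nd] := boolP (n \in dom y); last first.
    rewrite coeff_outdom // big1 // => k _; case: eqP => // /(congr1 f); rewrite !fe => <-.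
    by rewrite coeff_outdom.
  rewrite (bigD1_seq n) ?uniq_dom //= eqxx big1 ?addr0 // => k kn.
  by case: eqP => // /(congr1 f); rewrite !fe => nk; rewrite nk eqxx in kn.
exists th; split=> //.
- move=> y i npi; rewrite thc big1 // => n _; case: eqP => // ie.
  by have [] := he n; rewrite -ie (negPf npi).
- move=> y y0; apply/eqP/freeg_eqP => n; rewrite coeff0 -thce y0 coef0 //.
move=> q qP; pose y := peval (fun i => << f i >>) q : {freeg nat}; exists y.
have hth : cont_hom (discrete_topology {freeg nat}) (discrete_topology {poly int}) th.
  exact: discrete_cont_hom.
have -> : th y = peval (th \o (fun i => << f i >>)) q by exact: (peval_hom _ q hth).
rewrite -[RHS]coefK poly_def; apply: eq_bigr => i _; rewrite /= /th fgevalU.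
rewrite -scaler_int intz; have [pi|/qP ->] := boolP (piv i); last by rewrite !scale0r.
by rewrite ef.
Qed.

End infinite_support.
End reindexing.

(** The terms after stage [k] lie in [K k] for all [x] at once: the series converges uniformly and
    its sum is continuous. *)
Lemma sum_of_levels (P G : topologicalZmodType) (K : nat -> zmodClosed G) (F : nat -> P -> G) :
  gcomplete G -> separated G -> (forall k, {subset K k.+1 <= K k}) ->
  (forall k, closed [set` K k]) ->
  (forall U, nbhs 0 U -> exists k, [set` K k] `<=` U) ->
  (forall k, cont_hom P G (F k)) -> (forall k x, F k x \in K k) ->
  exists2 S, cont_hom P G S & forall k x, S x - \sum_(j < k) F j x \in K k.
Proof.
move=> cG sG dK cK sK hF FK.
pose s k x := \sum_(j < k) F j x.
have hs k : cont_hom P G (s k) by apply: cont_hom_sum => j; exact: hF.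
have sub k n x : s (k + n)%N x - s k x \in K k.
  have dKn j : {subset K (k + j)%N <= K k}.
    by elim: j => [|j IH] y; rewrite ?addn0 // addnS => /dK /IH.
  elim: n => [|n IH]; first by rewrite addn0 subrr rpred0.
  have -> : s (k + n.+1)%N x - s k x = F (k + n)%N x + (s (k + n)%N x - s k x).
    by rewrite addnS /s big_ord_recr /=; abel.
  by apply: rpredD => //; apply: dKn (FK _ _).
have cs x : gcauchy (fun k => s k x).
  move=> U /sK [k KU]; exists k => m n /subnKC <- /subnKC <-; apply: KU => /=.
  have -> : s (k + (m - k))%N x - s (k + (n - k))%N x =
    (s (k + (m - k))%N x - s k x) - (s (k + (n - k))%N x - s k x) by abel.
  by apply: rpredB; exact: sub.
have [S hS] := choice (fun x => cG _ (cs x)).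
have Ss k x : S x - s k x \in K k.
  apply: (closed_near (cK k)) => U /nbhs0_half [V [nV sV _ VU]].
  have [n hn] := hS x _ nV; exists (s (k + n)%N x - s k x); first exact: sub.
  have -> : s (k + n)%N x - s k x - (S x - s k x) = s (k + n)%N x - S x by abel.
  by apply/VU/hn; exact: leq_addl.
exists S => //; apply/cont_homP; split=> [x y|U /nbhs0_half [V [nV sV VU _]]].
  apply: separated_eq => // U /sK [k KU]; apply: KU => /=.
  have -> : S (x - y) - (S x - S y) = (S (x - y) - s k (x - y)) -
     ((S x - s k x) - (S y - s k y)) by rewrite (chomB (hs k)); abel.
  by apply: rpredB => //; apply: rpredB.
have [k KV] := sK _ nV; apply: filterS (chom_nbhs (hs k) nV) => x /= sx.
have -> : S x = s k x + (S x - s k x) by abel.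
by apply: VU => //; apply: KV => /=.
Qed.

Section assembly.
Variables (R : realType) (G : topologicalZmodType) (K : nat -> zmodClosed G).
Variable D : nat -> nat * (nat -> R -> G) * (nat -> G) * pred nat.
Hypotheses (cG : gcomplete G) (sG : separated G) (K0 : forall g, g \in K 0%N)
  (dK : forall k, {subset K k.+1 <= K k}) (cK : forall k, closed [set` K k])
  (sK : forall U, nbhs 0 U -> exists k, [set` K k] `<=` U)
  (DK : forall k, splitting (K k) (K k.+1) (D k)).

Let c k := (D k).1.1.1.
Let rho k := (D k).1.1.2.
Let b k := (D k).1.2.
Let piv k := (D k).2.

Let DK' k : splitting (K k) (K k.+1) (c k, rho k, b k, piv k).
Proof. by have := DK k; rewrite /c /rho /b /piv; case: (D k) => [[[? ?] ?] ?]. Qed.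

(** A level of finite free rank contributes its basis elements to the power of Z; one of infinite
    rank contributes a single factor Z^(omega). *)
Let fin k : bool := `[< finite_set [set i | piv k i] >].

Let bound k : exists n, fin k -> forall i, piv k i -> (i < n)%N.
Proof.
have [/asboolP /finite_seqP [s es]|nf] := boolP (fin k); last by exists 0%N.
exists (\max_(i <- s) i).+1 => _ i pi; rewrite ltnS; apply: leq_bigmax_seq => //.
by have : [set i | piv k i] i by []; rewrite es.
Qed.

(** On levels of finite rank the zero map is a placeholder, so that one family covers all levels. *)
Let theta k : exists th : {freeg nat} -> {poly int}, [/\ forall x y, th (x - y) = th x - th y,
    ~~ fin k -> forall y i, ~~ piv k i -> (th y)`_i = 0,
    ~~ fin k -> forall y, th y = 0 -> y = 0
  & ~~ fin k -> forall q : {poly int}, (forall i, ~~ piv k i -> q`_i = 0) -> exists y, th y = q].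
Proof.
have [f|/asboolP nf] := boolP (fin k).
  by exists (fun=> 0); split => // x y; rewrite subr0.
by have [th [? ? ? ?]] := infinite_support_iso nf; exists th; split.
Qed.

Let QZ (u : nat * nat) : bool := fin u.1 && piv u.1 u.2.
Let QF (k : nat) : bool := ~~ fin k.
Let QR (u : nat * nat) : bool := (u.2 < c u.1)%N.

Lemma assemble : exists a b c, top_iso G (projective_model R a b c).
Proof.
have [bd bdP] := choice bound; have [th thP] := choice theta.
pose P : topologicalZmodType := powg {u | QZ u} (discrete_topology int)
  ⊕ powg {k | QF k} (discrete_topology {freeg nat}) ⊕ powg {u | QR u} R.
suff iso : top_iso P G.
  have [a ha] := countable_index {u | QZ u}; have [b' hb] := countable_index {k | QF k}.
  have [c' hc] := countable_index {u | QR u}; exists a, b', c'.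
  apply: top_iso_trans (top_iso_sym iso) _.
  apply: top_iso_dsum; last exact: hc.
  by apply: top_iso_dsum; [exact: ha|exact: hb].
pose q k (x : P) : {poly int} :=
  if fin k then \poly_(i < bd k) ext x.1.1 (k, i) else th k (ext x.1.2 k).
pose z k (x : P) (j : nat) : R := ext x.2 (k, j).
pose E k (x : P) : G := \sum_(j < c k) rho k j (z k x j) + peval (b k) (q k x).
have hx11 : cont_hom P (powg {u | QZ u} (discrete_topology int)) (fun x => x.1.1).
  exact: (cont_hom_comp (fst_cont_hom _ _) (fst_cont_hom _ _)).
have hx12 : cont_hom P (powg {k | QF k} (discrete_topology {freeg nat})) (fun x => x.1.2).
  exact: (cont_hom_comp (fst_cont_hom _ _) (snd_cont_hom _ _)).
have hx2 : cont_hom P (powg {u | QR u} R) (fun x => x.2) by exact: snd_cont_hom.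
have hz k j : cont_hom P R (fun x => z k x j).
  exact: (cont_hom_comp hx2 (ext_cont_hom _ _ (k, j))).
have qsupp k x i : ~~ piv k i -> (q k x)`_i = 0.
  rewrite /q; case: ifP => fk npi; last by have [_ h _ _] := thP k; apply: h => //; rewrite fk.
  by rewrite coef_poly ext_out ?if_same // /QZ /= fk.
have hE k : cont_hom P G (E k).
  apply: cont_homD.
    apply: cont_hom_sum => j; have [h _ _ _ _] := DK' k.
    exact: (cont_hom_comp (hz k j) (h j).1).
  rewrite /q; case: (boolP (fin k)) => fk.
    have -> : (fun x : P => peval (b k) (\poly_(i < bd k) ext x.1.1 (k, i))) =
        (fun x : P => \sum_(i < bd k) b k i *~ ext x.1.1 (k, nat_of_ord i)).
      apply: funext => x; rewrite (@pevalE _ _ _ (bd k)) ?size_poly //.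
      by apply: eq_bigr => i _; rewrite coef_poly ltn_ord.
    apply: cont_hom_sum => i.
    have hm : cont_hom (discrete_topology int) G (fun n => b k i *~ n).
      by apply: discrete_cont_hom => n m; exact: mulrzBr.
    exact: (cont_hom_comp (cont_hom_comp hx11 (ext_cont_hom _ _ (k, nat_of_ord i))) hm).
  have hth : cont_hom (discrete_topology {freeg nat}) G (fun y => peval (b k) (th k y)).
    by apply: discrete_cont_hom => x y; have [-> _ _ _] := thP k; exact: pevalB.
  exact: (cont_hom_comp (cont_hom_comp hx12 (ext_cont_hom _ _ k)) hth).
have EK k x : E k x \in K k.
  have [h1 h2 _ _ _] := DK' k; apply: rpredD.
    by apply: rpred_sum => j _; exact: (h1 j).2.
  by apply: rpred_sum => i _; apply: rpredMz.
have [Phi hPhi PhiE] := sum_of_levels cG sG dK cK sK hE EK.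
have q0 k x : q k x = 0 -> (forall i, QZ (k, i) -> ext x.1.1 (k, i) = 0) /\
    (QF k -> ext x.1.2 k = 0).
  rewrite /q; case: (boolP (fin k)) => fk h; split => //.
  - move=> i /andP[_ pi]; have := congr1 (fun p : {poly int} => p`_i) h.
    by rewrite coef_poly coef0 (bdP k fk).
  - by rewrite /QF fk.
  - by move=> i; rewrite /QZ /= (negPf fk).
  - by move=> _; have [_ _ inj _] := thP k; exact: inj fk _ h.
have Phi0 x : Phi x = 0 -> x = 0.
  move=> Px.
  (* Strong induction: once the earlier levels vanish, the partial sum up to [k] is [E k x], it lies
     in [K k.+1], and independence at level [k] applies. *)
  have lev k : (forall j, (j < c k)%N -> z k x j = 0) /\ q k x = 0.
    have [n] := ubnP k; elim: n k => // n IH k; rewrite ltnS => kn.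
    have [_ _ _ free _] := DK' k; apply: free; first exact: qsupp.
    have := PhiE k.+1 x; rewrite Px sub0r rpredN big_ord_recr /= big1 ?add0r // => j _.
    have [zj qj] := IH j (leq_trans (ltn_ord j) kn).
    rewrite /E qj /peval size_poly0 big_ord0 addr0 big1 // => i _.
    by rewrite zj // (chom0 _) //; have [h _ _ _ _] := DK' j; exact: (h i).1.
  case: x Px lev => -[X Y] Z Px lev.
  congr pair; first congr pair; apply: funext => u.
  - rewrite -ext_val; have [_ /q0 [h _]] := lev (val u).1.
    case: u h => -[k i] Q h; exact: h.
  - by rewrite -ext_val; have [_ /q0 [_ h]] := lev (val u); apply: h; exact: valP u.
  - rewrite -ext_val; case: u => -[k j] Q /=; have [h _] := lev k; exact: h.
have build (zs : nat -> nat -> R) (qs : nat -> {poly int}) :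
    (forall k i, ~~ piv k i -> (qs k)`_i = 0) ->
    exists x, forall k, q k x = qs k /\ forall j, (j < c k)%N -> z k x j = zs k j.
  move=> qsP.
  have hy k : exists y : {freeg nat}, ~~ fin k -> th k y = qs k.
    have [fk|nf] := boolP (fin k); first by exists 0.
    by have [_ _ _ /(_ nf _ (qsP k)) [y hy]] := thP k; exists y.
  have [y yP] := choice hy.
  exists ((fun u => (qs (val u).1)`_(val u).2, fun k => y (val k)),
     fun u => zs (val u).1 (val u).2) => k; split.
    rewrite /q; case: (boolP (fin k)) => fk.
      apply/polyP => i; rewrite coef_poly; case: ltnP => ib.
        have [Qu|nQ] := boolP (QZ (k, i)).
          by rewrite -[(k, i)]/(val (exist (fun u => QZ u) (k, i) Qu)) ext_val.
        by rewrite ext_out // qsP //; rewrite /QZ /= fk in nQ.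
      by rewrite qsP //; apply/negP => /(bdP k fk); rewrite ltnNge ib.
    by rewrite -[k in ext _ k]/(val (exist (fun k => QF k) k fk)) ext_val yP.
  by move=> j jc; rewrite /z -[(k, j)]/(val (exist (fun u => QR u) (k, j) jc)) ext_val.
(* Surjectivity and openness at once. For [k0 = 0] nothing is asked of [g] or of the coordinates;
   for openness, [g] near zero gets a preimage small on the first [k0] levels. *)
have solve k0 (e : R) : 0 < e -> exists2 O : set G, nbhs 0 O & forall g, O g \/ k0 = 0%N ->
    exists2 x, Phi x = g & forall k, (k < k0)%N ->
      q k x = 0 /\ forall j, (j < c k)%N -> `|z k x j| < e.
  move=> e0.
  (* For [g] in [V] at level [k], small real coordinates suffice to enter the next level, and the
     remainder falls into [U]. *)
  pose small k (U V : set G) := nbhs 0 V /\ forall g, g \in K k -> V g ->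
    exists zz : nat -> R, (forall j, (j < c k)%N -> `|zz j| < e) /\
      g - \sum_(j < c k) rho k j (zz j) \in K k.+1 /\ U (g - \sum_(j < c k) rho k j (zz j)).
  (* The premise on [p.2] stands after the existential so that choice yields a total function;
     [setT] is a dummy. *)
  have back (p : nat * set G) : exists V, nbhs 0 p.2 -> small p.1 p.2 V.
    case: p => k U /=.
    have [nU|nn] := pselect (nbhs 0 U); last by exists setT.
    have [V [nV sV VU _]] := nbhs0_half nU.
    have [h1 _ _ _ h] := DK' k.
    pose sm (v : powg 'I_(c k) R) := \sum_(j < c k) rho k j (v j).
    have hsm : cont_hom (powg 'I_(c k) R) G sm.
      apply: cont_hom_sum => j.
      exact: (cont_hom_comp (proj_cont_hom R j) (h1 j).1).
    have [e' e'0 he'] := box_nbhsP (chom_nbhs hsm nV).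
    have m0 : 0 < Num.min e e' by rewrite lt_min e0.
    have [O nO HO] := h _ m0; exists (O `&` V) => _; split; first exact: filterI.
    move=> g gK [Og Vg]; have [zz [zze gz]] := HO g gK Og; exists zz.
    have ze j : (j < c k)%N -> `|zz j| < e /\ `|zz j| <= e'.
      by move=> /zze; rewrite lt_min => /andP[? /ltW].
    split; first by move=> j /ze [].
    split=> //; apply: VU => //; apply: sV; apply: (he' (fun j => zz j)) => j.
    by have [] := ze j (ltn_ord j).
  have [sb sbP] := choice back.
  (* Built backwards, [d] being the number of constrained levels still to come; nothing is required
     after the last one. *)
  pose fix Zr d : set G := if d is d'.+1 then sb ((k0 - d'.+1)%N, Zr d') else setT.
  have nZr d : nbhs 0 (Zr d).
    elim: d => [|d IH]; first exact: filterT.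
    by have [] := sbP ((k0 - d.+1)%N, Zr d) IH.
  exists (Zr k0) => // g Og.
  pose inv k g := g \in K k /\ Zr (k0 - k)%N g.
  pose rel k g g' := exists (zz : nat -> R) (qq : {poly int}),
    [/\ forall i, ~~ piv k i -> qq`_i = 0, g' = g - (\sum_(j < c k) rho k j (zz j) + peval (b k) qq)
      & (k < k0)%N -> qq = 0 /\ forall j, (j < c k)%N -> `|zz j| < e].
  have step k h : inv k h -> exists h', inv k.+1 h' /\ rel k h h'.
    move=> [hK Zh]; have [kk|kk] := ltnP k k0.
      have ek : (k0 - k)%N = (k0 - k.+1).+1 by lia.
      have [_ hs] := sbP ((k0 - (k0 - k.+1).+1)%N, Zr (k0 - k.+1)%N) (nZr _).
      have ek' : (k0 - (k0 - k.+1).+1)%N = k by lia.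
      rewrite ek /= in Zh; rewrite /= ek' in hs Zh.
      have [zz [ze [zK zZ]]] := hs _ hK Zh.
      exists (h - \sum_(j < c k) rho k j (zz j)); split => //.
      exists zz, 0; split=> //; first by move=> i _; rewrite coef0.
      by rewrite /peval size_poly0 big_ord0 addr0.
    have [_ _ gen _ _] := DK' k; have [zz [qq [qP hk]]] := gen _ hK.
    exists (h - \sum_(j < c k) rho k j (zz j) - peval (b k) qq); split.
      by split=> //; have -> : (k0 - k.+1)%N = 0%N by lia.
    exists zz, qq; split=> //; first abel.
    by rewrite ltnNge kk.
  have inv0 : inv 0%N g.
    by split=> //; rewrite subn0; case: Og => [//|->].
  have [gs [gs0 gsP]] := step_choice inv0 step.
  have relP k : exists w : (nat -> R) * {poly int},
    [/\ forall i, ~~ piv k i -> w.2`_i = 0, gs k.+1 = gs k - (\sum_(j < c k) rho k j (w.1 j) + peval (b k) w.2)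
      & (k < k0)%N -> w.2 = 0 /\ forall j, (j < c k)%N -> `|w.1 j| < e].
    by have [_ [zz [qq h]]] := gsP k; exists (zz, qq).
  have [w wP] := choice relP.
  have [|x xP] := build (fun k => (w k).1) (fun k => (w k).2).
    by move=> k; have [] := wP k.
  have Ex k : E k x = gs k - gs k.+1.
    have [_ -> _] := wP k; have [qx zx] := xP k; rewrite /E qx.
    have -> : \sum_(j < c k) rho k j (z k x j) = \sum_(j < c k) rho k j ((w k).1 j).
      by apply: eq_bigr => j _; rewrite zx.
    abel.
  exists x; last first.
    move=> k kk; have [qx zx] := xP k; have [_ _ /(_ kk) [w0 we]] := wP k.
    by rewrite qx; split=> // j jc; rewrite zx //; exact: we.
  apply: separated_eq => // U /sK [k KU]; apply: KU => /=.
  (* Each level consumes [gs k - gs k.+1], so the sums telescope; the remainder [gs k] lies in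
     [K k]. *)
  have sumE : \sum_(j < k) E j x = g - gs k.
    elim: (k) => [|l IH]; first by rewrite big_ord0 gs0 subrr.
    by rewrite big_ord_recr /= IH Ex; abel.
  have -> : Phi x - g = (Phi x - \sum_(j < k) E j x) - gs k by rewrite sumE; abel.
  by apply: rpredB => //; have [[]] := gsP k.
apply: (top_iso_open hPhi) => //.
  move=> U /dsum_nbhsP [U1 [UR [/dsum_nbhsP [UZ [UF [nZ nF ZF]]] nR HU]]].
  have [sZ [VZ [nVZ hVZ]]] := powg_nbhsP nZ; have [sF [VF [nVF hVF]]] := powg_nbhsP nF.
  have [sR [VR [/real_nbhs0P [e e0 eV] hVR]]] := powg_nbhsP nR.
  (* A basic neighborhood constrains finitely many coordinates, and [k0] exceeds the level of each
     of them. *)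
  pose mz := \max_(u <- sZ) (val u).1; pose mf := \max_(k <- sF) val k.
  pose mr := \max_(u <- sR) (val u).1; pose k0 := (mz + mf + mr).+1.
  have [O nO HO] := solve k0 e e0; apply: filterS nO => g Og.
  have [x xg xP] := HO g (or_introl Og); exists x => //.
  case: x xg xP => -[X Y] Z _ xP; apply: HU; first apply: ZF.
  - apply: hVZ => u us; rewrite -ext_val.
    have kk : ((val u).1 < k0)%N.
      have h : ((val u).1 <= mz)%N by exact: (@leq_bigmax_seq _ sZ xpredT (fun u => (val u).1)).
      rewrite /k0 -/mz -/mf -/mr; lia.
    have [/q0 [h _] _] := xP _ kk; case: u h {us kk} => -[k i] Qu h /=.
    by rewrite (h i Qu); exact: nbhs_singleton nVZ.
  - apply: hVF => u us; rewrite -ext_val.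
    have kk : (val u < k0)%N.
      have h : (val u <= mf)%N by exact: (@leq_bigmax_seq _ sF xpredT (fun u => val u)).
      rewrite /k0 -/mz -/mf -/mr; lia.
    have [/q0 [_ h] _] := xP _ kk; rewrite h; last exact: valP u.
    exact: nbhs_singleton nVF.
  apply: hVR => u us; apply: eV; rewrite -ext_val.
  have kk : ((val u).1 < k0)%N.
    have h : ((val u).1 <= mr)%N by exact: (@leq_bigmax_seq _ sR xpredT (fun u => (val u).1)).
      rewrite /k0 -/mz -/mf -/mr; lia.
  have [_ h] := xP _ kk; case: u h {us kk} => -[k j] Qu h; exact: h.
have [O _ HO] := solve 0%N 1 ltr01.
by move=> g; have [|x xg _] := HO g; [right|exists x].
Qed.

End assembly.

(** * From cofinality to the model, and the equivalences *)

Section main.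
Variable R : realType.

Lemma cover_torsion_free m (x : cover R m) n : x *+ n.+1 = 0 -> x = 0.
Proof.
move=> h; have := chomMn (fst_cont_hom _ _) x n.+1; have := chomMn (snd_cont_hom _ _) x n.+1.
rewrite h; case: x {h} => v q /= hq hv; congr pair; last first.
  apply/polyP => i; have := congr1 (fun p : {poly int} => p`_i) hq.
  by rewrite coefMn coef0 => /esym/eqP; rewrite mulrn_eq0 /= => /eqP.
apply: funext => i; have := chomMn (proj_cont_hom R i) v n.+1; rewrite -hv => /esym/eqP.
by rewrite mulrn_eq0 /= => /eqP.
Qed.

Lemma cofinal_model (G : topologicalZmodType) : pro_lie_polish R G ->
  cofinal_lie_kernels R [set N : zmodClosed G | lie_kernels R N /\
    projective_in (lie_polish R) (quotg N)] ->
  exists a b c, top_iso G (projective_model R a b c).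
Proof.
move=> lG cof; have [pG _] := lG.
have cG := polish_complete pG; have sG := polish_separated pG.
have [|N [SN dN sN]] := kernel_tower lG _ cof; first by move=> M [].
have cN k : closed [set` N k] by have [[]] := SN k.
(* The identity of the projective group [quotg (N k)] lifts to its cover, so the lift is injective
   and [phi] has kernel exactly [N k]. *)
have hphi k : exists (m : nat) (phi : G -> cover R m), [/\ cont_hom G (cover R m) phi,
    open_at0 phi, forall v, exists g, phi g = (v, 0) & forall g, g \in N k <-> phi g = 0].
  have [[_ lN] prN] := SN k; have [pN _] := lN.
  have [m [phi [h o f i]]] := projective_cover (fun _ h => h) pN prN lN
    (@cont_hom_id (quotg (N k))) (fun y => ex_intro _ y erefl).
  exists m, (phi \o to_quotg (N k)); split.
  - exact: cont_hom_comp (to_quotg_hom _) h.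
  - by move=> U /(@to_quotg_open0 G (N k)) /o; rewrite image_comp.
  - move=> v; have [u <-] := f v; have [g <-] := to_quotg_surj u; by exists g.
  by move=> g; split=> [/to_quotg0 /= ->|/= /i /to_quotg0 //]; exact: chom0 h.
have T0 : [set: G] 0 by [].
have TB (x y : G) : [set: G] x -> [set: G] y -> [set: G] (x - y) by [].
pose T := subgroup_of T0 TB; have TT x : x \in T by apply/subgroup_ofP.
(* Starting the tower at [G] itself makes the first quotient the bottom level of the splitting. *)
pose K k := if k is k'.+1 then N k' else T.
have cK k : closed [set` K k].
  case: k => //=; have -> : [set` T] = setT by apply/seteqP; split=> x // _; exact: TT.
  exact: closedT.
have dK k : {subset K k.+1 <= K k} by case: k => [|k] x //=; exact: dN.
have tK k g n : g *+ n.+1 \in K k -> g \in K k.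
  case: k => [|k] //=; have [m [phi [h _ _ kphi]]] := hphi k.
  by move=> /kphi; rewrite (chomMn h) => /cover_torsion_free /kphi.
(* One-parameter subgroups of [quotg (N k)] climb to [G] along the tower from [N k] on, each step
   having a kernel inside a Lie group. *)
have lR k f : cont_hom R (quotg (N k)) f ->
    exists2 g, cont_hom R G g & forall t, to_quotg (N k) (g t) = f t.
  move=> hf; have [r rf] := choice (fun t => to_quotg_surj (f t)).
  have [||||||g hg gr] := @tower_lift R G R (fun j => N (j + k)%N) r cG sG.
  - by move=> j; exact: dN.
  - by move=> j; exact: cN.
  - move=> U /sN [j jU]; exists j; apply: subset_trans jU => x.
    have sub i : {subset N (j + i)%N <= N j}.
      by elim: i => [|i IH] y; rewrite ?addn0 // addnS => /dN /IH.
    exact: sub.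
  - move=> j; exists setT => //; apply: lie_chart_loc_vec; apply: lie_polish_chart.
    by have [[]] := SN (j.+1 + k)%N.
  - exact: lifts_real.
  - by under eq_fun do rewrite rf.
  exists g => // t; rewrite -rf; exact/to_quotgP/gr.
have spl k : exists x : nat * (nat -> R -> G) * (nat -> G) * pred nat, splitting (K k) (K k.+1) x.
  have [m [phi [h o f i]]] := hphi k.
  exact: (splitting_exists (cK k) (dK k) h o f i (tK k) (lR k)).
have [D hD] := choice spl.
apply: (assemble cG sG _ dK cK _ hD) => // U /sN [k kU].
by exists k.+1.
Qed.

End main.

Theorem theorem3p51 (R : realType) (G : topologicalZmodType)
    (hG : pro_lie_polish R G) :
  (projective_in (pro_lie_polish R) G <->
     exists a b c : option nat, top_iso G (projective_model R a b c))
  /\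
  (projective_in (pro_lie_polish R) G <->
     cofinal_lie_kernels R
       [set N : zmodClosed G | lie_kernels R N /\
          projective_in (lie_polish R) (quotg N)]).
Proof.
have model_projective : (exists a b c : option nat, top_iso G (projective_model R a b c)) ->
    projective_in (pro_lie_polish R) G.
  move=> [a [b [c iso]]]; apply: (@lifts_projective R) => //.
  exact: lifts_iso (top_iso_sym iso) (@lifts_model R a b c).
split; split.
- by move=> /(projective_cofinal hG) /(cofinal_model hG).
- exact: model_projective.
- exact: projective_cofinal.
- by move=> /(cofinal_model hG) /model_projective.
Qed.
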